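(* Let $u$ be a divergence-free vector field on $\mathbb{R}^d$ with an Osgood modulus of continuity $\varphi$, let $\mu_0$ be a modulus of continuity, and let $\theta$ be the solution of $\partial_t\theta+u\cdot\nabla_x\theta=0$, $\theta(0,\cdot)=\theta_0$. 1. If $\theta_0$ has modulus of continuity $\mu_0$, then $\theta(t)$ has modulus of continuity $\mu_0\circ\mu_{[u]_\varphi,t}$ for every $t\ge 0$. 2. Let $T>0$ and suppose that $A(u):=\int_0^1\frac{\mu_0\circ\mu_{[u]_\varphi,T}(r)}{r}\,dr<\infty$. Suppose that there exists $g\in L^2(\mathbb{R}^d)$ such that $$|\theta_0(x)-\theta_0(y)|\le (g(x)+g(y))\,\mu_0(|x-y|)\qquad\text{for } x,y\in\mathbb{R}^d.$$ Then for every $t\in[0,T]$, $$\int_{B_1(0)}\int_{\mathbb{R}^d}\frac{|\theta(x,t)-\theta(x+h,t)|^2}{|h|^d}\,\bigl(\mu_0\circ\mu_{[u]_\varphi,t}(|h|)\bigr)^{-1}\,dx\,dh\le C\,\|g\|_{L^2(\mathbb{R}^d)}^2\,A(u),$$ where $C>0$ is a constant depending only on $d$.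
   Context: Modulus of continuity: an increasing function $\mu$, positive for positive arguments, with $\lim_{r\to0^+}\mu(r)=0$; here $\mu_0$ is defined on $[0,\infty)$. A function $f$ on $\mathbb{R}^d$ has modulus of continuity $\mu$ if there is $C>0$ with $|f(x)-f(y)|\le C\mu(|x-y|)$ (for $|x-y|$ in the domain of $\mu$). Osgood modulus of continuity: an increasing function $\varphi:(0,m)\to(0,\infty)$, $0<m<\infty$, with $\lim_{r\to0^+}\varphi(r)=0$ and $\int_0^m\frac{dr}{\varphi(r)}=\infty$. The field $u$ has modulus of continuity $\varphi$ if $|u(x,t)-u(y,t)|\le C\varphi(|x-y|)$ for some $C$ and all $t\ge0$ and $0<|x-y|<m$. Define $\mathcal{M}(z)=\int_z^m\frac{dr}{\varphi(r)}$, $R(z)=\exp(-\mathcal{M}(z))$, $[u(t)]_\varphi=\sup_{x\ne y}\frac{|u(x,t)-u(y,t)|}{\varphi(|x-y|)}$ (over $|x-y|$ in the domain of $\varphi$), and $$\mu_{[u]_\varphi,t}(r)=R^{-1}\Bigl(e^{\int_0^t[u(s)]_\varphi ds}\,R(r)\Bigr),$$ for those $r$ for which the right-hand side is defined. Statements about $\mu_{[u]_\varphi,t}(r)$ refer to such $r$; in part 2, the finiteness of $A(u)$ presupposes that $\mu_{[u]_\varphi,T}$ is defined on $(0,1)$. Solution: for such $u$ the flow $\frac{d}{dt}\phi(x,t)=u(\phi(x,t),t)$, $\phi(x,0)=x$, is unique and volume preserving, and the solution is $\theta(x,t)=\theta_0(\phi^{-1}(x,t))$, with $\phi^{-1}(\cdot,t)$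 the inverse of $\phi(\cdot,t)$. *)

(* Defs.v *)
From HB Require Import structures.
From mathcomp Require Import all_boot all_order all_algebra.
From mathcomp Require Import all_classical all_reals all_analysis.

Set Implicit Arguments.
Unset Strict Implicit.
Unset Printing Implicit Defensive.

Import Order.TTheory GRing.Theory Num.Theory.
Import numFieldNormedType.Exports.

Local Open Scope classical_set_scope.
Local Open Scope ring_scope.

(** * Lebesgue measure on R^n

    Points of R^n are row vectors.  The sigma-algebra is the one generated by
    the coordinate maps into the Borel sigma-algebra of R, that is, the Borel
    sigma-algebra of R^n.  Lebesgue measure is the n-fold product of the
    one-dimensional one, transported along R * R^n = R^(n+1). *)

Section measurable_rV.
Context (R : realType) (n : nat).

Let coord : 'I_n -> 'rV[R]_n -> measurableTypeR R := fun i x => x 0 i.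

Let rV_set0 : g_sigma_preimage coord set0.
Proof. exact: sigma_algebra0. Qed.

Let rV_setC A : g_sigma_preimage coord A -> g_sigma_preimage coord (~` A).
Proof. exact: sigma_algebraC. Qed.

Let rV_bigcup (F : (set 'rV[R]_n)^nat) : (forall i, g_sigma_preimage coord (F i)) ->
  g_sigma_preimage coord (\bigcup_i (F i)).
Proof. exact: sigma_algebra_bigcup. Qed.

HB.instance Definition _ := @isMeasurable.Build default_measure_display
  'rV[R]_n (g_sigma_preimage coord) rV_set0 rV_setC rV_bigcup.

Lemma measurable_coord (i : 'I_n) :
  measurable_fun [set: 'rV[R]_n] (fun x => x 0 i : measurableTypeR R).
Proof.
move=> _ Y mY; rewrite setTI; apply: sub_sigma_algebra => /=.
rewrite -bigcup_seq/=; exists i => /=; first by rewrite mem_index_enum.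
by exists Y => //; rewrite setTI.
Qed.

Lemma measurable_fun_coordP d (T : measurableType d) (f : T -> 'rV[R]_n) :
  (forall i, measurable_fun [set: T] (fun x => f x 0 i : measurableTypeR R)) ->
  measurable_fun [set: T] f.
Proof.
move=> mf; apply: (@measurability _ _ _ _ setT f
  (\big[setU/set0]_(i < n) preimage_set_system setT (coord i) measurable)) => //.
move=> _ [B + <-]; rewrite -bigcup_seq => -[i _ [A mA <-]].
by rewrite !setTI -comp_preimage -[X in measurable X]setTI; exact: mf.
Qed.

End measurable_rV.

Section lebesgue_rV.
Context (R : realType).

Definition rV_cons n (p : measurableTypeR R * 'rV[R]_n) : 'rV[R]_n.+1 :=
  row_mx (p.1)%:M p.2.

Lemma measurable_rV_cons n : measurable_fun setT (@rV_cons n).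
Proof.
apply: measurable_fun_coordP => i.
have -> : (fun p => rV_cons p 0 i : measurableTypeR R) =
    (fun p : measurableTypeR R * 'rV[R]_n =>
      match fintype.split (i : 'I_(1 + n)) with
      | inl _ => p.1 | inr j => p.2 0 j end).
  apply/funext => p; rewrite /rV_cons /row_mx mxE.
  by case: fintype.split => // j; rewrite ord1 mxE mulr1n.
case: fintype.split => [_|j]; first exact: measurable_fst.
exact: (measurableT_comp (measurable_coord j) measurable_snd).
Qed.

Section step.
Context n (m : {sigma_finite_measure set 'rV[R]_n -> \bar R}).

Definition lebesgue_cons : set 'rV[R]_n.+1 -> \bar R :=
  pushforward (@lebesgue_measure R \x m)%E (@rV_cons n).

Let lebesgue_cons0 : lebesgue_cons set0 = 0%E.
Proof. by rewrite /lebesgue_cons /pushforward preimage_set0 measure0. Qed.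

Let lebesgue_cons_ge0 A : (0 <= lebesgue_cons A)%E.
Proof. by rewrite /lebesgue_cons /pushforward; exact: measure_ge0. Qed.

Let lebesgue_cons_sigma_additive : semi_sigma_additive lebesgue_cons.
Proof.
move=> F mF tF mUF; rewrite /lebesgue_cons /pushforward preimage_bigcup.
apply: measure_semi_sigma_additive.
- by move=> k; rewrite -[X in measurable X]setTI; exact: measurable_rV_cons.
- apply/trivIsetP => /= i j _ _ ij; rewrite -preimage_setI.
  by move/trivIsetP : tF => /(_ _ _ _ _ ij) ->//; rewrite preimage_set0.
- rewrite -preimage_bigcup -[X in measurable X]setTI.
  exact: measurable_rV_cons.
Qed.

HB.instance Definition _ := isMeasure.Build _ _ _ lebesgue_cons
  lebesgue_cons0 lebesgue_cons_ge0 lebesgue_cons_sigma_additive.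

Let sigma_finite_cons : sigma_finite setT lebesgue_cons.
Proof.
have /sigma_finiteP[F [FT ndF Foo]] := sigma_finiteT (@lebesgue_measure R).
have /sigma_finiteP[G [GT ndG Goo]] := sigma_finiteT m.
have rV_consK : cancel (fun v : 'rV[R]_n.+1 =>
    (lsubmx (v : 'rV_(1 + n)) 0 0 : measurableTypeR R, rsubmx (v : 'rV_(1 + n))))
    (@rV_cons n).
  move=> v; rewrite /rV_cons /= -mx11_scalar.
  exact: (hsubmxK (v : 'rV_(1 + n))).
set unc := (X in cancel X _) in rV_consK.
have unc_rV : cancel (@rV_cons n) unc.
  by case=> x y; rewrite /unc /rV_cons /= row_mxKl row_mxKr mxE mulr1n.
have munc : measurable_fun setT unc.
  apply/measurable_fun_pairP; split => /=.
    rewrite (_ : _ \o _ = (fun v : 'rV[R]_n.+1 => v 0 ord0 : measurableTypeR R)).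
      exact: measurable_coord.
    by apply/funext => v; rewrite /= mxE; congr (v _ _); exact/val_inj.
  apply: measurable_fun_coordP => i.
  rewrite (_ : (fun _ => _) = (fun v : 'rV[R]_n.+1 => v 0 (lift ord0 i) : measurableTypeR R)).
    exact: measurable_coord.
  by apply/funext => v; rewrite /= mxE; congr (v _ _); exact/val_inj.
exists (fun k => unc @^-1` (F k `*` G k)).
  rewrite -preimage_bigcup (_ : \bigcup_k _ = setT) ?preimage_setT//.
  rewrite -setXTT FT GT predeqE => -[x y]; split.
    by move=> [k _ []/= ? ?]; split; exists k.
  move=> [/= [k _ Fkx] [l _ Gly]]; exists (maxn k l) => //; split.
  - by move: x Fkx; exact/subsetPset/ndF/leq_maxl.
  - by move: y Gly; exact/subsetPset/ndG/leq_maxr.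
move=> k; have [mF Fk] := Foo k; have [mG Gk] := Goo k; split.
  by rewrite -[X in measurable X]setTI; apply: munc => //; exact: measurableX.
rewrite /lebesgue_cons /pushforward -comp_preimage.
rewrite (_ : unc \o _ = id); last exact/funext.
by rewrite preimage_id product_measure1E// lte_mul_pinfty// ge0_fin_numE.
Qed.

HB.instance Definition _ := Measure_isSigmaFinite.Build _ _ _ lebesgue_cons
  sigma_finite_cons.
End step.

Fixpoint lebesgue_rV n : {sigma_finite_measure set 'rV[R]_n -> \bar R} :=
  match n with
  | 0 => dirac (0 : 'rV[R]_0)
  | k.+1 => lebesgue_cons (lebesgue_rV k)
  end.

End lebesgue_rV.

(** * Moduli of continuity *)

Section moduli.
Context (R : realType).

(* The library norm on row vectors is the sup norm. *)
Definition enorm d (x : 'rV[R]_d) : R := Num.sqrt (\sum_i x 0 i ^+ 2).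

Definition modulus_of_continuity (mu : R -> R) :=
  [/\ forall r s, 0 <= r -> r <= s -> mu r <= mu s,
      forall r, 0 < r -> 0 < mu r &
      mu r @[r --> 0^'+] --> 0].

(* [dom] is the domain of [mu]. *)
Definition has_modulus d (dom : set R) (mu : R -> R) (f : 'rV[R]_d -> R) :=
  exists C : R, 0 < C /\
    forall x y, dom (enorm (x - y)) -> `|f x - f y| <= C * mu (enorm (x - y)).

(* Only the values of [phi] on (0, m) matter. *)
Definition osgood_modulus (m : R) (phi : R -> R) :=
  [/\ 0 < m,
      forall r s, 0 < r -> r <= s -> s < m -> phi r <= phi s,
      forall r, 0 < r -> r < m -> 0 < phi r,
      phi r @[r --> 0^'+] --> 0 &
      (\int[lebesgue_measure]_(r in `]0%R, m[) ((phi r)^-1)%:E = +oo)%E].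

Definition field_has_modulus d (m : R) (phi : R -> R)
    (u : R -> 'rV[R]_d -> 'rV[R]_d) :=
  exists C : R, forall t x y, 0 <= t -> 0 < enorm (x - y) -> enorm (x - y) < m ->
    enorm (u t x - u t y) <= C * phi (enorm (x - y)).

Definition osgood_M (m : R) (phi : R -> R) (z : R) : R :=
  (\int[lebesgue_measure]_(r in `]z, m[) (phi r)^-1)%R.

Definition osgood_R (m : R) (phi : R -> R) (z : R) : R :=
  expR (- osgood_M m phi z).

(* Inverse of [osgood_R m phi] on (0, m); 0 outside the range. *)
Definition osgood_Rinv (m : R) (phi : R -> R) (y : R) : R :=
  xget 0 [set z | 0 < z < m /\ osgood_R m phi z = y].

Definition field_seminorm d (m : R) (phi : R -> R) (v : 'rV[R]_d -> 'rV[R]_d) : R :=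
  sup [set q | exists x y, 0 < enorm (x - y) < m /\
                 q = enorm (v x - v y) / phi (enorm (x - y))].

Definition flow_factor d (m : R) (phi : R -> R)
    (u : R -> 'rV[R]_d -> 'rV[R]_d) (t : R) : R :=
  expR (\int[lebesgue_measure]_(s in `[0, t]) field_seminorm m phi (u s))%R.

Definition flow_modulus d (m : R) (phi : R -> R)
    (u : R -> 'rV[R]_d -> 'rV[R]_d) (t r : R) : R :=
  osgood_Rinv m phi (flow_factor m phi u t * osgood_R m phi r).

(* The set of r for which [flow_modulus m phi u t r] is defined. *)
Definition flow_modulus_dom d (m : R) (phi : R -> R)
    (u : R -> 'rV[R]_d -> 'rV[R]_d) (t : R) : set R :=
  [set r | 0 < r < m /\
     exists2 z, 0 < z < m & osgood_R m phi z = flow_factor m phi u t * osgood_R m phi r].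

End moduli.

(** * Divergence-free fields and the transport equation *)

Section transport.
Context (R : realType) (d : nat).

Definition C1_compact (psi : 'rV[R]_d -> R) :=
  [/\ forall i x, derivable psi x (delta_mx 0 i),
      forall i, continuous ('D_(delta_mx 0 i) psi : 'rV[R]_d -> R) &
      exists2 K : set 'rV[R]_d, compact K & forall x, ~ K x -> psi x = 0].

(* An Osgood field need not be differentiable in space, so the divergence is
   taken in the weak sense. *)
Definition divergence_free (u : R -> 'rV[R]_d -> 'rV[R]_d) :=
  forall t, 0 <= t -> forall psi, C1_compact psi ->
    (\int[lebesgue_rV R d]_x (\sum_i u t x 0 i * 'D_(delta_mx 0 i) psi x) = 0)%R.

Definition is_flow (u : R -> 'rV[R]_d -> 'rV[R]_d) (X : R -> 'rV[R]_d -> 'rV[R]_d) :=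
  forall x, [/\ X 0 x = x,
    X s x @[s --> 0^'+] --> x &
    forall t : R, 0 < t -> is_derive t 1 (X ^~ x) (u t (X t x))].

(* [theta] is the transport of [theta0] by the flow of [u]:
   theta(x, t) = theta0 (X_t^-1 x). *)
Definition transport_solution (u : R -> 'rV[R]_d -> 'rV[R]_d)
    (theta0 : 'rV[R]_d -> R) (theta : R -> 'rV[R]_d -> R) :=
  exists X Xinv : R -> 'rV[R]_d -> 'rV[R]_d,
    is_flow u X /\
    forall t, 0 <= t -> [/\ cancel (X t) (Xinv t), cancel (Xinv t) (X t) &
                          forall x, theta t x = theta0 (Xinv t x)].

End transport.

(* Main.v *)
(** Volume preservation. If [v] has an Osgood modulus, there is a radial weight
    [beta], flat near 0 and as large as wanted on a small ball, with slope at
    most [8 / phi]. Then [Q (s, x) = smoothstep (16 C (s - T) + beta |x - X_s a|^2)]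
    is a supersolution of the transport equation, and so is a product of such
    functions. As [v] is divergence free, the integral of [1 - Q] decreases,
    which bounds the measure of [X_T K] by that of any neighbourhood of [K].
    Applied to the flow and to the reversed flow, this shows that [X_t^-1]
    preserves Lebesgue measure.

    Modulus. For two trajectories at distance [r s], the upper derivative of
    [M (r s)] is at most [[u s]]. This gives [|X_t^-1 x - X_t^-1 y| <= mu_t |x - y|]
    and part 1. The seminorm need not be measurable in time, so the bound is
    obtained for the lower integral of [[u s]].

    Part 2. At fixed [h], the increment of [theta t] is controlled by
    [g (X_t^-1 x) + g (X_t^-1 (x + h))]; integrate in [x] by volume preservation,
    then in [h]. *)

Require Import Defs.
From mathcomp Require Import all_boot all_order all_algebra.
From mathcomp Require Import ring lra.
From mathcomp Require Import all_classical all_reals all_analysis.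
From mathcomp Require Import measurable_realfun.
Import Order.TTheory GRing.Theory Num.Theory.
Import numFieldNormedType.Exports.
Local Open Scope classical_set_scope.
Local Open Scope ring_scope.
Set Implicit Arguments.
Unset Strict Implicit.
Unset Printing Implicit Defensive.

(** * Euclidean norm and Lebesgue measure *)

Section enorm_theory.
Context (R : realType) (d : nat).
Implicit Types x y : 'rV[R]_d.

(** The obstacle is that [u] is given neither a spatial derivative nor any regularity in time, and
    that [X_t] is only continuous: there is no Jacobian to differentiate. The weak divergence acts
    at one fixed time and on C^1 functions of compact support, so the volume estimate has to be
    phrased with such functions. In the transport of [beta (|x - X_s a|^2)], the error is the
    pairing of the gradient with [v x - v (X_s a)]. At distance [p] it is at most
    [2 C p phi(p) beta'(p^2) <= 16 C], a constant that does not see the height of [beta]. A drift of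
    speed [16 C] absorbs it, and the height [16 C T + 1], which the divergence of the integral of
    [1 / phi] makes available on any small ball, outlasts that drift over [0, T]. The same weight
    along two trajectories yields the continuity of the flow in space. In part 2 the weight is taken
    at time [t] and [A(u)] at time [T]: squaring the increment produces two factors of the modulus
    at [t], one of which cancels with the weight while the other is bounded by its value at [T]. *)

Definition dotp x y : R := \sum_i x 0 i * y 0 i.

Lemma enorm_ge0 x : 0 <= enorm x. Proof. exact: sqrtr_ge0. Qed.

Lemma sqr_enorm x : enorm x ^+ 2 = \sum_i x 0 i ^+ 2.
Proof. by rewrite sqr_sqrtr// sumr_ge0// => i _; exact: sqr_ge0. Qed.

Lemma enorm0 : enorm (0 : 'rV[R]_d) = 0.
Proof. by rewrite /enorm big1 ?sqrtr0// => i _; rewrite mxE expr0n. Qed.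

Lemma enormZ a x : enorm (a *: x) = `|a| * enorm x.
Proof.
rewrite /enorm -sqrtr_sqr -sqrtrM ?sqr_ge0//; congr Num.sqrt.
by rewrite mulr_sumr; apply: eq_bigr => i _; rewrite mxE exprMn.
Qed.

Lemma enormN x : enorm (- x) = enorm x.
Proof. by rewrite -scaleN1r enormZ normrN1 mul1r. Qed.

Lemma enormB x y : enorm (x - y) = enorm (y - x).
Proof. by rewrite -enormN opprB. Qed.

Lemma coord_le_enorm x i : `|x 0 i| <= enorm x.
Proof.
rewrite -(ler_pXn2r (n := 2))// ?nnegrE ?enorm_ge0// sqr_enorm real_normK ?num_real//.
by rewrite (bigD1 i)//= lerDl sumr_ge0// => j _; exact: sqr_ge0.
Qed.

Lemma enorm_eq0 x : (enorm x == 0) = (x == 0).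
Proof.
apply/eqP/eqP => [x0|->]; last exact: enorm0.
apply/rowP => i; rewrite mxE; apply/eqP; rewrite -normr_le0 -x0.
exact: coord_le_enorm.
Qed.

Lemma enorm_gt0 x : (0 < enorm x) = (x != 0).
Proof. by rewrite lt_def enorm_ge0 enorm_eq0 andbT. Qed.

Lemma dotp_le x y : `|dotp x y| <= enorm x * enorm y.
Proof.
have [/eqP|y0] := eqVneq (enorm y) 0.
  rewrite enorm_eq0 => /eqP ->; rewrite enorm0 mulr0 /dotp big1 ?normr0//.
  by move=> i _; rewrite mxE mulr0.
have {}y0 : 0 < enorm y by rewrite lt_def y0 enorm_ge0.
rewrite -(ler_pXn2r (n := 2))// ?nnegrE ?mulr_ge0 ?enorm_ge0//.
rewrite real_normK ?num_real// exprMn.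
(* The coefficient of the projection of [x] on [y], for which [|x - a y|^2] is smallest. *)
pose a := dotp x y / enorm y ^+ 2.
have : 0 <= \sum_i (x 0 i - a * y 0 i) ^+ 2 by rewrite sumr_ge0// => i _; exact: sqr_ge0.
have -> : \sum_i (x 0 i - a * y 0 i) ^+ 2 =
    enorm x ^+ 2 - 2 * a * dotp x y + a ^+ 2 * enorm y ^+ 2.
  rewrite !sqr_enorm /dotp !mulr_sumr -sumrB -big_split; apply: eq_bigr => i _ /=.
  by ring.
have -> : enorm x ^+ 2 - 2 * a * dotp x y + a ^+ 2 * enorm y ^+ 2 =
    enorm x ^+ 2 - dotp x y ^+ 2 / enorm y ^+ 2 by rewrite /a; field; rewrite gt_eqF.
by rewrite subr_ge0 ler_pdivrMr// exprn_gt0.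
Qed.

Lemma ler_enormD x y : enorm (x + y) <= enorm x + enorm y.
Proof.
rewrite -(ler_pXn2r (n := 2))// ?nnegrE ?addr_ge0 ?enorm_ge0//.
have -> : enorm (x + y) ^+ 2 = enorm x ^+ 2 + 2 * dotp x y + enorm y ^+ 2.
  rewrite !sqr_enorm /dotp mulr_sumr -!big_split; apply: eq_bigr => i _ /=.
  by rewrite mxE; ring.
have := le_trans (ler_norm _) (dotp_le x y).
by rewrite sqrrD -mulr_natl; lra.
Qed.

Lemma ler_enorm_dist x y : `|enorm x - enorm y| <= enorm (x - y).
Proof.
have := ler_enormD (x - y) y; have := ler_enormD (y - x) x.
by rewrite !subrK (enormB y) ler_norml => *; lra.
Qed.

Lemma norm_le_enorm x : `|x| <= enorm x.
Proof.
rewrite [leLHS]/Num.Def.normr/= mx_normrE; apply: bigmax_le; first exact: enorm_ge0.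
by move=> -[i j] _; rewrite ord1; exact: coord_le_enorm.
Qed.

Lemma coord_le_norm x i : `|x 0 i| <= `|x|.
Proof. by rewrite [leRHS]/Num.Def.normr/= mx_normrE; exact: (le_bigmax _ _ (0, i)). Qed.

Lemma enorm_le_norm x : enorm x <= d%:R * `|x|.
Proof.
rewrite -(ler_pXn2r (n := 2))// ?nnegrE ?mulr_ge0 ?enorm_ge0// sqr_enorm exprMn.
apply: (@le_trans _ _ (\sum_(i < d) `|x| ^+ 2)).
  apply: ler_sum => i _; rewrite -(real_normK (num_real (x 0 i))).
  by rewrite ler_pXn2r// ?nnegrE//; exact: coord_le_norm.
rewrite sumr_const card_ord -[leLHS]mulr_natl ler_wpM2r ?sqr_ge0//.
by rewrite -natrX ler_nat; case: d => // k; rewrite leq_pmulr.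
Qed.

Lemma enorm_ballP x (A : set 'rV[R]_d) :
  nbhs x A <-> exists2 e, 0 < e & forall y, enorm (x - y) < e -> A y.
Proof.
split => [/nbhs_ballP[e /= e0 eA]|[e e0 eA]].
  exists e => // y xy; apply: eA; rewrite -ball_normE /=.
  exact: le_lt_trans (norm_le_enorm _) xy.
(* [d.+1] in place of [d] keeps the radius positive in dimension 0. *)
have e0' : 0 < e / d.+1%:R by rewrite divr_gt0// ltr0Sn.
apply/nbhs_ballP; exists (e / d.+1%:R) => //= y; rewrite -ball_normE /= => xy.
apply: eA; apply: le_lt_trans (enorm_le_norm _) _.
apply: (@le_lt_trans _ _ (d.+1%:R * `|x - y|)).
  by rewrite ler_wpM2r// ler_nat.
by rewrite mulrC -ltr_pdivlMr ?ltr0Sn.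
Qed.

Lemma enorm_continuous : continuous (@enorm R d).
Proof.
move=> x A /= /(nbhs_ballP (enorm x))[e /= e0 eA]; apply/enorm_ballP.
exists e => // y xy; apply: eA; rewrite -ball_normE /=.
exact: le_lt_trans (ler_enorm_dist _ _) xy.
Qed.

Lemma measurable_enorm : measurable_fun setT (@enorm R d : _ -> measurableTypeR R).
Proof.
apply: (measurableT_comp (f := @Num.sqrt R)).
  by apply: nondecreasing_measurable => // x y; exact: ler_wsqrtr.
apply: measurable_sum => i; apply: measurable_funX; exact: measurable_coord.
Qed.

End enorm_theory.

(** * Boxes and Borel sets of R^n *)

Section cbox.
Context (R : realType) (n : nat).
Implicit Types (a b x : 'rV[R]_n).

(** Closed boxes are compact, stable under intersection and generate the sigma-algebra. Volume
    estimates for compact sets therefore extend to all measurable sets through them. *)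
Definition cbox a b : set 'rV[R]_n := [set x | forall i, a 0 i <= x 0 i <= b 0 i].

Definition cboxes : set (set 'rV[R]_n) := [set A | exists a b, A = cbox a b].

Lemma cbox_compact a b : compact (cbox a b).
Proof.
have -> : cbox a b = [set x | forall i, `[a 0 i, b 0 i]%classic (x 0 i)].
  by apply/seteqP; split => x /= h i; have := h i; rewrite in_itv.
exact: (rV_compact (fun i => @segment_compact _ (a 0 i) (b 0 i))).
Qed.

Lemma measurable_cbox a b : measurable (cbox a b).
Proof.
have -> : cbox a b = \bigcap_(i in [set: 'I_n])
    ((fun x => x 0 i : measurableTypeR R) @^-1` `[a 0 i, b 0 i]%classic).
  apply/seteqP; split => x /= h i; first by move=> _; rewrite /= in_itv /=; exact: h.
  by have := h i I; rewrite /= in_itv.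
apply: fin_bigcap_measurable => // i _; rewrite -[X in measurable X]setTI.
exact: measurable_coord.
Qed.

Lemma cbox_bigcup : \bigcup_(k : nat) cbox (const_mx (- k%:R)) (const_mx k%:R) = setT.
Proof.
apply/seteqP; split => // x _; exists (Num.truncn `|x|).+1 => // i; rewrite !mxE -ler_norml.
by apply: le_trans (coord_le_norm _ _) _; rewrite ltW// truncnS_gt.
Qed.

Lemma cboxes_setI : setI_closed cboxes.
Proof.
move=> _ _ [a [b ->]] [a' [b' ->]].
exists (\row_i Num.max (a 0 i) (a' 0 i)), (\row_i Num.min (b 0 i) (b' 0 i)).
apply/seteqP; split => x /=.
  by move=> [h h'] i; rewrite !mxE ge_max le_min; case/andP: (h i) => p1 p2;
    case/andP: (h' i) => p3 p4; rewrite p1 p2 p3 p4.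
by move=> h; split => i; have := h i; rewrite !mxE ge_max le_min =>
  /andP[/andP[p1 p2] /andP[p3 p4]]; apply/andP.
Qed.

Lemma measurable_cboxesE : (measurable : set (set 'rV[R]_n)) = <<s cboxes >>.
Proof.
apply/seteqP; split; last first.
  apply: smallest_sub; first exact: sigma_algebra_measurable.
  by move=> _ [a [b ->]]; exact: measurable_cbox.
apply: smallest_sub; first exact: smallest_sigma_algebra.
move=> A; rewrite -bigcup_seq => -[i _].
have -> : @measurable _ (measurableTypeR R) = (@RGenCInfty.G R).-sigma.-measurable.
  exact: RGenCInfty.measurableE.
rewrite /= -g_sigma_preimageE; move: A; apply: smallest_sub; first exact: smallest_sigma_algebra.
move=> _ [_ [r] -> <-]; rewrite setTI.
(* A half-space is an increasing union of boxes; only the lower bound of coordinate [i] stays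
   fixed. *)
rewrite (_ : _ @^-1` _ = \bigcup_(k : nat)
    cbox (\row_j if j == i then r else - k%:R) (const_mx k%:R)); last first.
  apply/seteqP; split => x /=.
    rewrite in_itv /= andbT => rx; exists (Num.truncn `|x|).+1 => // j; rewrite !mxE.
    have := le_trans (coord_le_norm x j) (ltW (truncnS_gt `|x|)).
    by rewrite ler_norml => /andP[h1 ->]; case: eqP => [->|_]; rewrite andbT.
  by move=> [k _ /(_ i)]; rewrite !mxE eqxx in_itv /= andbT => /andP[].
apply: sigma_algebra_bigcup => k; apply: sub_sigma_algebra.
by eexists; eexists.
Qed.

Lemma cbox_measure_unique (m1 m2 : {measure set 'rV[R]_n -> \bar R}) :
  (forall a b, m1 (cbox a b) = m2 (cbox a b)) ->
  (forall a b, m1 (cbox a b) < +oo)%E ->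
  forall A, measurable A -> m1 A = m2 A.
Proof.
move=> m12 m1oo A mA.
apply: (measure_unique cboxes (fun k => cbox (const_mx (- k%:R)) (const_mx k%:R))) => //.
- exact: measurable_cboxesE.
- exact: cboxes_setI.
- by move=> k; eexists; eexists.
- exact: cbox_bigcup.
- by move=> _ [a [b ->]].
Qed.

(** The sigma-algebra comes from the coordinates, not from the topology. An open set is the union of
    the countably many boxes with rational corners that it contains. *)
Lemma open_measurable_rV (U : set 'rV[R]_n) : open U -> measurable U.
Proof.
move=> oU.
pose q2r (v : 'rV[rat]_n) : 'rV[R]_n := map_mx ratr v.
pose F (v : 'rV[rat]_n * 'rV[rat]_n) := if `[< cbox (q2r v.1) (q2r v.2) `<=` U >]
   then cbox (q2r v.1) (q2r v.2) else set0.
have -> : U = \bigcup_v F v.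
  apply/seteqP; split => [x Ux|x [v _]]; last first.
    by rewrite /F; case: asboolP => // h; exact: h.
  have /nbhs_ballP[e /= e0 eU] := open_nbhs_nbhs (conj oU Ux).
  have ex (i : 'I_n) (a b : R) : a < b -> {q : rat | a < ratr q < b}.
    move=> ab; apply: cid; have [q] := rat_in_itvoo ab.
    by rewrite in_itv /= => h; exists q.
  have h1 i : x 0 i - e < x 0 i by rewrite ltrBlDr ltrDl.
  have h2 i : x 0 i < x 0 i + e by rewrite ltrDl.
  pose l : 'rV[rat]_n := \row_i sval (ex i _ _ (h1 i)).
  pose r : 'rV[rat]_n := \row_i sval (ex i _ _ (h2 i)).
  exists (l, r) => //; rewrite /F /=.
  have xlr i : x 0 i - e < q2r l 0 i < x 0 i /\ x 0 i < q2r r 0 i < x 0 i + e.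
    rewrite !mxE; split; [exact: (svalP (ex i _ _ (h1 i)))|exact: (svalP (ex i _ _ (h2 i)))].
  have -> : `[< cbox (q2r l) (q2r r) `<=` U >] = true.
    apply/asboolP => y yb; apply: eU; split => // i0 i; rewrite ord1.
    move: (xlr i) (yb i) => [/andP[] + + /andP[]] + + /andP[].
    by rewrite /ball /= ltr_norml => *; apply/andP; split; lra.
  by move=> i; move: (xlr i) => [/andP[_ /ltW ->] /andP[/ltW -> _]].
apply: countable_bigcupT_measurable; first exact: countableP.
by move=> v; rewrite /F; case: asboolP => // _; exact: measurable_cbox.
Qed.

Lemma closed_measurable_rV (A : set 'rV[R]_n) : closed A -> measurable A.
Proof.
by move=> cA; rewrite -(setCK A); apply: measurableC; apply: open_measurable_rV; exact: closed_openC.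
Qed.

Lemma compact_measurable_rV (A : set 'rV[R]_n) : compact A -> measurable A.
Proof.
by move=> cA; apply: closed_measurable_rV; apply: compact_closed => //; exact: norm_hausdorff.
Qed.

Lemma compact_sub_cbox (A : set 'rV[R]_n) : compact A ->
  exists2 k : R, 0 < k & A `<=` cbox (const_mx (- k)) (const_mx k).
Proof.
move=> /compact_bounded/pinfty_ex_gt0[k k0 kA]; exists k => // x /kA xk i.
by rewrite !mxE -ler_norml (le_trans (coord_le_norm _ _)).
Qed.

Lemma continuous_measurable_rV (f : 'rV[R]_n -> R) :
  continuous f -> measurable_fun setT (f : _ -> measurableTypeR R).
Proof.
move=> cf; apply: (measurability (@RGenOpens.G R)).
  exact: RGenOpens.measurableE.
move=> _ [_ [a [b ->]] <-]; rewrite setTI; apply: open_measurable_rV.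
by apply: open_comp => [x _|]; [exact: cf|exact: interval_open].
Qed.

Lemma continuous_measurable_rV_rV m (f : 'rV[R]_n -> 'rV[R]_m) :
  continuous f -> measurable_fun setT f.
Proof.
move=> cf; apply: measurable_fun_coordP => i; apply: continuous_measurable_rV => x.
apply: (@continuous_comp _ _ _ f (fun y : 'rV[R]_m => y 0 i)).
  exact: cf.
exact: coord_continuous.
Qed.

End cbox.

(** * Volume of boxes and affine changes of variables *)

Section lebesgue_cbox.
Context (R : realType).

(** The maximum with 0 accounts for empty boxes. *)
Lemma lebesgue_rV_cbox n (a b : 'rV[R]_n) :
  lebesgue_rV R n (cbox a b) = (\prod_i Num.max 0 (b 0 i - a 0 i))%:E.
Proof.
elim: n a b => [|n IH] a b.
  have -> : cbox a b = setT by apply/seteqP; split => // x _ [].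
  by rewrite big_ord0 /= diracE in_setT.
rewrite /= /lebesgue_cons /pushforward.
pose a' : 'rV[R]_n := \row_i a 0 (lift ord0 i).
pose b' : 'rV[R]_n := \row_i b 0 (lift ord0 i).
have E : @rV_cons R n @^-1` cbox a b = `[a 0 ord0, b 0 ord0]%classic `*` cbox a' b'.
  have r0 (p : measurableTypeR R * 'rV[R]_n) : rV_cons p 0 ord0 = p.1.
    rewrite /rV_cons /row_mx mxE; case: fintype.splitP => [j _|j //].
    by rewrite ord1 mxE mulr1n.
  have r1 (p : measurableTypeR R * 'rV[R]_n) i : rV_cons p 0 (lift ord0 i) = p.2 0 i.
    rewrite /rV_cons /row_mx mxE; case: fintype.splitP => [j|j].
      by rewrite ord1 lift0.
    by rewrite lift0 add1n => /eq_add_S/val_inj ->.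
  apply/seteqP; split => p /=.
    move=> h; split; first by have := h ord0; rewrite r0 in_itv.
    by move=> i; have := h (lift ord0 i); rewrite r1 !mxE.
  move=> [h0 h1] i; have [j ->|->] := unliftP ord0 i.
    by rewrite r1; have := h1 j; rewrite !mxE.
  by rewrite r0; move: h0; rewrite in_itv.
rewrite E product_measure1E//; last exact: measurable_cbox.
rewrite IH big_ord_recl EFinM; congr (_ * _)%E; last first.
  by congr EFin; apply: eq_bigr => i _; rewrite !mxE.
apply: etrans (lebesgue_measure_itv `[a 0 ord0, b 0 ord0]) _ => /=; rewrite lte_fin; case: ltP => ab.
  by rewrite -EFinB; congr EFin; rewrite max_r// subr_ge0 ltW.
by rewrite max_l// subr_le0.
Qed.

Lemma lebesgue_rV_cbox_lty n (a b : 'rV[R]_n) : (lebesgue_rV R n (cbox a b) < +oo)%E.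
Proof. by rewrite lebesgue_rV_cbox ltry. Qed.

Lemma lebesgue_rV_compact_lty n (K : set 'rV[R]_n) :
  compact K -> (lebesgue_rV R n K < +oo)%E.
Proof.
move=> cK; have [k k0 Kk] := compact_sub_cbox cK.
apply: le_lt_trans (lebesgue_rV_cbox_lty (const_mx (- k)) (const_mx k)).
by apply: le_measure => //; rewrite inE; [exact: compact_measurable_rV|exact: measurable_cbox].
Qed.

Definition affine_rV n (c : R) (h : 'rV[R]_n) (x : 'rV[R]_n) : 'rV[R]_n := c *: x + h.

Lemma measurable_affine_rV n (c : R) (h : 'rV[R]_n) : measurable_fun setT (affine_rV c h).
Proof.
apply: measurable_fun_coordP => i.
under eq_fun do rewrite !mxE.
apply: measurable_funD => //; apply: measurable_funM => //.
exact: measurable_coord.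
Qed.

(** The preimage of a box is a box with sides divided by [c], and boxes determine the measure. *)
Lemma pushforward_affine_rV n (c : R) (h : 'rV[R]_n) : 0 < c ->
  forall A, measurable A ->
  pushforward (lebesgue_rV R n) (affine_rV c h) A = ((c^-1 ^+ n)%:E * lebesgue_rV R n A)%E.
Proof.
move=> c0 A mA.
have cn0 : 0 <= c^-1 ^+ n by rewrite exprn_ge0// invr_ge0 ltW.
pose mc := mscale (NngNum cn0) (lebesgue_rV R n).
have mcE B : mc B = ((c^-1 ^+ n)%:E * lebesgue_rV R n B)%E by [].
have box (a b : 'rV[R]_n) : lebesgue_rV R n (affine_rV c h @^-1` cbox a b) =
    ((c^-1 ^+ n)%:E * lebesgue_rV R n (cbox a b))%E.
  rewrite (_ : _ @^-1` _ = cbox (c^-1 *: (a - h)) (c^-1 *: (b - h))); last first.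
    apply/seteqP; split => x xab i; have := xab i;
      rewrite !mxE !(mulrC c^-1) => /andP[h1 h2].
    + rewrite ler_pdivrMr// ler_pdivlMr//; apply/andP; split; lra.
    + move: h1 h2; rewrite ler_pdivrMr// ler_pdivlMr// => h1 h2.
      by apply/andP; split; lra.
  rewrite !lebesgue_rV_cbox -EFinM; congr EFin.
  have -> : c^-1 ^+ n = \prod_(i < n) c^-1 by rewrite prodr_const card_ord.
  rewrite -big_split; apply: eq_bigr => i _ /=.
  rewrite !mxE -mulrBr maxr_pMr ?mulr0 ?invr_ge0 ?ltW//.
  by congr Num.max; lra.
rewrite -mcE; apply: (@cbox_measure_unique R n _ mc) => //.
- exact: measurable_affine_rV.
- move=> mf a b; rewrite /= /pushforward box lebesgue_rV_cbox -EFinM; exact: ltry.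
Qed.

Lemma ge0_integral_affine_rV n (c : R) (h : 'rV[R]_n) (f : 'rV[R]_n -> \bar R) : 0 < c ->
  measurable_fun setT f -> (forall x, 0 <= f x)%E ->
  (\int[lebesgue_rV R n]_x f (c *: x + h)%R = (c^-1 ^+ n)%:E * \int[lebesgue_rV R n]_x f x)%E.
Proof.
move=> c0 mf f0.
have cn0 : 0 <= c^-1 ^+ n by rewrite exprn_ge0// invr_ge0 ltW.
rewrite -(ge0_integral_mscale _ measurableT (NngNum cn0))//.
transitivity (\int[pushforward (lebesgue_rV R n) (affine_rV c h)]_x f x)%E.
  by rewrite ge0_integral_pushforward//=; exact: measurable_affine_rV.
apply: eq_measure_integral => [|mh A mA _]; first exact: measurable_affine_rV.
exact: pushforward_affine_rV.
Qed.

End lebesgue_cbox.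

(** Superlevel sets are intervals. This gives the measurability of [1 / phi] and of [mu0] composed
    with the flow modulus, which are only known to be monotone. *)
Lemma monotone_itv_measurable (R : realType) (D : set R) (f : R -> R) : is_interval D ->
  (forall x y, D x -> D y -> x <= y -> f x <= f y) ->
  measurable_fun (D : set (measurableTypeR R)) (f : _ -> measurableTypeR R).
Proof.
move=> iD fD; apply: (measurability (@RGenCInfty.G R)).
  exact: RGenCInfty.measurableE.
move=> _ [_ [r] -> <-]; apply: is_interval_measurable => s t /=.
rewrite !in_itv /= !andbT => -[Ds fs] [Dt ft] u /andP[su ut].
have Du : D u by apply: (iD s t) => //; rewrite su.
by split => //; rewrite in_itv /= andbT (le_trans fs)// fD.
Qed.

(** * The function [M] of an Osgood modulus *)

Section osgood_M_theory.
Context (R : realType) (m : R) (phi : R -> R) (osg : osgood_modulus m phi).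
Let mu := @lebesgue_measure R.

Lemma osgood_m_gt0 : 0 < m. Proof. by case: osg. Qed.

Lemma osgood_le r s : 0 < r -> r <= s -> s < m -> phi r <= phi s.
Proof. by case: osg => _ + _ _ _; exact. Qed.

Lemma osgood_gt0 r : 0 < r -> r < m -> 0 < phi r.
Proof. by case: osg => _ _ + _ _; exact. Qed.

Lemma osgood_inv_measurable (a b : R) : 0 <= a -> b <= m ->
  measurable_fun (`]a, b[%classic : set (measurableTypeR R))
    (fun r => (phi r)^-1 : measurableTypeR R).
Proof.
move=> a0 bm; rewrite (_ : (fun r => _) = -%R \o (fun r => - (phi r)^-1)); last first.
  by apply/funext => r /=; rewrite opprK.
apply: measurableT_comp => //; apply: monotone_itv_measurable.
  exact: interval_is_interval.
move=> x y; rewrite /= !in_itv /= => /andP[ax xb] /andP[ay yb] xy.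
have x0 := le_lt_trans a0 ax; have ym := lt_le_trans yb bm.
rewrite lerN2 lef_pV2 ?posrE ?osgood_gt0 ?(le_lt_trans xy ym) ?(lt_le_trans x0 xy)//.
exact: osgood_le.
Qed.

Lemma osgood_inv_integral_le (a b : R) : 0 < a -> a < m -> a <= b -> b <= m ->
  (\int[mu]_(r in `]a, b[) ((phi r)^-1)%:E <= ((b - a) / phi a)%:E)%E.
Proof.
move=> a0 am ab bm.
apply: (@le_trans _ _ (\int[mu]_(r in `]a, b[) ((phi a)^-1)%:E)%E).
  apply: ge0_le_integral => //.
  - move=> r /=; rewrite in_itv /= => /andP[ar rb]; rewrite lee_fin invr_ge0 ltW//.
    by rewrite osgood_gt0 ?(lt_trans a0)// (lt_le_trans rb).
  - by apply/measurable_EFinP; apply: osgood_inv_measurable => //; exact: ltW.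
  - move=> r /=; rewrite in_itv /= => /andP[ar rb]; rewrite lee_fin.
    rewrite lef_pV2 ?posrE ?osgood_gt0 ?(lt_trans a0 ar) ?(lt_le_trans rb bm)//.
    by apply: osgood_le => //; [exact: ltW|exact: lt_le_trans bm].
rewrite integral_cst//= lebesgue_measure_itv /= lte_fin mulrC EFinM.
case: ltP => [_|ba]; first by rewrite -EFinB.
by have -> : b = a; [apply/eqP; rewrite eq_le ba ab|rewrite subrr].
Qed.

Lemma osgood_inv_integral_ge (a b : R) : 0 < a -> a < b -> b < m ->
  (((b - a) / phi b)%:E <= \int[mu]_(r in `]a, b[) ((phi r)^-1)%:E)%E.
Proof.
move=> a0 ab bm.
apply: (@le_trans _ _ (\int[mu]_(r in `]a, b[) ((phi b)^-1)%:E)%E).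
  rewrite integral_cst//= lebesgue_measure_itv /= lte_fin ab -EFinB -EFinM.
  by rewrite mulrC.
apply: ge0_le_integral => //.
- by move=> r _; rewrite lee_fin invr_ge0 ltW// osgood_gt0// (lt_trans a0).
- by apply/measurable_EFinP; apply: osgood_inv_measurable => //; exact: ltW.
- move=> r /=; rewrite in_itv /= => /andP[ar rb]; rewrite lee_fin.
  rewrite lef_pV2 ?posrE ?osgood_gt0 ?(lt_trans a0 ar) ?(lt_trans rb bm) ?(lt_trans a0 ab)//.
  by apply: osgood_le => //; [exact: lt_trans ar|exact: ltW].
Qed.

Lemma osgood_M_ge z : m <= z -> osgood_M m phi z = 0.
Proof. by move=> mz; rewrite /osgood_M set_itv_ge ?Rintegral_set0// bnd_simp -leNgt. Qed.

Lemma osgood_ME z : 0 < z -> z < m ->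
  ((osgood_M m phi z)%:E = \int[mu]_(r in `]z, m[) ((phi r)^-1)%:E)%E.
Proof.
move=> z0 zm; rewrite /osgood_M /Rintegral fineK// ge0_fin_numE.
  by apply: le_lt_trans (osgood_inv_integral_le z0 zm (ltW zm) (lexx _)) _; rewrite ltry.
apply: integral_ge0 => r /=; rewrite in_itv /= => /andP[zr rm].
by rewrite lee_fin invr_ge0 ltW// osgood_gt0// (lt_trans z0).
Qed.

Lemma osgood_M_split a b : 0 < a -> a < b -> b < m ->
  ((osgood_M m phi a)%:E = \int[mu]_(r in `]a, b[) ((phi r)^-1)%:E + (osgood_M m phi b)%:E)%E.
Proof.
move=> a0 ab bm; rewrite !osgood_ME ?(lt_trans a0 ab) ?(lt_trans ab bm)//.
have mphi : measurable_fun (`]a, m[%classic : set (measurableTypeR R))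
    (fun r => ((phi r)^-1)%:E).
  by apply/measurable_EFinP; apply: osgood_inv_measurable => //; exact: ltW.
have abm : `]a, m[%classic = `]a, b[ `|` `[b, m[.
  by rewrite -itv_bndbnd_setU// bnd_simp ltW.
rewrite abm ge0_integral_setU//=; first last.
- apply/disj_setPS => y [/=]; rewrite !in_itv /= => /andP[_ yb] /andP[].
  by rewrite leNgt yb.
- move=> r abr; have : `]a, m[%classic r by rewrite abm.
  rewrite /= in_itv /= => /andP[ar rm].
  by rewrite lee_fin invr_ge0 ltW// osgood_gt0// (lt_trans a0).
- by move: mphi; rewrite abm.
congr (_ + _)%E; apply/esym/integral_itv_obnd_cbnd.
by apply: measurable_funS mphi => //; apply: subset_itvr; rewrite bnd_simp ltW.
Qed.

Lemma osgood_M_diff_ge a b : 0 < a -> a < b -> b < m ->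
  (b - a) / phi b <= osgood_M m phi a - osgood_M m phi b.
Proof.
move=> a0 ab bm; rewrite lerBrDr -lee_fin (osgood_M_split a0 ab bm) EFinD leeD2r//.
exact: osgood_inv_integral_ge.
Qed.

(** Beyond [m] the function [M] vanishes, so [b] may lie past [m]: the interval of integration is
    then only shortened. *)
Lemma osgood_M_diff_le a b : 0 < a -> a < m -> a <= b ->
  osgood_M m phi a - osgood_M m phi b <= (b - a) / phi a.
Proof.
move=> a0 am; rewrite le_eqVlt => /predU1P[<-|ab]; first by rewrite !subrr mul0r.
have [bm|mb] := ltP b m.
  rewrite lerBlDr -lee_fin (osgood_M_split a0 ab bm) EFinD leeD2r//.
  by apply: osgood_inv_integral_le => //; exact: ltW.
rewrite (osgood_M_ge mb) subr0 -lee_fin osgood_ME//.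
apply: le_trans (osgood_inv_integral_le a0 am (ltW am) (lexx _)) _.
by rewrite lee_fin ler_wpM2r ?lerB// invr_ge0 ltW// osgood_gt0.
Qed.

Lemma osgood_M_lt a b : 0 < a -> a < b -> b < m -> osgood_M m phi b < osgood_M m phi a.
Proof.
move=> a0 ab bm; rewrite -subr_gt0; apply: lt_le_trans (osgood_M_diff_ge a0 ab bm).
by rewrite divr_gt0 ?subr_gt0// osgood_gt0// (lt_trans a0).
Qed.

Lemma osgood_M_gt0 a : 0 < a -> a < m -> 0 < osgood_M m phi a.
Proof.
move=> a0 am; pose b := (a + m) / 2.
have ab : a < b by rewrite /b; lra.
have bm : b < m by rewrite /b; lra.
apply: le_lt_trans (osgood_M_lt a0 ab bm).
have b0 : 0 < b by exact: lt_trans ab.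
rewrite -lee_fin osgood_ME//; apply: integral_ge0 => r /=; rewrite in_itv /= => /andP[br rm].
by rewrite lee_fin invr_ge0 ltW// osgood_gt0// (lt_trans b0).
Qed.

Lemma osgood_M_le a b : 0 < a -> a <= b -> osgood_M m phi b <= osgood_M m phi a.
Proof.
move=> a0; rewrite le_eqVlt => /predU1P[->//|ab].
have [bm|mb] := ltP b m; first by rewrite ltW// osgood_M_lt.
rewrite (osgood_M_ge mb); have [am|ma] := ltP a m; first by rewrite ltW// osgood_M_gt0.
by rewrite (osgood_M_ge ma).
Qed.

(** This is how the divergence of the integral of [1 / phi] enters: if [M] were at most [K],
    monotone convergence would bound that integral by [K]. *)
Lemma osgood_M_unbounded (K : R) : exists z, [/\ 0 < z, z < m & K < osgood_M m phi z].
Proof.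
have m0 := osgood_m_gt0.
apply: contrapT => /forallNP H.
have MK z : 0 < z -> z < m -> osgood_M m phi z <= K.
  by move=> z0 zm; rewrite leNgt; apply/negP => Kz; exact: (H z).
have [_ _ _ _ ioo] := osg.
(* [n.+2] keeps the left end strictly below [m]. *)
pose F (n : nat) : set (measurableTypeR R) := `]m / n.+2%:R, m[%classic.
have UF : \bigcup_n F n = `]0, m[%classic.
  apply/seteqP; split => [x [n _]|x]; rewrite /F /= !in_itv /= => /andP[h1 h2].
    by rewrite h2 andbT (lt_trans _ h1)// divr_gt0.
  exists (Num.truncn (m / x)) => //; rewrite /= in_itv /= h2 andbT.
  rewrite ltr_pdivrMr// mulrC -ltr_pdivrMr//; apply: lt_trans (truncnS_gt _) _.
  by rewrite ltr_nat.
have mphi : measurable_fun (`]0, m[%classic : set (measurableTypeR R))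
    (fun r => ((phi r)^-1)%:E).
  by apply/measurable_EFinP; apply: osgood_inv_measurable.
have Fsub n : F n `<=` `]0, m[%classic by rewrite -UF; exact: bigcup_sup.
have phi0 x : `]0, m[%classic x -> (0 <= ((phi x)^-1)%:E)%E.
  by rewrite /= in_itv /= => /andP[x0 xm]; rewrite lee_fin invr_ge0 ltW// osgood_gt0.
have Fcvg : (\int[mu]_(x in F i) ((phi x)^-1)%:E @[i --> \oo] --> +oo)%E.
  rewrite -ioo -UF; apply: ge0_nondecreasing_set_cvg_integral.
  - move=> p q pq; rewrite subsetEset; apply: subset_itvr; rewrite bnd_simp.
    by rewrite ler_pM2l// lef_pV2 ?posrE ?ltr0n// ler_nat.
  - by move=> n; exact: measurable_itv.
  - by move=> n; exact: measurable_funS mphi.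
  - by move=> n x /Fsub; exact: phi0.
have : (+oo <= K%:E)%E; last by rewrite leNgt ltry.
rewrite -(cvg_lim _ Fcvg)//; apply: lime_le; first by apply/cvg_ex; exists +oo%E.
apply: nearW => n; rewrite /F -osgood_ME ?lee_fin ?divr_gt0//.
  by apply: MK; rewrite ?divr_gt0// ltr_pdivrMr// ltr_pMr// ltr1n.
by rewrite ltr_pdivrMr// ltr_pMr// ltr1n.
Qed.

End osgood_M_theory.

(** * Criteria for derivatives *)

Section derivative_tools.
Context (R : realType).

Lemma is_derive_cvg (V W : normedModType R) (f : V -> W) (a v : V) (l : W) :
  h^-1 *: (f (h *: v + a) - f a) @[h --> 0^'] --> l -> is_derive a v f l.
Proof. by move=> fl; apply: DeriveDef; [apply/cvg_ex; exists l|exact: cvg_lim]. Qed.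

Lemma is_derive_cvgP (V W : normedModType R) (f : V -> W) (a v : V) (l : W) :
  is_derive a v f l -> h^-1 *: (f (h *: v + a) - f a) @[h --> 0^'] --> l.
Proof. by move=> [] /[swap] <-. Qed.

(** A quadratic bound on the Taylor remainder can be checked case by case, including at the
    junctions of a piecewise polynomial. *)
Lemma is_derive_quad (f : R -> R) (x l K : R) :
  (forall y, `|f y - f x - l * (y - x)| <= K * (y - x) ^+ 2) -> is_derive x 1 f l.
Proof.
move=> fK; apply: is_derive_cvg; apply/cvgrPdist_le => e e0.
have K1 : 0 < `|K| + 1 by rewrite ltr_wpDl.
near=> h.
have h0 : h != 0 by near: h; exact: nbhs_dnbhs_neq.
have -> : l - h^-1 *: (f (h *: 1 + x) - f x) = - (h^-1 * (f (h + x) - f x - l * h)).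
  rewrite /GRing.scale /= mulr1; field; exact: h0.
rewrite normrN normrM normfV mulrC ler_pdivrMr ?normr_gt0//.
have := fK (h + x); rewrite addrK => /le_trans; apply.
apply: (@le_trans _ _ ((`|K| + 1) * h ^+ 2)).
  by rewrite ler_wpM2r ?sqr_ge0// ler_wpDr// ler_norm.
rewrite -real_normK ?num_real// expr2 mulrA ler_wpM2r// -ler_pdivlMl//.
near: h; apply: dnbhs0_le; by rewrite mulr_gt0// invr_gt0.
Unshelve. all: by end_near. Qed.

(** Reduces a partial derivative to the derivative along a curve, so that the one-variable chain
    rule applies. *)
Lemma is_derive_line (V W : normedModType R) (f : V -> W) (a v : V) (l : W) :
  is_derive (0 : R) 1 (fun h => f (h *: v + a)) l -> is_derive a v f l.
Proof.
move=> /is_derive_cvgP h; apply: is_derive_cvg.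
apply: cvg_trans h; apply: near_eq_cvg; near=> t.
by rewrite addr0 scale0r add0r scaler1.
Unshelve. all: by end_near. Qed.

Lemma is_derive_coord n (g : R -> 'rV[R]_n) (t : R) (l : 'rV[R]_n) i :
  is_derive t 1 g l -> is_derive t 1 (fun s => g s 0 i) (l 0 i).
Proof.
move=> [dg <-]; rewrite derive_mx// mxE; apply: DeriveDef => //.
exact: (derivable_mxP _ _ _).1.
Qed.

Lemma is_derive_continuous (f : R -> R) (x l : R) : is_derive x 1 f l -> {for x, continuous f}.
Proof. by move=> [df _]; apply: differentiable_continuous; apply/derivable1_diffP. Qed.

Lemma bounded_derive_lipschitz (f df : R -> R) (K : R) :
  (forall x : R, is_derive x 1 f (df x)) -> (forall x, `|df x| <= K) ->
  forall x y, `|f x - f y| <= K * `|x - y|.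
Proof.
move=> fdf dfK; suff H x y : x <= y -> `|f x - f y| <= K * `|x - y|.
  move=> x y; have [/H//|/ltW/H] := leP x y.
  by rewrite distrC (distrC y).
move=> xy; rewrite distrC (distrC x).
have [c _ ->] : exists2 c : R, c \in `[x, y] & f y - f x = df c * (y - x).
  apply: MVT_segment => // z; apply/continuous_subspaceT => w.
  exact: is_derive_continuous.
by rewrite normrM ler_wpM2r.
Qed.

End derivative_tools.

(** * A C^1 step function *)

Section smoothstep.
Context (R : realType).
Implicit Types x y : R.

Definition posq x : R := Num.max 0 x ^+ 2.

Lemma is_derive_posq x : is_derive x 1 posq (2 * Num.max 0 x).
Proof.
apply: (is_derive_quad (K := 1)) => y; rewrite mul1r /posq ler_norml.
have := sqr_ge0 (y - x); have := sqr_ge0 x; have := sqr_ge0 y.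
case: (ltP 0 x) => hx; case: (ltP 0 y) => hy; rewrite ?expr0n /= => h1 h2 h3; apply/andP.
- by split; nra.
- have : x * y <= 0 by rewrite pmulr_rle0.
  by split; nra.
- have : x * y <= 0 by rewrite pmulr_lle0.
  by split; nra.
- by split; nra.
Qed.

(** A step from 0 on [x <= 0] to 1 on [x >= 1], made of two squared positive parts. It is C^1, which
    is the smoothness asked of test functions in [C1_compact]. *)
Definition smoothstep x : R := 1 - posq (1 - posq x).
Definition dsmoothstep x : R := 4 * Num.max 0 (1 - posq x) * Num.max 0 x.

Lemma is_derive_smoothstep x : is_derive x 1 smoothstep (dsmoothstep x).
Proof.
have h1 := is_derive_posq x.
have h2 : is_derive x 1 (fun x => 1 - posq x) (0 - 2 * Num.max 0 x) by exact: is_deriveB.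
have h3 := @is_derive1_comp _ posq (fun x => 1 - posq x) x _ _ (is_derive_posq (1 - posq x)) h2.
rewrite /smoothstep (_ : dsmoothstep x =
  0 - (2 * Num.max 0 (1 - posq x) * (0 - 2 * Num.max 0 x))); last first.
  by rewrite /dsmoothstep; ring.
exact: is_deriveB.
Qed.

Lemma continuous_dsmoothstep : continuous dsmoothstep.
Proof.
have cmax : continuous (fun x : R => Num.max 0 x).
  rewrite (_ : (fun x => _) = (fun x => (x + `|x|) / 2)); last first.
    by apply/funext => x; case: (ltP 0 x) => x0; [rewrite gtr0_norm//|rewrite ler0_norm//]; lra.
  move=> x; apply: cvgM; last exact: cvg_cst.
  apply: cvgD; first exact: cvg_id.
  exact: norm_continuous.
move=> x; apply: cvgM; last exact: cmax.
apply: cvgM; first exact: cvg_cst.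
apply: (@continuous_comp _ _ _ (fun x => 1 - posq x) (fun x => Num.max 0 x)); last exact: cmax.
apply: cvgB; first exact: cvg_cst.
exact: (is_derive_continuous (is_derive_posq x)).
Qed.

Lemma smoothstep_le0 x : x <= 0 -> smoothstep x = 0.
Proof.
move=> x0; rewrite /smoothstep /posq [Num.max 0 x]max_l// expr0n /= subr0 max_r ?ler01//.
by rewrite expr1n subrr.
Qed.

Lemma smoothstep_ge1 x : 1 <= x -> smoothstep x = 1.
Proof.
move=> x1; rewrite /smoothstep /posq [Num.max 0 x]max_r ?(le_trans ler01)//.
rewrite max_l ?expr0n ?subr0// subr_le0; nra.
Qed.

Lemma smoothstep_itv x : 0 <= smoothstep x <= 1.
Proof.
rewrite /smoothstep subr_ge0 gerBl sqr_ge0 andbT.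
have : 0 <= posq x by exact: sqr_ge0.
rewrite {2}/posq; case: (ltP 0 (1 - posq x)) => h1 h2; nra.
Qed.

Lemma dsmoothstep_ge0 x : 0 <= dsmoothstep x.
Proof. by rewrite /dsmoothstep !mulr_ge0// le_max lexx. Qed.

Lemma dsmoothstep_le x : dsmoothstep x <= 4.
Proof.
rewrite /dsmoothstep /posq; have [x0|x0] := leP x 0.
  by rewrite mulr0 ler0n.
have [x1|x1] := leP (1 - x ^+ 2) 0.
  by rewrite mulr0 mul0r ler0n.
have : x <= 1 by rewrite leNgt; apply/negP => ?; nra.
by move=> ?; nra.
Qed.

Lemma dsmoothstep_eq0 x : ~~ (0 < x < 1) -> dsmoothstep x = 0.
Proof.
rewrite negb_and -!leNgt => /orP[x0|x1]; rewrite /dsmoothstep /posq.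
  by rewrite (max_l x0) mulr0.
rewrite [Num.max 0 x]max_r ?(le_trans ler01)// max_l ?mulr0 ?mul0r//.
rewrite subr_le0; nra.
Qed.

Lemma smoothstep_lipschitz x y : `|smoothstep x - smoothstep y| <= 4 * `|x - y|.
Proof.
apply: (@bounded_derive_lipschitz _ _ dsmoothstep); first exact: is_derive_smoothstep.
by move=> z; rewrite ger0_norm ?dsmoothstep_ge0 ?dsmoothstep_le.
Qed.

End smoothstep.

(** * The radial weight *)

Section osgood_potential.
Context (R : realType) (m : R) (phi : R -> R) (osg : osgood_modulus m phi).

(** The slopes of the steps must not add up over the scales. They are supported on disjoint ranges,
    so at most one term of the sum is nonzero. *)
Lemma ler_sum_single (t : nat -> R) (B : R) n : 0 <= B -> (forall k, t k <= B) ->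
  (forall j k, (j < k)%N -> t j != 0 -> t k != 0 -> False) -> \sum_(k < n) t k <= B.
Proof.
move=> B0 tB tt; elim: n => [|n IH]; first by rewrite big_ord0.
rewrite big_ord_recr /=; have [->|tn] := eqVneq (t n) 0; first by rewrite addr0.
rewrite big1 ?add0r// => i _; apply/eqP/negPn/negP => ti; exact: (tt i n).
Qed.

Let r (r0 : R) k : R := r0 / 2 ^+ k.
Let c r0 k := r r0 k / phi (2 * r r0 k).

Let r_gt0 r0 k : 0 < r0 -> 0 < r r0 k.
Proof. by move=> h; rewrite divr_gt0// exprn_gt0. Qed.

Let rS r0 k : r r0 k = 2 * r r0 k.+1.
Proof. by rewrite /r exprS; field; rewrite expf_eq0 /= pnatr_eq0 andbF. Qed.

Let r_le r0 j k : 0 < r0 -> (j <= k)%N -> r r0 k <= r r0 j.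
Proof.
move=> r0_gt0 jk; rewrite /r ler_pM2l// lef_pV2 ?posrE ?exprn_gt0//.
by rewrite ler_eXn2l// ltr1n.
Qed.

(** A condensation argument: from [2 r_k] down to [2 r_(k+1)], [M] grows by at most the width
    [2 r_(k+1)] over [phi (2 r_(k+1))], which is twice the height of a step. *)
Let sum_c_ge r0 n : 0 < r0 -> 2 * r0 < m ->
  osgood_M m phi (2 * r r0 n) - osgood_M m phi (2 * r r0 0) <= 2 * \sum_(k < n.+1) c r0 k.
Proof.
move=> r0_gt0 r0m.
have rm k : 2 * r r0 k < m.
  apply: le_lt_trans r0m; rewrite ler_pM2l//.
  by have := r_le r0_gt0 (leq0n k); rewrite {2}/r expr0 divr1.
have c0 k : 0 <= c r0 k.
  by rewrite divr_ge0 ?ltW ?r_gt0// (osgood_gt0 osg)// mulr_gt0// r_gt0.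
elim: n => [|n IH]; first by rewrite subrr mulr_ge0// sumr_ge0.
rewrite big_ord_recr /= mulrDr.
have : osgood_M m phi (2 * r r0 n.+1) - osgood_M m phi (2 * r r0 n) <= 2 * c r0 n.+1.
  have h0 : 0 < 2 * r r0 n.+1 by rewrite mulr_gt0// r_gt0.
  apply: le_trans (osgood_M_diff_le osg h0 (rm _) _) _.
    by rewrite ler_pM2l// r_le.
  rewrite /c mulrA ler_wpM2r ?invr_ge0 ?(ltW (osgood_gt0 osg _ _))//.
  by rewrite (rS r0 n); lra.
by lra.
Qed.

Let sum_c_unbounded r0 K : 0 < r0 -> 2 * r0 < m -> exists n, K <= \sum_(k < n) c r0 k.
Proof.
move=> r0_gt0 r0m.
have [z [z0 zm Kz]] := osgood_M_unbounded osg (2 * K + osgood_M m phi (2 * r r0 0)).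
(* Since [2 ^ n > n], the scale [2 r_n] lies below [z], where [M] is already large. *)
pose n := (Num.truncn (2 * r0 / z)).+1; exists n.+1.
have := sum_c_ge n r0_gt0 r0m.
suff : osgood_M m phi z <= osgood_M m phi (2 * r r0 n).
  move: Kz; lra.
apply: (osgood_M_le osg); first by rewrite mulr_gt0// r_gt0.
rewrite /r mulrA ler_pdivrMr ?exprn_gt0// [leRHS]mulrC -ler_pdivrMr//.
apply: le_trans (ltW (truncnS_gt _)) _.
by rewrite -natrX ler_nat; apply: ltnW; exact: ltn_expl.
Qed.

(* A radial weight, smooth and flat near 0, growing by an arbitrarily large
   amount on an arbitrarily small ball, with slope at most [8 / phi]: a sum of
   steps at dyadic scales [r_k] of heights [r_k / phi (2 r_k)], which diverges
   by the Osgood condition. *)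
Lemma osgood_potential (e K : R) : 0 < e -> exists beta dbeta : R -> R, exists s L : R,
  [/\ 0 < s, forall y : R, is_derive y 1 beta (dbeta y), continuous dbeta,
      forall y, 0 <= dbeta y & forall y, dbeta y <= L] /\
  [/\ forall y, y <= s -> beta y = 0, forall y, e <= y -> K <= beta y,
      forall y, e <= y -> dbeta y = 0, forall y, 0 <= beta y &
      forall p, 0 < p -> p < m -> dbeta (p ^+ 2) * p * phi p <= 8].
Proof.
move=> e0; have m0 := osgood_m_gt0 osg.
(* The first bound completes every step before [e]; the second keeps [2 r_k] in the domain of
   [phi]. *)
pose r0 := Num.min (Num.sqrt e / 2) (m / 4).
have r0_gt0 : 0 < r0 by rewrite lt_min !divr_gt0 ?sqrtr_gt0.
have r0m : 2 * r0 < m.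
  have : r0 <= m / 4 by rewrite ge_min lexx orbT.
  by lra.
have r0e : 4 * r0 ^+ 2 <= e.
  have h : r0 <= Num.sqrt e / 2 by rewrite ge_min lexx.
  have := sqr_sqrtr (ltW e0); have := sqrtr_ge0 e; nra.
have [n Kn] := sum_c_unbounded K r0_gt0 r0m.
have rk0 k : 0 < r r0 k := r_gt0 k r0_gt0.
have rkr0 k : r r0 k <= r0.
  by apply: le_trans (r_le r0_gt0 (leq0n k)) _; rewrite /r expr0 divr1.
have rkm k : 2 * r r0 k < m by apply: le_lt_trans r0m; rewrite ler_pM2l.
have phik k : 0 < phi (2 * r r0 k) by apply: (osgood_gt0 osg); rewrite ?mulr_gt0.
have ck0 k : 0 < c r0 k by rewrite divr_gt0.
(* As a function of [y = p^2], the step of scale [r_k] rises only for [r_k^2 < y < 2 r_k^2]. *)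
pose arg y k := y / r r0 k ^+ 2 - 1.
pose beta y := \sum_(k < n) c r0 k * smoothstep (arg y k).
pose dbeta y := \sum_(k < n) c r0 k * (dsmoothstep (arg y k) * (r r0 k ^+ 2)^-1).
have arg_ge1 y k : e <= y -> 1 <= arg y k.
  move=> ey; rewrite lerBrDr ler_pdivlMr ?exprn_gt0//.
  have := rkr0 k; have := rk0 k; nra.
exists beta, dbeta, (r r0 n ^+ 2), (\sum_(k < n) c r0 k * (4 * (r r0 k ^+ 2)^-1)).
have r2 k : 0 <= (r r0 k ^+ 2)^-1 by rewrite invr_ge0 sqr_ge0.
split; split.
- by rewrite exprn_gt0.
- move=> y; rewrite /beta /dbeta.
  have -> : (fun y => \sum_(k < n) c r0 k * smoothstep (arg y k)) =
      \sum_(k < n) (fun y => c r0 k * smoothstep (arg y k)).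
    by apply/funext => z; rewrite fct_sumE.
  apply: is_derive_sum => k.
  apply: is_deriveZ.
  have da : is_derive y (1 : R) (fun y => arg y k) (r r0 k ^+ 2)^-1.
    rewrite /arg -[X in is_derive _ _ _ X]subr0.
    apply: is_deriveB; rewrite (_ : (fun y => _) = (r r0 k ^+ 2)^-1 \*: id).
      by rewrite -[X in is_derive _ _ _ X]mulr1; exact: is_deriveZ.
    by apply/funext => z /=; rewrite mulrC.
  exact: (@is_derive1_comp _ _ (fun y => arg y k) y _ _ (is_derive_smoothstep (arg y k)) da).
- apply: (continuous_big (x0 := 0) (op := +%R)) => [|k _ y]; first exact: add_continuous.
  apply: cvgM; first exact: cvg_cst.
  apply: cvgM; last exact: cvg_cst.
  apply: (@continuous_comp _ _ _ (arg ^~ k) (@dsmoothstep R)).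
    by apply: cvgB; [apply: cvgM; [exact: cvg_id|exact: cvg_cst]|exact: cvg_cst].
  exact: continuous_dsmoothstep.
- move=> y; apply: sumr_ge0 => k _; apply: mulr_ge0; first exact: ltW.
  by apply: mulr_ge0; [exact: dsmoothstep_ge0|exact: r2].
- by move=> y; apply: ler_sum => k _; rewrite ler_pM2l// ler_wpM2r// dsmoothstep_le.
- move=> y yr; apply: big1 => k _; rewrite smoothstep_le0 ?mulr0//.
  rewrite subr_le0 ler_pdivrMr ?exprn_gt0// mul1r (le_trans yr)//.
  by rewrite lerXn2r ?nnegrE ?(ltW (rk0 _))// r_le// ltnW.
- move=> y ey; apply: le_trans Kn _; apply: ler_sum => k _.
  by rewrite smoothstep_ge1 ?mulr1// arg_ge1.
- move=> y ey; apply: big1 => k _; rewrite dsmoothstep_eq0 ?mul0r ?mulr0//.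
  by rewrite negb_and -!leNgt arg_ge1// orbT.
- move=> y; apply: sumr_ge0 => k _; apply: mulr_ge0; first exact: ltW.
  by case/andP: (smoothstep_itv (arg y k)).
- move=> p p0 pm; rewrite /dbeta !mulr_suml.
  have nz k : dsmoothstep (arg (p ^+ 2) k) != 0 -> r r0 k < p /\ p ^+ 2 < 2 * r r0 k ^+ 2.
    move=> h; have : 0 < arg (p ^+ 2) k < 1.
      by apply/negPn/negP => /dsmoothstep_eq0 h0; rewrite h0 eqxx in h.
    move=> /andP[h1 h2].
    have {}h1 : r r0 k ^+ 2 < p ^+ 2.
      by move: h1; rewrite /arg subr_gt0 ltr_pdivlMr ?exprn_gt0// mul1r.
    split; last by move: h2; rewrite /arg ltrBlDr ltr_pdivrMr ?exprn_gt0.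
    by rewrite -(ltr_pXn2r (n := 2)) ?nnegrE ?(ltW p0) ?(ltW (rk0 _)).
  pose t k := c r0 k * (dsmoothstep (arg (p ^+ 2) k) * (r r0 k ^+ 2)^-1) * p * phi p.
  apply: (@ler_sum_single t) => // [k|j k jk tj tk].
    rewrite /t; have [->|/nz[h1 h2]] := eqVneq (dsmoothstep (arg (p ^+ 2) k)) 0.
      by rewrite mul0r mulr0 !mul0r.
    have p2 : p <= 2 * r r0 k.
      by have := rk0 k; nra.
    have pp : phi p <= phi (2 * r r0 k) by exact: (osgood_le osg p0 p2 (rkm k)).
    (* The slope of [smoothstep] is at most 4, and [p <= 2 r_k] where it is nonzero. The bound is
       [c_k (4 / r_k^2) (2 r_k) phi (2 r_k)], which equals 8 by the choice of [c_k]. *)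
    apply: (@le_trans _ _ (c r0 k * (4 * (r r0 k ^+ 2)^-1) * (2 * r r0 k) * phi (2 * r r0 k))).
      have h3 : 0 <= c r0 k * (dsmoothstep (arg (p ^+ 2) k) * (r r0 k ^+ 2)^-1).
        by apply: mulr_ge0; [exact: ltW|apply: mulr_ge0; [exact: dsmoothstep_ge0|exact: r2]].
      apply: ler_pM => //; first by apply: mulr_ge0 => //; exact: ltW.
        by apply: ltW; exact: (osgood_gt0 osg).
      apply: ler_pM => //; first exact: ltW.
      by rewrite ler_pM2l// ler_wpM2r// dsmoothstep_le.
    rewrite /c le_eqVlt; apply/orP; left; apply/eqP; field.
    by rewrite !gt_eqF.
  have nzt i : t i != 0 -> dsmoothstep (arg (p ^+ 2) i) != 0.
    by apply: contraNneq => h; rewrite /t h mul0r mulr0 !mul0r.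
  (* For [j < k] one has [2 r_k <= r_j], so [r_j < p] and [p^2 < 2 r_k^2] contradict each other. *)
  have [h1 _] := nz _ (nzt _ tj); have [_ h2] := nz _ (nzt _ tk).
  have := r_le r0_gt0 jk; have := rS r0 j; have := rk0 k; have := rk0 j; nra.
Qed.

End osgood_potential.

(** * Dini derivatives and supersolutions *)

Section dini.
Context (R : realType).

(** For [a' > a], the points where [g <= g a'] have a supremum. Continuity keeps this supremum in
    the set, and the local hypothesis would push it further if it were below [b]. Then [a'] tends to
    [a]. *)
Lemma dini_nonincreasing (g : R -> R) (a b : R) : a <= b -> continuous g ->
  (forall s, a < s -> s < b -> exists2 e, 0 < e & forall h, 0 < h -> h < e -> g (s + h) <= g s) ->
  g b <= g a.
Proof.
move=> ab cg dg.
have H a' : a < a' -> a' <= b -> g b <= g a'.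
  move=> aa' a'b.
  pose A := [set x | a' <= x <= b /\ g x <= g a'].
  have Aa' : A a' by split; rewrite ?lexx.
  have supA : has_sup A by split; [exists a'|exists b => x [/andP[]]].
  have a'c : a' <= sup A by apply: ub_le_sup => //; exact: supA.2.
  have cb : sup A <= b by apply: ge_sup; [exists a'|move=> x [/andP[]]].
  have gc : g (sup A) <= g a'.
    rewrite leNgt; apply/negP => gac.
    have /cvgr_gt/(_ _ gac) /nbhs_ballP[e /= e0 eA] := cg (sup A).
    have [x Ax xe] := sup_adherent e0 supA.
    have xs : x <= sup A by apply: ub_le_sup => //; exact: supA.2.
    have : g a' < g x.
      by apply: eA; rewrite -ball_normE /= ger0_norm ?subr_ge0// ltrBlDr addrC -ltrBlDr.
    by rewrite ltNge Ax.2.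
  move: cb; rewrite le_eqVlt => /predU1P[<-//|cb].
  have [e e0 eg] := dg _ (lt_le_trans aa' a'c) cb.
  pose h := Num.min (e / 2) (b - sup A).
  have h0 : 0 < h by rewrite lt_min divr_gt0//= subr_gt0.
  have he : h < e by rewrite gt_min; apply/orP; left; lra.
  have hb : h <= b - sup A by rewrite ge_min lexx orbT.
  have : sup A + h <= sup A.
    apply: ub_le_sup; first exact: supA.2.
    split; last exact: le_trans (eg _ h0 he) gc.
    by apply/andP; split; lra.
  by lra.
move: ab; rewrite le_eqVlt => /predU1P[<-//|ab].
rewrite leNgt; apply/negP => gab.
have /cvgr_lt/(_ _ gab) /nbhs_ballP[e /= e0 eA] := cg a.
pose h := Num.min (e / 2) (b - a).
have h0 : 0 < h by rewrite lt_min divr_gt0//= subr_gt0.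
have he : h < e by rewrite gt_min; apply/orP; left; lra.
have hb : h <= b - a by rewrite ge_min lexx orbT.
have : g b <= g (a + h) by apply: H; lra.
rewrite leNgt => /negP; apply; apply: eA.
by rewrite -ball_normE /= opprD addNKr normrN gtr0_norm.
Qed.

(** Subtracting [(K + e) s] reduces to the nonincreasing case; then [e] tends to 0. *)
Lemma dini_le (f : R -> R) (a b K : R) : a <= b -> continuous f ->
  (forall s, a < s -> s < b -> forall e, 0 < e ->
    exists2 r, 0 < r & forall h, 0 < h -> h < r -> f (s + h) - f s <= (K + e) * h) ->
  f b - f a <= K * (b - a).
Proof.
move=> ab cf df.
suff H e : 0 < e -> f b - f a <= (K + e) * (b - a).
  apply/ler_addgt0Pr => e e0.
  have ba : 0 < b - a + 1 by lra.
  (* The added 1 covers [a = b]. *)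
  have := H (e / (b - a + 1)) (divr_gt0 e0 ba).
  rewrite mulrDl => /le_trans; apply; rewrite lerD2l -mulrA ler_piMr ?(ltW e0)//.
  by rewrite mulrC ler_pdivrMr//; lra.
move=> e0.
have : f b - (K + e) * b <= f a - (K + e) * a.
  apply: (@dini_nonincreasing (fun s => f s - (K + e) * s)) => //.
    move=> x; apply: cvgB; first exact: cf.
    by apply: cvgM; [exact: cvg_cst|exact: cvg_id].
  move=> s as_ sb; have [r r0 rf] := df s as_ sb e e0; exists r => // h h0 hr.
  by have := rf h h0 hr; lra.
by lra.
Qed.

(** Freezing time outside [a, b] turns continuity on the interval into continuity on the line, the
    form in which the Dini lemmas ask for it. *)
Definition clip (a b s : R) : R := Num.max a (Num.min s b).

Lemma clip_itv a b s : a <= b -> a <= clip a b s <= b.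
Proof. by move=> ab; rewrite /clip le_max lexx /= ge_max ab ge_min lexx orbT. Qed.

Lemma clip_id a b s : a <= s -> s <= b -> clip a b s = s.
Proof. by move=> as_ sb; rewrite /clip min_l// max_r. Qed.

Lemma clip_continuous a b : continuous (clip a b).
Proof.
have -> : clip a b = (fun=> a) \max ((fun s => s) \min (fun=> b)) by [].
move=> s; apply: (@continuous_max R R); first exact: cst_continuous.
by apply: (@continuous_min R R); [move=> ?; exact: cvg_id|exact: cst_continuous].
Qed.

Lemma continuous_clip (U : topologicalType) (f : R -> U) a b : a <= b ->
  {within `[a, b], continuous f} -> continuous (f \o clip a b).
Proof.
move=> ab /subspace_continuousP cf s.
have cabs : `[a, b]%classic (clip a b s) by rewrite /= in_itv; exact: clip_itv.
move=> A /(cf _ cabs A) /=; rewrite /within /= => hA.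
have hB : nbhs s [set t | `[a, b]%classic (clip a b t) -> A (f (clip a b t))].
  exact: (@clip_continuous a b s _ hA).
apply: (filterS _ hB) => t /=; apply.
by rewrite /= in_itv; exact: clip_itv.
Qed.

End dini.

Section barrier.
Context (R : realType) (d : nat).
Implicit Types (T : R) (v : R -> 'rV[R]_d -> 'rV[R]_d) (Q : R -> 'rV[R]_d -> R).

Lemma continuous_rVM (f g : 'rV[R]_d -> R) :
  continuous f -> continuous g -> continuous (fun x => f x * g x).
Proof. by move=> cf cg x; exact: (@continuousM _ _ f g x (cf x) (cg x)). Qed.

Lemma continuous_rVD (f g : 'rV[R]_d -> R) :
  continuous f -> continuous g -> continuous (fun x => f x + g x).
Proof. by move=> cf cg x; exact: (@continuousD _ _ _ f g x (cf x) (cg x)). Qed.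

Lemma continuous_rV_comp (f : 'rV[R]_d -> R) (g : R -> R) :
  continuous f -> continuous g -> continuous (fun x => g (f x)).
Proof. by move=> cf cg x; exact: (@continuous_comp _ _ _ f g x (cf x) (cg _)). Qed.

Lemma continuous_rV_coord i : continuous (fun x : 'rV[R]_d => x 0 i).
Proof. by move=> x; exact: coord_continuous. Qed.

(* [Q] is a C^1 supersolution of the transport equation along [v] on [0, T],
   equal to 1 outside a bounded set. *)
Record barrier T v Q : Prop := Barrier {
  barrier_itv : forall s x, 0 <= Q s x <= 1;
  barrier_far : exists p, forall s x, 0 <= s <= T -> p <= enorm x -> Q s x = 1;
  barrier_time : forall x, continuous (fun s => Q (clip 0 T s) x);
  barrier_space : forall s, 0 <= s <= T -> continuous (Q s);
  barrier_deriv : forall s, 0 < s -> s < T ->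
    exists (q : 'rV[R]_d -> R) (G : 'rV[R]_d -> 'rV[R]_d),
    [/\ forall x, is_derive s 1 (Q ^~ x) (q x),
        forall x i, is_derive x (delta_mx 0 i) (Q s) (G x 0 i),
        forall i, continuous (fun x => G x 0 i),
        forall x, 0 <= q x + dotp (G x) (v s x) &
        exists K r, 0 < r /\
          forall h x, `|h| < r -> `|Q (s + h) x - Q s x| <= K * `|h|] }.

Lemma barrier_one T v : barrier T v (fun _ _ => 1).
Proof.
split => [s x||x||s s0 sT]; rewrite ?lexx ?ler01//.
- by exists 0.
- by move=> s; exact: cvg_cst.
- by move=> s _; exact: cst_continuous.
- exists (fun=> 0), (fun=> 0); split => [x|x i|i x|x|].
  + apply: is_derive_cst.
  + by rewrite mxE; exact: is_derive_cst.
  + by under eq_fun do rewrite mxE; exact: cst_continuous.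
  + by rewrite add0r /dotp sumr_ge0// => i _; rewrite mxE mul0r.
  + by exists 0, 1; split => // h x _; rewrite subrr normr0 mul0r.
Qed.

Lemma dotpDl (x y z : 'rV[R]_d) : dotp (x + y) z = dotp x z + dotp y z.
Proof. by rewrite /dotp -big_split; apply: eq_bigr => i _; rewrite mxE mulrDl. Qed.

Lemma dotpZl a (x y : 'rV[R]_d) : dotp (a *: x) y = a * dotp x y.
Proof. by rewrite /dotp mulr_sumr; apply: eq_bigr => i _; rewrite mxE mulrA. Qed.

Lemma dotpBr (x y z : 'rV[R]_d) : dotp x (y - z) = dotp x y - dotp x z.
Proof. by rewrite /dotp -sumrB; apply: eq_bigr => i _; rewrite !mxE mulrBr. Qed.

Lemma dotp_delta (x : 'rV[R]_d) i : dotp x (delta_mx 0 i) = x 0 i.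
Proof.
rewrite /dotp (bigD1 i)//= big1 ?addr0; last first.
  by move=> j ji; rewrite mxE eqxx /= (negbTE ji) mulr0.
by rewrite mxE !eqxx mulr1.
Qed.

(** By the Leibniz rule, the transport derivative of the product is [Q1 D Q2 + Q2 D Q1], nonnegative
    because the factors are. As these are at most 1, the Lipschitz constants in time add up. *)
Lemma barrier_mul T v Q1 Q2 : barrier T v Q1 -> barrier T v Q2 ->
  barrier T v (fun s x => Q1 s x * Q2 s x).
Proof.
move=> [i1 [p1 f1] t1 c1 d1] [i2 [p2 f2] t2 c2 d2].
split => [s x||x s|s sT x|s s0 sT].
- have /andP[? ?] := i1 s x; have /andP[? ?] := i2 s x.
  by rewrite mulr_ge0//= mulr_ile1.
- exists (Num.max p1 p2) => s x sT; rewrite ge_max => /andP[px1 px2].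
  by rewrite f1// f2// mulr1.
- by apply: cvgM; [exact: t1|exact: t2].
- by move: x; apply: continuous_rVM; [exact: c1|exact: c2].
- have [q1 [G1 [qd1 Gd1 Gc1 ge1 [K1 [r1 [r10 l1]]]]]] := d1 s s0 sT.
  have [q2 [G2 [qd2 Gd2 Gc2 ge2 [K2 [r2 [r20 l2]]]]]] := d2 s s0 sT.
  exists (fun x => Q1 s x * q2 x + Q2 s x * q1 x),
    (fun x => Q1 s x *: G2 x + Q2 s x *: G1 x); split => [x|x i|i x|x|].
  + exact: is_deriveM.
  + by rewrite !mxE; exact: is_deriveM.
  + have sT' : 0 <= s <= T by rewrite !ltW.
    under eq_fun do rewrite !mxE.
    move: x; apply: continuous_rVD; apply: continuous_rVM.
    - exact: c1.
    - exact: Gc2.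
    - exact: c2.
    - exact: Gc1.
  + rewrite dotpDl !dotpZl.
    have /andP[Q10 _] := i1 s x; have /andP[Q20 _] := i2 s x.
    have := mulr_ge0 Q10 (ge2 x); have := mulr_ge0 Q20 (ge1 x); lra.
  + exists (K1 + K2), (Num.min r1 r2); split; first by rewrite lt_min r10.
    move=> h x; rewrite lt_min => /andP[hr1 hr2].
    have -> : Q1 (s + h) x * Q2 (s + h) x - Q1 s x * Q2 s x =
      (Q1 (s + h) x - Q1 s x) * Q2 (s + h) x + (Q2 (s + h) x - Q2 s x) * Q1 s x by ring.
    apply: le_trans (ler_normD _ _) _; rewrite !normrM mulrDl; apply: lerD.
      apply: le_trans (l1 h x hr1); rewrite ler_piMr// ger0_norm; last by case/andP: (i2 (s + h) x).
      by case/andP: (i2 (s + h) x).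
    apply: le_trans (l2 h x hr2); rewrite ler_piMr// ger0_norm; last by case/andP: (i1 s x).
    by case/andP: (i1 s x).
Qed.

Lemma barrier_prod (I : Type) (l : seq I) T v (F : I -> R -> 'rV[R]_d -> R) :
  (forall i, barrier T v (F i)) -> barrier T v (fun s x => \prod_(i <- l) F i s x).
Proof.
move=> bF; elim: l => [|i l IH].
  have -> : (fun s x => \prod_(i <- [::]) F i s x) = (fun _ _ => 1).
    by apply/funext => s; apply/funext => x; rewrite big_nil.
  exact: barrier_one.
have -> : (fun s x => \prod_(j <- i :: l) F j s x) =
    (fun s x => F i s x * \prod_(j <- l) F j s x).
  by apply/funext => s; apply/funext => x; rewrite big_cons.
exact: barrier_mul.
Qed.

End barrier.

(** * Monotonicity of the integral of [1 - Q] *)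

Section barrier_integral.
Context (R : realType) (d : nat).
Let lam := lebesgue_rV R d.
Local Notation V := 'rV[R]_d.

Lemma enorm_ball_compact (p : R) : compact [set x : V | enorm x <= p].
Proof.
apply: bounded_closed_compact.
  exists p; split; first exact: num_real.
  by move=> q pq x /= xp; rewrite (le_trans (norm_le_enorm _))// (le_trans xp)// ltW.
apply: (@closed_comp _ _ (@enorm R d) [set y | y <= p]); last exact: closed_le.
by move=> x _; exact: enorm_continuous.
Qed.

Lemma continuous_rV_integrable (K : set V) (f : V -> R) :
  compact K -> continuous f -> lam.-integrable K (EFin \o f).
Proof.
move=> cK cf; apply: measurable_bounded_integrable.
- exact: compact_measurable_rV.
- exact: lebesgue_rV_compact_lty.
- by apply: measurable_funTS; exact: continuous_measurable_rV.
- have /compact_bounded := continuous_compact (continuous_subspaceT cf : {within K, continuous f}) cK.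
  by move=> [M [Mr HM]]; exists M; split => // x Mx y Ky; apply: HM => //; exists y.
Qed.

Lemma integral_rV_compactE (K : set V) (f : V -> \bar R) :
  (forall x, ~ K x -> f x = 0%E) -> (\int[lam]_x f x = \int[lam]_(x in K) f x)%E.
Proof.
move=> fK; rewrite [RHS]integral_mkcond; apply: eq_integral => x _.
by rewrite patchE; case: ifPn => // /negP; rewrite inE => /fK.
Qed.

Variables (T : R) (v : R -> V -> V) (Q : R -> V -> R).
Hypotheses (T0 : 0 <= T) (bQ : barrier T v Q).
Hypothesis cv : forall s, 0 < s -> s < T -> forall i, continuous (fun x => v s x 0 i).
Hypothesis dv : forall s, 0 < s -> s < T -> forall psi : V -> R, C1_compact psi ->
  (\int[lam]_x (\sum_i v s x 0 i * 'D_(delta_mx 0 i) psi x) = 0)%R.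

(** At a fixed time [- q <= G . v], and the integral of [G . v] vanishes because [Q s - 1] is an
    admissible test function. Hence the upper right Dini derivative is at most 0. Passing to the
    limit under the integral uses the bound on the increments in time, uniform in [x], that is part
    of [barrier]. *)
Lemma barrier_integral : (\int[lam]_x (1 - Q T x)%:E <= \int[lam]_x (1 - Q 0 x)%:E)%E.
Proof.
have [Q01 [p Qp] Qt Qs Qd] := bQ.
pose K : set V := [set x | enorm x <= p].
have cK : compact K by exact: enorm_ball_compact.
have mK : measurable K by exact: compact_measurable_rV.
have Koo : (lam K < +oo)%E by exact: lebesgue_rV_compact_lty.
have cl s : 0 <= clip 0 T s <= T by exact: clip_itv.
have QK s x : 0 <= s <= T -> ~ K x -> Q s x = 1.
  by move=> sT /negP; rewrite -ltNge => /ltW; exact: Qp.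
have c1Q s : 0 <= s <= T -> continuous (fun x => 1 - Q s x).
  move=> sT; under eq_fun do rewrite -mulN1r.
  apply: continuous_rVD; first exact: cst_continuous.
  by apply: continuous_rVM; [exact: cst_continuous|exact: Qs].
have i1Q s : 0 <= s <= T -> lam.-integrable K (EFin \o (fun x => 1 - Q s x)).
  by move=> sT; apply: continuous_rV_integrable => //; exact: c1Q.
have icst (c : R) : lam.-integrable K (EFin \o (fun=> c)).
  by apply: continuous_rV_integrable => //; exact: cst_continuous.
pose Gam s := (\int[lam]_(x in K) (1 - Q (clip 0 T s) x))%R.
have GamE s : 0 <= s <= T -> (\int[lam]_x (1 - Q s x)%:E = (Gam s)%:E)%E.
  move=> sT; have /andP[s0 sT'] := sT; rewrite /Gam clip_id// /Rintegral.
  rewrite (integral_rV_compactE (K := K)); last by move=> x Kx; rewrite QK// subrr.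
  by rewrite fineK//; apply: integrable_fin_num => //; exact: i1Q.
rewrite !GamE ?lexx ?T0//.
have cGam : continuous Gam.
  move=> a; have Ia : a \in (`]a - 1, a + 1[%classic : set R).
    by rewrite inE /= in_itv /=; apply/andP; split; lra.
  apply: (@continuity_under_integral _ _ _ lam (fun s x => 1 - Q (clip 0 T s) x) K mK
    (a - 1) (a + 1) _ _ (fun=> 1) (icst 1) _ _ Ia).
  - by move=> s _; exact: i1Q.
  - apply: aeW => x _ s _; apply: cvgB; first exact: cvg_cst.
    exact: Qt.
  - move=> s _; apply: aeW => x _; have /andP[? ?] := Q01 (clip 0 T s) x.
    by rewrite ger0_norm; lra.
rewrite lee_fin -subr_le0 -[leRHS](mul0r (T - 0)).
apply: dini_le => // s s0 sT e e0; rewrite add0r.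
have sT' : 0 <= s <= T by rewrite !ltW.
have [q [G [Qq QG cG qG [L [r [r0 Lr]]]]]] := Qd s s0 sT.
(* Dominated convergence concerns sequences: a failure of the Dini bound is turned into a sequence
   [h n] of increments tending to 0 along which the quotient exceeds [e]. *)
apply: contrapT => H.
pose r1 := Num.min r (T - s).
have r10 : 0 < r1 by rewrite lt_min r0 subr_gt0.
have /choice[h hP] : forall n : nat, exists h : R,
    [/\ 0 < h, h < r, s + h < T, h < n.+1%:R^-1 & e * h < Gam (s + h) - Gam s].
  move=> n; apply: contrapT => Hn; apply: H.
  exists (Num.min r1 n.+1%:R^-1); first by rewrite lt_min r10 invr_gt0 ltr0n.
  move=> h h0; rewrite !lt_min => /andP[/andP[hr hT] hn].
  by rewrite leNgt; apply/negP => He; apply: Hn; exists h; split => //; lra.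
have h0 n : 0 < h n by case: (hP n).
have hT n : 0 <= s + h n <= T.
  by case: (hP n) => ? ? ? ? ?; apply/andP; split; lra.
have hcvg : h n @[n --> \oo] --> (0 : R).
  apply: (squeeze_cvgr (f := fun=> 0) (h := fun n => n.+1%:R^-1)).
  - by apply: nearW => n; case: (hP n) => ? ? ? /ltW -> _; rewrite ltW.
  - exact: cvg_cst.
  - exact: cvg_harmonic.
have hdn : h n @[n --> \oo] --> (0 : R)^'.
  move=> A hA; have hB : \forall n \near \oo, h n != 0 -> A (h n) by exact: (hcvg _ hA).
  apply: filterS hB => n /=; apply.
  exact: lt0r_neq0.
(* Difference quotients of [1 - Q]: they converge to [- q] and are dominated by the constant [L] on
   [K]. *)
pose f_ n x := ((h n)^-1 * (Q s x - Q (s + h n) x))%:E.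
pose f x := (- q x)%:E.
have f_f x : f_ ^~ x @ \oo --> f x.
  apply/cvg_EFin; first by apply: nearW.
  have /is_derive_cvgP/(cvg_comp _ _ hdn) := Qq x.
  move=> /cvgN; apply: cvg_trans; apply: near_eq_cvg; apply: nearW => n /=.
  by rewrite fctE /= /GRing.scale /= mulr1 (addrC (h n)) -mulrN opprB.
have mf_ n : measurable_fun K (f_ n).
  apply/measurable_EFinP; apply: measurable_funTS; apply: continuous_measurable_rV.
  apply: continuous_rVM; first exact: cst_continuous.
  under eq_fun do rewrite -[X in _ + X]mulN1r.
  apply: continuous_rVD; first exact: Qs.
  by apply: continuous_rVM; [exact: cst_continuous|exact: Qs].
have mf : measurable_fun K f by apply: (emeasurable_fun_cvg f_) => // x _; exact: f_f.
have f_L n x : (`|f_ n x| <= (EFin \o fun=> L) x)%E.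
  rewrite /f_ /= lee_fin normrM normfV distrC ler_pdivrMl ?normr_gt0 ?lt0r_neq0//.
  by rewrite mulrC; apply: Lr; rewrite gtr0_norm//; case: (hP n).
have [if_ _ cvgf] := dominated_convergence mK mf_ mf (aeW _ (fun x _ => f_f x)) (icst L)
  (aeW _ (fun x n _ => f_L n x)).
have intf_ n : (\int[lam]_(x in K) f_ n x = ((h n)^-1 * (Gam (s + h n) - Gam s))%:E)%E.
  have i1 := i1Q _ (hT n); have i2 := i1Q _ sT'.
  have /andP[? ?] := sT'; have /andP[? ?] := hT n.
  rewrite /Gam !clip_id// -RintegralB// -RintegralZl//; last first.
    by move: (integrableB mK i1 i2); apply: eq_integrable => // x _ /=.
  rewrite /Rintegral fineK; last first.
    apply: integrable_fin_num => //.
    by move: (integrableZl mK ((h n)^-1) (integrableB mK i1 i2)); apply: eq_integrable.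
  by apply: eq_integral => x _; rewrite /f_; congr EFin; lra.
have ef : (e%:E <= \int[lam]_(x in K) f x)%E.
  rewrite -(cvg_lim _ cvgf)//; apply: lime_ge; first by apply/cvg_ex; eexists; exact: cvgf.
  apply: nearW => n /=; rewrite intf_ lee_fin ler_pdivlMl//.
  by case: (hP n) => ? ? ? ? /ltW; rewrite mulrC.
pose w x := \sum_i v s x 0 i * G x 0 i.
have cw : continuous w.
  rewrite /w; apply: (continuous_big (x0 := 0) (op := +%R)) => [|i _]; first exact: add_continuous.
  by apply: continuous_rVM; [exact: cv|exact: cG].
have iw : lam.-integrable K (EFin \o w) by exact: continuous_rV_integrable.
have GK x : ~ K x -> forall i, G x 0 i = 0.
  move=> Kx i; have [_ <-] := QG x i.
  have oK : open (~` K) by apply: closed_openC; apply: compact_closed => //; exact: norm_hausdorff.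
  have := @near_eq_derive _ _ _ (Q s) (fun=> 1) x (delta_mx 0 i) _.
  rewrite derive_cst; apply.
  by apply: filterS (open_nbhs_nbhs (conj oK Kx)) => y /QK; exact.
have w0 : (\int[lam]_(x in K) (w x)%:E = 0)%E.
  (* Subtracting 1 makes the support compact and leaves the gradient unchanged. *)
  have C1 : C1_compact (fun x => Q s x - 1).
    split=> [i x|i|].
    - by apply: derivableB; [have [] := QG x i|exact: derivable_cst].
    - rewrite (_ : 'D__ _ = fun x => G x 0 i) //; apply/funext => x.
      rewrite deriveB; [|by have [] := QG x i|exact: derivable_cst].
      by rewrite derive_cst subr0; have [] := QG x i.
    - by exists K => // x Kx; rewrite QK// subrr.
  have := dv s0 sT C1.
  have -> : (fun x => \sum_i v s x 0 i * 'D_(delta_mx 0 i) (fun x => Q s x - 1) x) = w.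
    apply/funext => x; apply: eq_bigr => i _.
    rewrite deriveB; [|by have [] := QG x i|exact: derivable_cst].
    by rewrite derive_cst subr0; have [_ ->] := QG x i.
  rewrite /Rintegral (integral_rV_compactE (K := K)).
    by move=> w0; rewrite -[LHS]fineK ?w0//; apply: integrable_fin_num.
  by move=> x Kx; rewrite /w big1// => i _; rewrite GK// mulr0.
have : (e%:E <= 0)%E; last by rewrite lee_fin leNgt e0.
rewrite -w0; apply: le_trans ef _; apply: le_integral => // x _.
rewrite lee_fin /w lerNl -subr_ge0 opprK; have := qG x.
by rewrite /dotp; under eq_bigr do rewrite mulrC.
Qed.

End barrier_integral.

(** * Supersolutions along one trajectory *)

Section point_barrier.
Context (R : realType) (d : nat).
Local Notation V := 'rV[R]_d.

Lemma is_derive_sqr_enorm (z : R -> V) (t : R) (l : V) :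
  is_derive t 1 z l -> is_derive t 1 (fun s => enorm (z s) ^+ 2) (2 * dotp (z t) l).
Proof.
move=> zl; rewrite (_ : (fun s => _) = \sum_i (fun s => z s 0 i) ^+ 2); last first.
  by apply/funext => s; rewrite sqr_enorm fct_sumE.
rewrite (_ : 2 * dotp (z t) l = \sum_i (2%:R * z t 0 i ^+ 1) *: l 0 i); last first.
  rewrite /dotp mulr_sumr; apply: eq_bigr => i _.
  by rewrite /GRing.scale /= expr1 mulrA.
by apply: is_derive_sum => i; apply: is_deriveX; exact: is_derive_coord.
Qed.

Lemma is_derive_enorm_le (z : R -> V) (t e : R) (l : V) : is_derive t 1 z l -> 0 < e ->
  exists2 r, 0 < r & forall h, `|h| < r -> enorm (z (t + h) - z t) <= (enorm l + e) * `|h|.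
Proof.
move=> /is_derive_cvgP zl e0.
have : nbhs l [set y | enorm (l - y) < e] by apply/enorm_ballP; exists e.
move=> /zl /nbhs_ballP[r /= r0 rP]; exists r => // h hr.
have [->|h0] := eqVneq h 0; first by rewrite addr0 subrr enorm0 normr0 mulr0.
have := rP h; rewrite /ball /= sub0r normrN => /(_ hr h0).
rewrite scaler1 (addrC h); set w := z (t + h) - z t => lw.
have -> : w = h *: (h^-1 *: w) by rewrite scalerA divff// scale1r.
rewrite enormZ mulrC ler_wpM2r//.
have := ler_enormD l (h^-1 *: w - l); rewrite addrC subrK.
by rewrite enormB in lw; move: lw; lra.
Qed.

Context (m : R) (phi : R -> R) (osg : osgood_modulus m phi).
Variables (T C : R) (v : R -> V -> V).
Hypothesis C0 : 0 <= C.
Hypothesis vC : forall s, 0 < s -> s < T -> forall x y, 0 < enorm (x - y) -> enorm (x - y) < m ->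
  enorm (v s x - v s y) <= C * phi (enorm (x - y)).
Variables (beta dbeta : R -> R) (e L : R).
Hypotheses (e0 : 0 < e) (em : e <= m ^+ 2).
Hypothesis beta_derive : forall y : R, is_derive y 1 beta (dbeta y).
Hypothesis dbeta_continuous : continuous dbeta.
Hypothesis dbeta_ge0 : forall y, 0 <= dbeta y.
Hypothesis dbeta_le : forall y, dbeta y <= L.
Hypothesis beta_far : forall y, e <= y -> 16 * C * T + 1 <= beta y.
Hypothesis dbeta_far : forall y, e <= y -> dbeta y = 0.
Hypothesis dbeta_phi : forall p, 0 < p -> p < m -> dbeta (p ^+ 2) * p * phi p <= 8.

(* Transported by [v], [beta (|x - Y s|^2)] decreases at rate at most [16 C] by
   [dbeta_phi]; the linear drift compensates for it. *)
Definition point_barrier (Y : R -> V) (s : R) (x : V) : R :=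
  smoothstep (16 * C * (s - T) + beta (enorm (x - Y s) ^+ 2)).

(** Serves twice: for the time derivative, where [z] follows the trajectory, and for the partial
    derivatives, where [z] runs along a coordinate line. *)
Lemma is_derive_barrier (a : R -> R) (z : R -> V) (t da : R) (l : V) :
  is_derive t 1 a da -> is_derive t 1 z l ->
  is_derive t 1 (fun s => smoothstep (a s + beta (enorm (z s) ^+ 2)))
   (dsmoothstep (a t + beta (enorm (z t) ^+ 2)) *
     (da + dbeta (enorm (z t) ^+ 2) * (2 * dotp (z t) l))).
Proof.
move=> dea dez.
have h1 := @is_derive1_comp _ beta (fun s => enorm (z s) ^+ 2) t _ _
  (beta_derive _) (is_derive_sqr_enorm dez).
have h2 : is_derive t (1 : R) (fun s => a s + beta (enorm (z s) ^+ 2))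
   (da + dbeta (enorm (z t) ^+ 2) * (2 * dotp (z t) l)) by exact: is_deriveD.
exact: (@is_derive1_comp _ _ _ t _ _ (is_derive_smoothstep _) h2).
Qed.

(** The Cauchy-Schwarz inequality and the modulus of [v] give [2 C] times the quantity that
    [dbeta_phi] bounds by 8. At distances of at least [m] the weight is flat, because
    [e <= m ^+ 2]. *)
Lemma dbeta_dotp_le s x y : 0 < s -> s < T ->
  `|dbeta (enorm (x - y) ^+ 2) * (2 * dotp (x - y) (v s x - v s y))| <= 16 * C.
Proof.
move=> s0 sT; set z := x - y.
have [z0|] := eqVneq (enorm z) 0.
  have -> : dotp z (v s x - v s y) = 0.
    apply/eqP; rewrite -normr_le0; apply: le_trans (dotp_le _ _) _.
    by rewrite z0 mul0r.
  by rewrite !mulr0 normr0 mulr_ge0.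
rewrite enorm_eq0 -enorm_gt0 => z0.
have [zm|mz] := ltP (enorm z) m; last first.
  rewrite dbeta_far ?mul0r ?normr0 ?mulr_ge0//.
  by rewrite (le_trans em)// lerXn2r ?nnegrE ?(ltW z0)// ltW// (osgood_m_gt0 osg).
rewrite !normrM (ger0_norm (dbeta_ge0 _)) (ger0_norm (ler0n _ 2)).
have h1 : `|dotp z (v s x - v s y)| <= enorm z * (C * phi (enorm z)).
  apply: le_trans (dotp_le _ _) _; rewrite ler_wpM2l ?enorm_ge0//.
  exact: vC.
have h2 := dbeta_phi z0 zm.
apply: (@le_trans _ _ (dbeta (enorm z ^+ 2) * (2 * (enorm z * (C * phi (enorm z)))))).
  by rewrite ler_wpM2l// ler_wpM2l.
rewrite (_ : dbeta _ * _ = 2 * C * (dbeta (enorm z ^+ 2) * enorm z * phi (enorm z))); last by ring.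
by rewrite (_ : 16 * C = 2 * C * 8) ?ler_wpM2l ?mulr_ge0//; ring.
Qed.

(** The drift in time compensates exactly for the bound of [dbeta_dotp_le]. Over [0, T] it is at
    least [- 16 C T], so that where [beta] reaches [16 C T + 1] the argument of the step is at least
    1. *)
Lemma point_barrier_barrier (Y : R -> V) : continuous (Y \o clip 0 T) ->
  (forall s, 0 < s -> s < T -> is_derive s 1 Y (v s (Y s))) ->
  barrier T v (point_barrier Y).
Proof.
move=> cY dY.
have cbeta : continuous beta by move=> y; exact: (is_derive_continuous (beta_derive y)).
have csm : continuous (@smoothstep R).
  by move=> y; exact: (is_derive_continuous (is_derive_smoothstep y)).
have cpb (U : topologicalType) (a : U -> R) (z : U -> V) : continuous a -> continuous z ->
    continuous (fun u => smoothstep (a u + beta (enorm (z u) ^+ 2))).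
  move=> ca cz u.
  have c1 := @continuous_comp _ _ _ z (@enorm R d) u (cz u) (@enorm_continuous R d _).
  have c2 := @continuous_comp _ _ _ _ (fun y : R => y ^+ 2) u c1 (@exprn_continuous R 2 _).
  have c3 := @continuous_comp _ _ _ _ beta u c2 (cbeta _).
  have c4 := @continuousD _ _ _ a _ u (ca u) c3.
  exact: (@continuous_comp _ _ _ _ (@smoothstep R) u c4 (csm _)).
have [M M0 YM] : exists2 M, 0 <= M & forall s, 0 <= s <= T -> enorm (Y s) <= M.
  have : compact [set (@enorm R d \o (Y \o clip 0 T)) s | s in `[0, T]%classic].
    apply: continuous_compact; last exact: segment_compact.
    apply: continuous_subspaceT => s.
    exact: (@continuous_comp _ _ _ (Y \o clip 0 T) (@enorm R d) s (cY s) (@enorm_continuous R d _)).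
  move=> /compact_bounded/pinfty_ex_gt0[M M0 HM]; exists M; first exact: ltW.
  move=> s /[dup] sT /andP[s0 s1]; have : `|enorm (Y s)| <= M.
    by apply: HM; exists s; rewrite /= ?in_itv//= clip_id.
  by rewrite ger0_norm ?enorm_ge0.
(* Outside this radius every [x] is at distance at least [sqrt e] from the trajectory, at all times
   in [0, T]. *)
pose p := M + Num.sqrt e.
have far s x : 0 <= s <= T -> p <= enorm x -> point_barrier Y s x = 1.
  move=> sT px; apply: smoothstep_ge1.
  have h1 : Num.sqrt e <= enorm (x - Y s).
    have := ler_enormD (x - Y s) (Y s); rewrite subrK.
    by have := YM s sT; move: px; rewrite /p; lra.
  have h2 : e <= enorm (x - Y s) ^+ 2.
    by rewrite -(sqr_sqrtr (ltW e0)) lerXn2r ?nnegrE ?sqrtr_ge0 ?enorm_ge0.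
  have := beta_far h2; have : 0 <= 16 * C * s by rewrite !mulr_ge0//; case/andP: sT.
  by lra.
split => [s x||x|s sT|s s0 sT].
- exact: smoothstep_itv.
- by exists p.
- apply: cpb.
    move=> s; apply: cvgM; first exact: cvg_cst.
    by apply: cvgB; [exact: clip_continuous|exact: cvg_cst].
  move=> s; apply: (@continuousB _ _ _ (fun=> x) (Y \o clip 0 T)); last exact: cY.
  exact: cst_continuous.
- apply: cpb; first exact: cst_continuous.
  move=> x; apply: (@continuousB _ _ _ (fun x => x) (fun=> Y s)); last exact: cst_continuous.
  exact: cvg_id.
- have dYs := dY s s0 sT.
  pose w x := dsmoothstep (16 * C * (s - T) + beta (enorm (x - Y s) ^+ 2)).
  exists (fun x => w x * (16 * C + dbeta (enorm (x - Y s) ^+ 2) * (2 * dotp (x - Y s) (0 - v s (Y s))))).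
  exists (fun x => (w x * dbeta (enorm (x - Y s) ^+ 2) * 2) *: (x - Y s)).
  split => [x|x i|i|x|].
  + apply: (is_derive_barrier (a := fun s => 16 * C * (s - T)) (z := fun s => x - Y s)).
      rewrite -[X in is_derive _ _ _ X]mulr1.
      apply: is_deriveZ; rewrite -[X in is_derive _ _ _ X]subr0; exact: is_deriveB.
  + apply: is_derive_line.
    have -> : ((w x * dbeta (enorm (x - Y s) ^+ 2) * 2) *: (x - Y s)) 0 i =
      w x * (0 + dbeta (enorm (x - Y s) ^+ 2) * (2 * dotp (x - Y s) (delta_mx 0 i))).
      by rewrite mxE dotp_delta; ring.
    have := @is_derive_barrier (fun=> 16 * C * (s - T)) (fun h => h *: delta_mx 0 i + x - Y s) 0 0
      (delta_mx 0 i).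
    rewrite scale0r add0r; apply.
    apply: is_derive_cvg; apply: cvg_near_cst; near=> h.
    have h0 : h != 0 by near: h; exact: nbhs_dnbhs_neq.
    rewrite addr0 scaler1 scale0r add0r -[h *: _ + x - _]addrA addrK.
    by rewrite scalerA mulVf// scale1r.
  + have cN : continuous (fun x : V => enorm (x - Y s) ^+ 2).
      move=> x; have c1 : {for x, continuous (fun x : V => x - Y s)}.
        by apply: (@continuousB _ _ _ (fun x => x) (fun=> Y s)); [exact: cvg_id|exact: cst_continuous].
      have c2 := @continuous_comp _ _ _ _ (@enorm R d) x c1 (@enorm_continuous R d _).
      exact: (@continuous_comp _ _ _ _ (fun y : R => y ^+ 2) x c2 (@exprn_continuous R 2 _)).
    under eq_fun do rewrite !mxE.
    apply: continuous_rVM; last first.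
      by apply: continuous_rVD; [exact: continuous_rV_coord|exact: cst_continuous].
    apply: continuous_rVM; last exact: cst_continuous.
    apply: continuous_rVM; last exact: (continuous_rV_comp cN dbeta_continuous).
    apply: (@continuous_rV_comp _ _ _ (@dsmoothstep R)); last exact: continuous_dsmoothstep.
    apply: continuous_rVD; first exact: cst_continuous.
    exact: (continuous_rV_comp cN cbeta).
  + have dotp0 (z : V) : dotp z 0 = 0 by rewrite /dotp big1// => i _; rewrite mxE mulr0.
    (* The time derivative contributes [- v s (Y s)] and the transport term [v s x]: only the
       difference of the two velocities remains. *)
    rewrite dotpZl dotpBr dotp0.
    have := dbeta_dotp_le x (Y s) s0 sT; rewrite dotpBr ler_norml => /andP[+ _].
    rewrite -subr_ge0 => /(mulr_ge0 (dsmoothstep_ge0 (16 * C * (s - T) + beta (enorm (x - Y s) ^+ 2)))).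
    rewrite -/(w x); move: (w x) (dbeta _) => a b; congr (0 <= _); ring.
  + have [r r0 rY] := is_derive_enorm_le dYs ltr01.
    have L0 : 0 <= L by exact: le_trans (dbeta_le 0).
    have l10 : 0 <= enorm (v s (Y s)) + 1 by rewrite addr_ge0 ?enorm_ge0.
    have pM0 : 0 <= p + M by rewrite !addr_ge0 ?sqrtr_ge0.
    (* Here 4 is the Lipschitz constant of the step and [L] that of [beta]. The difference of the
       squared distances is factored: one factor is at most the speed times [|h|], the other at most
       [2 (p + M)]. *)
    pose K := 4 * (16 * C + L * ((enorm (v s (Y s)) + 1) * (2 * (p + M)))).
    have K0 : 0 <= K by rewrite mulr_ge0// addr_ge0 ?mulr_ge0.
    exists K, (Num.min r (Num.min s (T - s))).
    split; first by rewrite !lt_min r0 s0 subr_gt0.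
    move=> h x; rewrite !lt_min => /andP[hr /andP[hs hT]].
    have sT' : 0 <= s <= T by rewrite !ltW.
    have shT : 0 <= s + h <= T.
      by move: hs hT; rewrite !ltr_norml => /andP[? ?] /andP[? ?]; apply/andP; split; lra.
    have [px|xp] := leP p (enorm x); first by rewrite !far// subrr normr0 mulr_ge0.
    apply: le_trans (smoothstep_lipschitz _ _) _.
    rewrite /K -[leRHS]mulrA ler_wpM2l//.
    have -> : 16 * C * (s + h - T) + beta (enorm (x - Y (s + h)) ^+ 2) -
      (16 * C * (s - T) + beta (enorm (x - Y s) ^+ 2)) =
      16 * C * h + (beta (enorm (x - Y (s + h)) ^+ 2) - beta (enorm (x - Y s) ^+ 2)) by ring.
    apply: le_trans (ler_normD _ _) _; rewrite [leRHS]mulrDl; apply: lerD.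
      by rewrite normrM ger0_norm// mulr_ge0.
    apply: le_trans (bounded_derive_lipschitz (K := L) beta_derive _ _ _) _.
      by move=> y; rewrite ger0_norm.
    apply: (@le_trans _ _ (L * ((enorm (v s (Y s)) + 1) * `|h| * (2 * (p + M))))); last first.
      by rewrite le_eqVlt; apply/orP; left; apply/eqP; ring.
    rewrite ler_wpM2l// subr_sqr normrM; apply: ler_pM => //.
    - apply: le_trans (ler_enorm_dist _ _) _.
      rewrite (_ : x - Y (s + h) - (x - Y s) = - (Y (s + h) - Y s)); last first.
        by apply/rowP => i; rewrite !mxE; ring.
      by rewrite enormN; exact: rY.
    - rewrite ger0_norm ?addr_ge0 ?enorm_ge0//.
      have := ler_enormD x (- Y (s + h)); have := ler_enormD x (- Y s).
      have := YM _ sT'; have := YM _ shT; rewrite !enormN; lra.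
Unshelve. all: by end_near. Qed.

End point_barrier.

(** * Volume preservation *)

Section flow_volume.
Context (R : realType) (d : nat).
Local Notation V := 'rV[R]_d.
Let lam := lebesgue_rV R d.
Context (m : R) (phi : R -> R) (osg : osgood_modulus m phi).
Variables (T C : R) (v Y : R -> V -> V).
Hypotheses (T0 : 0 <= T) (C0 : 0 <= C).
Hypothesis vC : forall s, 0 < s -> s < T -> forall x y, 0 < enorm (x - y) -> enorm (x - y) < m ->
  enorm (v s x - v s y) <= C * phi (enorm (x - y)).
Hypothesis Y0 : forall x, Y 0 x = x.
Hypothesis cY : forall x, continuous (fun s => Y (clip 0 T s) x).
Hypothesis dY : forall x s, 0 < s -> s < T -> is_derive s 1 (Y ^~ x) (v s (Y s x)).

(** Along two trajectories, [beta] of the squared distance grows at rate at most [16 C]. Starting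
    from 0 it stays below [16 C T + 1], a value that it takes only below the prescribed distance,
    whence the bound. *)
Lemma flow_uniform_continuous e : 0 < e -> exists2 r, 0 < r &
  forall x y, enorm (x - y) < r -> enorm (Y T x - Y T y) < e.
Proof.
move=> e0; have m0 := osgood_m_gt0 osg.
pose e' := Num.min (e ^+ 2) (m ^+ 2).
have e'0 : 0 < e' by rewrite lt_min !exprn_gt0.
have [beta [dbeta [s [L [[s0 bd bc b0 bL] [bs bK bfar bge0 bphi]]]]]] :=
  osgood_potential osg (16 * C * T + 1) e'0.
have em : e' <= m ^+ 2 by rewrite ge_min lexx orbT.
exists (Num.sqrt s); first by rewrite sqrtr_gt0.
move=> x y xy.
have z0 : beta (enorm (Y 0 x - Y 0 y) ^+ 2) = 0.
  rewrite !Y0; apply: bs; rewrite -(sqr_sqrtr (ltW s0)).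
  by rewrite lerXn2r ?nnegrE ?enorm_ge0 ?sqrtr_ge0// ltW.
pose f t := beta (enorm (Y t x - Y t y) ^+ 2).
pose df t := dbeta (enorm (Y t x - Y t y) ^+ 2) *
  (2 * dotp (Y t x - Y t y) (v t (Y t x) - v t (Y t y))).
have fd t : 0 < t -> t < T -> is_derive t 1 f (df t).
  move=> t0 tT.
  have dz : is_derive t 1 (fun t => Y t x - Y t y) (v t (Y t x) - v t (Y t y)).
    by apply: is_deriveB; exact: dY.
  exact: (@is_derive1_comp _ beta (fun t => enorm (Y t x - Y t y) ^+ 2) t _ _
    (bd _) (is_derive_sqr_enorm dz)).
have fT : f T <= 16 * C * T.
  have [<-|T1] := eqVneq 0 T; first by rewrite /f z0 mulr0.
  have {}T1 : 0 < T by rewrite lt_def eq_sym T1.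
  have cf : {within `[0, T], continuous f}.
    have cfc : {within `[0, T], continuous (f \o clip 0 T)}.
      apply: continuous_subspaceT => t.
      have c1 : {for t, continuous (fun t => Y (clip 0 T t) x - Y (clip 0 T t) y)}.
        by apply: continuousB; exact: cY.
      have c2 := @continuous_comp _ _ _ _ (@enorm R d) t c1 (@enorm_continuous R d _).
      have c3 := @continuous_comp _ _ _ _ (fun y : R => y ^+ 2) t c2 (@exprn_continuous R 2 _).
      exact: (@continuous_comp _ _ _ _ beta t c3 (is_derive_continuous (bd _))).
    refine (subspace_eq_continuous _ cfc) => t; rewrite inE /= in_itv /= => /andP[t0 tT].
    by change (f (clip 0 T t) = f t); rewrite clip_id.
  have fd' t : t \in `]0, T[ -> is_derive t 1 f (df t).
    by rewrite in_itv /= => /andP[t0 tT]; exact: fd.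
  have [c] := MVT T1 fd' cf.
  rewrite in_itv /= => /andP[c0 cT]; rewrite subr0 {2}/f z0 subr0 => ->.
  rewrite ler_wpM2r//.
  have := dbeta_dotp_le osg C0 vC em b0 bfar bphi (Y c x) (Y c y) c0 cT.
  by rewrite ler_norml => /andP[_].
rewrite ltNge; apply/negP => ez.
have : e' <= enorm (Y T x - Y T y) ^+ 2.
  rewrite ge_min; apply/orP; left.
  by rewrite lerXn2r ?nnegrE ?enorm_ge0// ltW.
by move/bK; move: fT; rewrite /f; lra.
Qed.

Lemma flow_continuous : continuous (Y T).
Proof.
move=> x A /enorm_ballP[e e0 eA]; have [r r0 rY] := flow_uniform_continuous e0.
by apply/enorm_ballP; exists r => // y /rY; exact: eA.
Qed.

Hypothesis cv : forall s, 0 < s -> s < T -> forall i, continuous (fun x => v s x 0 i).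
Hypothesis dv : forall s, 0 < s -> s < T -> forall psi : V -> R, C1_compact psi ->
  (\int[lam]_x (\sum_i v s x 0 i * 'D_(delta_mx 0 i) psi x) = 0)%R.

Definition enbhd (K : set V) (e : R) : set V := [set x | exists2 a, K a & enorm (x - a) < e].

Lemma enbhd_open K e : open (enbhd K e).
Proof.
rewrite openE => x [a Ka xa]; apply/enorm_ballP; exists (e - enorm (x - a)).
  by rewrite subr_gt0.
move=> y xy; exists a => //.
have := ler_enormD (y - x) (x - a); rewrite addrA subrK (enormB y x); lra.
Qed.

(* The product of the barriers issued from a finite net of [K] vanishes on
   [Y T @` K] at time [T], and equals 1 off [enbhd K e] at time 0. *)
Lemma flow_volume_enbhd (K : set V) e : compact K -> 0 < e ->
  (lam (Y T @` K) <= lam (enbhd K e))%E.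
Proof.
move=> cK e0; have m0 := osgood_m_gt0 osg.
pose e' := Num.min (e ^+ 2) (m ^+ 2).
have e'0 : 0 < e' by rewrite lt_min !exprn_gt0.
have [beta [dbeta [s [L [[s0 bd bc b0 bL] [bs bK bfar bge0 bphi]]]]]] :=
  osgood_potential osg (16 * C * T + 1) e'0.
have em : e' <= m ^+ 2 by rewrite ge_min lexx orbT.
have cYK : compact (Y T @` K).
  by apply: continuous_compact => //; apply: continuous_subspaceT; exact: flow_continuous.
have sq0 : 0 < Num.sqrt s by rewrite sqrtr_gt0.
have [l lK Yl] : exists2 l : seq V, (forall a, a \in l -> K a) &
    forall x, (Y T @` K) x -> exists2 a, a \in l & enorm (x - Y T a) < Num.sqrt s.
  have := cYK; rewrite compact_cover => /(_ _ K (fun a => enbhd [set Y T a] (Num.sqrt s))).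
  case.
  - by move=> a _; exact: enbhd_open.
  - by move=> _ [a Ka <-]; exists a => //; exists (Y T a); rewrite ?subrr ?enorm0.
  move=> D DK cD; exists (finmap.enum_fset D).
    by move=> a aD; have := DK a aD; rewrite inE.
  by move=> x /cD [a aD [_ -> xa]]; exists a.
pose Q s x := \prod_(a <- l) point_barrier T C beta (Y ^~ a) s x.
have bQ : barrier T v Q.
  apply: barrier_prod => a.
  exact: (point_barrier_barrier osg C0 vC e'0 em bd bc b0 bL bK bfar bphi (@cY a) (@dY a)).
have [Q01 _ _ Qs _] := bQ.
have m1Q t : 0 <= t <= T -> measurable_fun setT (fun x => (1 - Q t x)%:E).
  move=> tT; apply/measurable_EFinP; apply: continuous_measurable_rV.
  under eq_fun do rewrite -mulN1r.
  apply: continuous_rVD; first exact: cst_continuous.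
  by apply: continuous_rVM; [exact: cst_continuous|exact: Qs].
apply: (@le_trans _ _ (\int[lam]_x (1 - Q T x)%:E)%E).
  rewrite -[X in lam X]setIT -integral_indic//; last exact: compact_measurable_rV.
  apply: ge0_le_integral => //.
  - by apply/measurable_EFinP; apply: measurable_indic; exact: compact_measurable_rV.
  - by apply: m1Q; rewrite ?lexx ?T0.
  - move=> x _; rewrite lee_fin indicE; case: (boolP (x \in Y T @` K)) => [|_]; last first.
      by rewrite subr_ge0; case/andP: (Q01 T x).
    rewrite inE => /Yl[a al xa].
    suff -> : Q T x = 0 by rewrite subr0.
    rewrite /Q (big_rem a al) /= /point_barrier subrr mulr0 add0r.
    rewrite bs ?smoothstep_le0 ?mul0r// -(sqr_sqrtr (ltW s0)).
    by rewrite lerXn2r ?nnegrE ?enorm_ge0 ?sqrtr_ge0// ltW.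
apply: le_trans (barrier_integral T0 bQ cv dv) _.
rewrite -[X in lam X]setIT -integral_indic//; last by apply: open_measurable_rV; exact: enbhd_open.
apply: ge0_le_integral => //.
- by move=> x _; rewrite lee_fin subr_ge0; case/andP: (Q01 0 x).
- by apply: m1Q; rewrite ?lexx ?T0.
- by apply/measurable_EFinP; apply: measurable_indic; apply: open_measurable_rV; exact: enbhd_open.
- move=> x _; rewrite lee_fin indicE; case: (boolP (x \in enbhd K e)) => [_|xK].
    by rewrite gerBl; case/andP: (Q01 0 x).
  suff -> : Q 0 x = 1 by rewrite subrr.
  rewrite /Q big_seq big1// => a al; apply: smoothstep_ge1.
  have : 16 * C * T + 1 <= beta (enorm (x - Y 0 a) ^+ 2).
    apply: bK; rewrite Y0 ge_min; apply/orP; left.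
    rewrite lerXn2r ?nnegrE ?enorm_ge0 ?(ltW e0)// leNgt; apply/negP => xa.
    by move/negP: xK; apply; rewrite inE; exists a => //; exact: lK.
  by lra.
Qed.

(** The set [K] is closed, hence the intersection of its neighbourhoods; these have finite measure
    because [K] is bounded, and the measure is continuous from above. *)
Lemma flow_volume_le (K : set V) : compact K -> (lam (Y T @` K) <= lam K)%E.
Proof.
move=> cK.
pose F n := enbhd K n.+1%:R^-1.
have mF n : measurable (F n) by apply: open_measurable_rV; exact: enbhd_open.
have FK : \bigcap_n F n = K.
  apply/seteqP; split => [x Fx|x Kx n _]; last first.
    by exists x; rewrite // subrr enorm0 invr_gt0 ltr0n.
  have : closed K by apply: compact_closed => //; exact: norm_hausdorff.
  apply => A /enorm_ballP[e e0 eA].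
  have [a Ka xa] := Fx (Num.truncn e^-1) I.
  exists a; split => //; apply: eA; apply: lt_trans xa _.
  by rewrite invf_plt ?posrE ?ltr0n// truncnS_gt.
have F0 : (lam (F 0%N) < +oo)%E.
  have [k k0 Kk] := compact_sub_cbox cK.
  apply: le_lt_trans (lebesgue_rV_cbox_lty (const_mx (- (k + 1)) : V) (const_mx (k + 1))).
  apply: le_measure; rewrite ?inE//; first exact: measurable_cbox.
  move=> x [a /Kk aK]; rewrite invr1 => xa i; have := aK i; rewrite !mxE => /andP[a1 a2].
  have := le_trans (coord_le_enorm (x - a) i) (ltW xa); rewrite !mxE ler_norml => /andP[? ?].
  by apply/andP; split; lra.
have cvgF : lam (F n) @[n --> \oo] --> lam K.
  rewrite -FK; apply: nonincreasing_cvg_mu => //.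
    by rewrite FK; exact: compact_measurable_rV.
  move=> p q pq; rewrite subsetEset => x [a Ka xa]; exists a => //.
  by apply: lt_le_trans xa _; rewrite lef_pV2 ?posrE ?ltr0n// ler_nat.
rewrite -(cvg_lim _ cvgF)//; apply: lime_ge; first by apply/cvg_ex; eexists; exact: cvgF.
by apply: nearW => n; apply: flow_volume_enbhd; rewrite ?invr_gt0 ?ltr0n.
Qed.

End flow_volume.

Section measure_preserving.
Context (R : realType) (d : nat).
Local Notation V := 'rV[R]_d.
Let lam := lebesgue_rV R d.

Lemma is_derive_rV (g : R -> V) (t : R) (l : V) :
  (forall i, is_derive t 1 (fun s => g s 0 i) (l 0 i)) -> is_derive t 1 g l.
Proof.
move=> gl; have dg : derivable g t 1.
  by apply/derivable_mxP => i j; rewrite ord1; have [] := gl j.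
apply: DeriveDef; first exact: dg.
rewrite (derive_mx dg); apply/rowP => j; rewrite mxE.
by have [_ ->] := gl j.
Qed.

Lemma field_continuous (m : R) (phi : R -> R) (C : R) (w : V -> V) : 0 < m -> 0 <= C ->
  phi r @[r --> 0^'+] --> 0 ->
  (forall x y, 0 < enorm (x - y) -> enorm (x - y) < m ->
    enorm (w x - w y) <= C * phi (enorm (x - y))) ->
  continuous w.
Proof.
move=> m0 C0 phi0 wC x A /enorm_ballP[e e0 eA]; apply/enorm_ballP.
have C1 : 0 < C + 1 by rewrite ltr_wpDl.
have /cvgrPdist_lt/(_ (e / (C + 1))) := phi0.
rewrite divr_gt0// => /(_ isT)[r /= r0 rP].
exists (Num.min r m); first by rewrite lt_min r0.
move=> y; rewrite lt_min => /andP[yr ym]; apply: eA.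
have [xy|] := eqVneq (enorm (x - y)) 0.
  move/eqP: xy; rewrite enorm_eq0 subr_eq0 => /eqP ->.
  by rewrite subrr enorm0.
rewrite enorm_eq0 -enorm_gt0 => xy.
apply: le_lt_trans (wC _ _ xy ym) _.
have := rP (enorm (x - y)); rewrite /ball_ /= !sub0r !normrN ger0_norm ?enorm_ge0//.
move=> /(_ yr xy)/(le_lt_trans (ler_norm _)).
rewrite ltr_pdivlMr// => h.
have [p0|p0] := leP 0 (phi (enorm (x - y))).
  by apply: le_lt_trans h; rewrite mulrC ler_wpM2l// lerDl.
by apply: le_lt_trans e0; rewrite mulr_ge0_le0// ltW.
Qed.

Context (m : R) (phi : R -> R) (u X Xinv : R -> V -> V).
Hypotheses (osg : osgood_modulus m phi) (umod : field_has_modulus m phi u).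
Hypotheses (udiv : divergence_free u) (flowX : is_flow u X).
Hypothesis XK : forall t, 0 <= t -> cancel (X t) (Xinv t).
Hypothesis XinvK : forall t, 0 <= t -> cancel (Xinv t) (X t).

(** The constant in [field_has_modulus] carries no sign; as [phi] is positive on its domain, it may
    be raised to a nonnegative one. *)
Lemma field_modulus_ge0 : exists2 C, 0 <= C &
  forall t x y, 0 <= t -> 0 < enorm (x - y) -> enorm (x - y) < m ->
  enorm (u t x - u t y) <= C * phi (enorm (x - y)).
Proof.
have [C uC] := umod; exists (Num.max C 0); first by rewrite le_max lexx orbT.
move=> t x y t0 xy xym; apply: le_trans (uC t x y t0 xy xym) _.
by rewrite ler_wpM2r ?le_max ?lexx// ltW// (osgood_gt0 osg).
Qed.

Lemma field_coord_continuous t i : 0 <= t -> continuous (fun x => u t x 0 i).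
Proof.
have [C C0 uC] := field_modulus_ge0; move=> t0 x.
have cu : continuous (u t).
  have [m0 _ _ phi0 _] := osg.
  by apply: (field_continuous m0 C0 phi0) => y z; exact: uC.
exact: (@continuous_comp _ _ _ (u t) (fun y : V => y 0 i) x (cu x) (@coord_continuous _ _ _ _ _ _)).
Qed.

Lemma flow_time_continuous T x : 0 <= T -> continuous (fun s => X (clip 0 T s) x).
Proof.
move=> T0; apply: (@continuous_clip _ _ (X ^~ x)) => //.
apply/subspace_continuousP => s; rewrite /= in_itv /= => /andP[s0 sT].
have [X0 X0c dX] := flowX x.
move: s0; rewrite le_eqVlt => /predU1P[<-|s0]; last first.
  apply: cvg_within_filter; have [dXs _] := dX s s0.
  by apply: differentiable_continuous; apply/derivable1_diffP.
have -> : from_subspace `[0, T] (X ^~ x) 0 = x by exact: X0.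
move=> A xA; have := X0c A xA => -[r /= r0 rA].
exists r => //= h hr; rewrite in_itv /= => /andP[h0 _].
move: h0; rewrite le_eqVlt => /predU1P[<-|h0]; last exact: rA.
by change (A (X 0 x)); rewrite X0; exact: nbhs_singleton.
Qed.

Lemma flow_derive (x : V) (s : R) : 0 < s -> is_derive s 1 (X ^~ x) (u s (X s x)).
Proof. by have [_ _] := flowX x; exact. Qed.

Lemma div_free_opp t : 0 <= t -> forall psi : V -> R, C1_compact psi ->
  (\int[lam]_x (\sum_i (- u t x) 0 i * 'D_(delta_mx 0 i) psi x) = 0)%R.
Proof.
move=> t0 psi [dpsi cpsi [K cK psiK]].
have D i : 'D_(delta_mx 0 i) (- psi) = - 'D_(delta_mx 0 i) psi.
  by apply/funext => x; rewrite deriveN.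
have C1 : C1_compact (- psi).
  split=> [i x|i|]; first exact: derivableN.
    by rewrite D => x; apply: (@continuousN _ _ _ _ x); exact: cpsi.
  by exists K => // x Kx; rewrite fctE psiK// oppr0.
rewrite -[RHS](udiv t0 C1); congr (Rintegral _ _ _); apply/funext => x.
apply: eq_bigr => i _.
rewrite [X in _ = _ * X](_ : _ = - 'D_(delta_mx 0 i) psi x); last exact: deriveN.
by rewrite mxE mulrN mulNr.
Qed.

Lemma flow_volume t K : 0 <= t -> compact K -> (lam (X t @` K) <= lam K)%E.
Proof.
move=> t0 cK; have [C C0 uC] := field_modulus_ge0.
apply: (flow_volume_le osg (v := u) t0 C0) => //.
- by move=> s s0 _ x y; apply: uC; exact: ltW.
- by move=> x; have [] := flowX x.
- by move=> x; exact: flow_time_continuous.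
- by move=> x s s0 _; exact: flow_derive.
- by move=> s s0 _ i; apply: field_coord_continuous; exact: ltW.
- by move=> s s0 _; apply: udiv; exact: ltW.
Qed.

Lemma flow_space_continuous t : 0 <= t -> continuous (X t).
Proof.
move=> t0; have [C C0 uC] := field_modulus_ge0.
apply: (flow_continuous osg (v := u) t0 C0) => //.
- by move=> s s0 _ x y; apply: uC; exact: ltW.
- by move=> x; have [] := flowX x.
- by move=> x; exact: flow_time_continuous.
- by move=> x s s0 _; exact: flow_derive.
Qed.

Section reversed.
Variable t : R.
Hypothesis t0 : 0 <= t.
(** Trajectories run backwards from time [t]. They solve the equation of [v], which inherits the
    modulus and the vanishing divergence of [u], and [Y t] is the inverse flow. *)
Let Y s y := X (t - s) (Xinv t y).
Let v s x := - u (t - s) x.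

Let Y_derive (x : V) (s : R) : 0 < s -> s < t -> is_derive s 1 (Y ^~ x) (v s (Y s x)).
Proof.
move=> s0 st; apply: is_derive_rV => i.
have ts : 0 < t - s by rewrite subr_gt0.
have h1 := is_derive_coord i (flow_derive (Xinv t x) ts).
have h2 : is_derive s (1 : R) (fun s => t - s) (0 - 1) by exact: is_deriveB.
have := @is_derive1_comp _ (fun s => X s (Xinv t x) 0 i) _ s _ _ h1 h2.
by rewrite sub0r mulrN1 /v mxE.
Qed.

Let Y_continuous x : continuous (fun s => Y (clip 0 t s) x).
Proof.
(* Clipping to [0, t] commutes with the reflection [s -> t - s]. *)
have -> : (fun s => Y (clip 0 t s) x) = (fun s => X (clip 0 t s) (Xinv t x)) \o (fun s => t - s).
  apply/funext => s /=; rewrite /Y; congr (X _ _); rewrite /clip.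
  case: (lerP s t) => st; case: (lerP (t - s) t) => ts.
  - have -> : Num.max 0 s = s by apply: max_r; lra.
    by apply/esym/max_r; lra.
  - have -> : Num.max 0 s = 0 by apply: max_l; lra.
    by rewrite subr0; apply/esym/max_r; exact: t0.
  - have -> : Num.max 0 t = t by apply: max_r; exact: t0.
    by rewrite subrr; apply/esym/max_l; lra.
  - by have := t0; lra.
move=> s; apply: continuous_comp; last exact: flow_time_continuous.
by apply: cvgB; [exact: cvg_cst|exact: cvg_id].
Qed.

Let v_modulus C : (forall t x y, 0 <= t -> 0 < enorm (x - y) -> enorm (x - y) < m ->
  enorm (u t x - u t y) <= C * phi (enorm (x - y))) ->
  forall s, 0 < s -> s < t -> forall x y, 0 < enorm (x - y) -> enorm (x - y) < m ->
    enorm (v s x - v s y) <= C * phi (enorm (x - y)).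
Proof.
move=> uC s s0 st x y xy xym; rewrite /v opprK addrC enormB enormB.
by rewrite enormB; apply: uC; rewrite // subr_ge0 ltW.
Qed.

Let Y0 x : Y 0 x = x.
Proof. by rewrite /Y subr0 XinvK. Qed.

Let Yt x : Y t x = Xinv t x.
Proof. by rewrite /Y subrr; have [] := flowX (Xinv t x). Qed.

Lemma flow_inv_continuous : continuous (Xinv t).
Proof.
have [C C0 uC] := field_modulus_ge0.
have <- : Y t = Xinv t by apply/funext.
exact: (flow_continuous osg t0 C0 (v_modulus uC) Y0 Y_continuous Y_derive).
Qed.

Lemma flow_inv_volume K : compact K -> (lam (Xinv t @` K) <= lam K)%E.
Proof.
have [C C0 uC] := field_modulus_ge0.
have <- : Y t = Xinv t by apply/funext.
move=> cK; apply: (flow_volume_le osg t0 C0 (v_modulus uC) Y0 Y_continuous Y_derive) => //.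
- move=> s s0 st i x; rewrite /v; under eq_fun do rewrite mxE.
  apply: (@continuousN _ _ _ _ x); apply: field_coord_continuous.
  by rewrite subr_ge0 ltW.
- by move=> s s0 st; apply: div_free_opp; rewrite subr_ge0 ltW.
Qed.

(** On a box [B] the preimage is [X_t B], of measure at most that of [B]. Conversely [B] is the
    image under the inverse flow of the compact set [X_t B], so its measure is at most that of
    [X_t B]. *)
Lemma flow_inv_measure_preserving A : measurable A -> lam (Xinv t @^-1` A) = lam A.
Proof.
move=> mA.
have mX : measurable_fun setT (Xinv t).
  by apply: continuous_measurable_rV_rV; exact: flow_inv_continuous.
have pre K : Xinv t @^-1` K = X t @` K.
  apply/seteqP; split => [x Kx|_ [x Kx <-]]; last by rewrite /= XK.
  by exists (Xinv t x); rewrite ?XinvK.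
have box (a b : V) : lam (Xinv t @^-1` cbox a b) = lam (cbox a b).
  have cK := @cbox_compact R d a b.
  apply/eqP; rewrite eq_le pre flow_volume//=.
  have {1}-> : cbox a b = Xinv t @` (X t @` cbox a b).
    rewrite image_comp; apply/seteqP; split => [x abx|_ [x abx <-]] /=; last by rewrite XK.
    by exists x; rewrite //= XK.
  apply: flow_inv_volume; apply: continuous_compact => //.
  by apply: continuous_subspaceT; exact: flow_space_continuous.
rewrite -[LHS]/(pushforward lam (Xinv t) A).
apply: (@cbox_measure_unique R d _ lam) => //.
move=> a b; rewrite /= /pushforward box; exact: lebesgue_rV_cbox_lty.
Qed.

End reversed.

End measure_preserving.

(** * The modulus of continuity of the inverse flow *)

Section lower_integral.
Context d (T : measurableType d) (R : realType) (mu : {measure set T -> \bar R}).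

Import HBNNSimple.

(* The integral of a nonnegative function is the supremum of the integrals of
   the simple functions below it, hence monotone without measurability. *)
Lemma ge0_le_lower_integral (D1 D2 : set T) (f1 f2 : T -> \bar R) : D1 `<=` D2 ->
  (forall x, D1 x -> 0 <= f1 x)%E -> (forall x, D2 x -> 0 <= f2 x)%E ->
  (forall x, D1 x -> f1 x <= f2 x)%E ->
  (\int[mu]_(x in D1) f1 x <= \int[mu]_(x in D2) f2 x)%E.
Proof.
move=> D12 f10 f20 f12; rewrite !ge0_integralE//.
apply: ereal_sup_le => _ [h /= hf <-]; exists h => //= x.
apply: le_trans (hf x) _; rewrite !patchE.
case: ifPn => [/set_mem D1x|_].
  by rewrite mem_set ?f12//; exact: D12.
by case: ifPn => [/set_mem D2x|_]; [exact: f20|exact: lexx].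
Qed.

End lower_integral.

Section integral_dini.
Context (R : realType).
Let mu := @lebesgue_measure R.

Lemma continuous_itv_integrable (f : R -> R) (a b : R) : continuous f ->
  mu.-integrable `[a, b] (EFin \o f).
Proof.
move=> cf; apply: continuous_compact_integrable; first exact: segment_compact.
exact: continuous_subspaceT.
Qed.

(** The primitive starts at -1 so as to have a two-sided derivative at 0. *)
Lemma continuous_primitive (w : R -> R) : continuous w ->
  exists W : R -> R, forall x : R, -1 < x -> is_derive x 1 W (w x).
Proof.
move=> cw; exists (fun x => \int[mu]_(t in `[-1, x]) w t)%R => x x1.
have xu : x < x + 1 by rewrite ltrDl.
have [dW W'] := continuous_FTC1_closed xu (continuous_itv_integrable (-1) (x + 1) cw) x1 (cw x).
by apply: DeriveDef => //; rewrite -derive1E.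
Qed.

Lemma continuous_shift_diff (w : R -> R) h : continuous w ->
  continuous (fun s => w (s + h) - w s).
Proof.
move=> cw s; apply: cvgB; last exact: cw.
apply: (@continuous_comp _ _ _ (fun s => s + h) w); last exact: cw.
by apply: cvgD; [exact: cvg_id|exact: cvg_cst].
Qed.

Lemma integral_shift_diff (w W : R -> R) (t h : R) : 0 < t -> 0 < h -> continuous w ->
  (forall x : R, -1 < x -> is_derive x 1 W (w x)) ->
  (\int[mu]_(s in `[0%R, t]) (w (s + h) - w s)%R%:E =
   ((W (t + h) - W t) - (W (0 + h) - W 0))%R%:E)%E.
Proof.
move=> t0 h0 cw dW.
have cD := @continuous_shift_diff w h cw.
have dF (s : R) : -1 < s -> is_derive s 1 (fun s => W (s + h) - W s) (w (s + h) - w s).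
  move=> s1; apply: is_deriveB; last exact: dW.
  have h1 : is_derive s (1 : R) (fun s => s + h) (1 + 0) by exact: is_deriveD.
  have sh : -1 < s + h by rewrite (lt_trans s1)// ltrDl.
  have := @is_derive1_comp _ W (fun s => s + h) s _ _ (dW _ sh) h1.
  by rewrite addr0 mulr1.
rewrite (@continuous_FTC2 _ _ (fun s => W (s + h) - W s))//.
- exact: continuous_subspaceT.
- have cF s : -1 < s -> {for s, continuous (fun s => W (s + h) - W s)}.
    by move=> /dF; exact: is_derive_continuous.
  split.
  + move=> s; rewrite in_itv /= => /andP[s0 _].
    by have [] := dF s (lt_trans (ltrN10 R) s0).
  + by apply: cvg_at_right_filter; apply: cF.
  + by apply: cvg_at_left_filter; apply: cF; rewrite (lt_trans _ t0).
- move=> s; rewrite in_itv /= => /andP[s0 _]; rewrite derive1E.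
  by have [_ ->] := dF s (lt_trans (ltrN10 R) s0).
Qed.

Lemma is_derive_harmonic (W : R -> R) (x l : R) : is_derive x 1 W l ->
  n.+1%:R * (W (x + n.+1%:R^-1) - W x) @[n --> \oo] --> l.
Proof.
move=> /is_derive_cvgP Wl.
have hdn : (n.+1%:R^-1 : R) @[n --> \oo] --> (0 : R)^'.
  move=> A hA; have hB : \forall n \near \oo, (n.+1%:R^-1 : R) != 0 -> A n.+1%:R^-1.
    by exact: (@cvg_harmonic R _ hA).
  by apply: filterS hB => n /=; apply; rewrite invr_eq0 pnatr_eq0.
apply: cvg_trans (cvg_comp _ _ hdn Wl); apply: near_eq_cvg; apply: nearW => n /=.
by rewrite invrK scaler1 (addrC x).
Qed.

Lemma limn_einf_ge (u : (\bar R)^nat) (l : R) :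
  (forall e, 0 < e -> \forall n \near \oo, ((l - e)%:E <= u n)%E) -> (l%:E <= limn_einf u)%E.
Proof.
move=> ul; apply/lee_subgt0Pr => e e0; rewrite -EFinB limn_einf_lim.
apply: lime_ge; first exact: is_cvg_einfs.
have [N _ HN] := ul e e0.
exists N => // n /= Nn; apply: le_ereal_inf_tmp => _ [k /= nk <-].
by apply: HN; exact: leq_trans nk.
Qed.

(** Since [a] may fail to be measurable, a measurable function [k <= a] is built from [w]. Fatou's
    lemma, applied to [C] minus the difference quotients of [w], shows that the integral of [k] is
    at least [w t - w 0]; the lower integral of [a] is larger still. *)
Lemma integral_dini (w a : R -> R) (t C : R) : 0 <= t -> continuous w ->
  (forall s, t <= s -> w s = w t) ->
  (forall s, 0 <= s <= t -> 0 <= a s <= C) ->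
  (forall s, 0 < s -> s < t -> forall e, 0 < e ->
    exists2 r, 0 < r & forall h, 0 < h -> h < r -> w (s + h) - w s <= (a s + e) * h) ->
  w t - w 0 <= (\int[mu]_(s in `[0, t]) a s)%R.
Proof.
rewrite le_eqVlt => /predU1P[<- _ _ _ _|t0 cw wt aC dw].
  by rewrite subrr set_itv1 Rintegral_set1.
have C0 : 0 <= C.
  by have /andP[] : 0 <= a 0 <= C; [apply: aC; rewrite lexx ltW|exact: le_trans].
(* A one-sided Lipschitz bound, which makes the functions [f n] below nonnegative. It extends past
   [t], where [w] is constant; the shifted times may lie there. *)
have wC s s' : 0 <= s -> s <= s' -> w s' - w s <= C * (s' - s).
  move=> s0 ss'.
  have H r : 0 <= s -> s <= r -> r <= t -> w r - w s <= C * (r - s).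
    move=> _ sr rt; apply: dini_le => // q sq qr e e0.
    have q0 : 0 < q by exact: le_lt_trans sq.
    have qt : q < t by exact: lt_le_trans rt.
    have [p p0 pP] := dw q q0 qt e e0; exists p => // h h0 hp.
    apply: le_trans (pP h h0 hp) _; rewrite ler_pM2r// lerD2r.
    by have /andP[] : 0 <= a q <= C; [apply: aC; rewrite !ltW|].
  have [s't|ts'] := leP s' t; first exact: H.
  have [st|ts] := leP s t; last first.
    by rewrite (wt s (ltW ts)) (wt s' (ltW ts')) subrr mulr_ge0// subr_ge0.
  rewrite (wt _ (ltW ts')); apply: le_trans (H t s0 st (lexx _)) _.
  by rewrite ler_wpM2l// lerD2r ltW.
have [W dW] := continuous_primitive cw.
pose D : set (measurableTypeR R) := `[0, t]%classic.
have mD : measurable D by exact: measurable_itv.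
have muD : mu D = t%:E.
  by apply: etrans (lebesgue_measure_itv `[0, t]) _ => /=; rewrite lte_fin t0 -EFinB subr0.
pose f n s : R := C - n.+1%:R * (w (s + n.+1%:R^-1) - w s).
have n0 n : 0 < (n.+1%:R^-1 : R) by rewrite invr_gt0 ltr0n.
have f0 n s : D s -> 0 <= f n s.
  rewrite /D /= in_itv /= => /andP[s0 st]; rewrite subr_ge0 mulrC -ler_pdivlMr ?ltr0n//.
  by apply: le_trans (wC _ (s + n.+1%:R^-1) s0 _) _; rewrite ?lerDl ?(ltW (n0 n))// addrAC subrr add0r.
have cf n : continuous (f n).
  move=> s; apply: cvgB; first exact: cvg_cst.
  by apply: cvgM; [exact: cvg_cst|exact: continuous_shift_diff].
have mf n : measurable_fun D (EFin \o f n).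
  by have /integrableP[] := continuous_itv_integrable 0 t (cf n).
pose Iw n := (W (t + n.+1%:R^-1) - W t) - (W (0 + n.+1%:R^-1) - W 0).
have fI n : (\int[mu]_(s in D) (f n s)%:E = (C * t - n.+1%:R * Iw n)%:E)%E.
  have cD := @continuous_shift_diff w n.+1%:R^-1 cw.
  have iD := continuous_itv_integrable 0 t cD.
  have icst : mu.-integrable D (EFin \o fun=> C).
    by apply: continuous_itv_integrable; exact: cst_continuous.
  transitivity (\int[mu]_(s in D)
    (C%:E - (n.+1%:R)%R%:E * ((w (s + n.+1%:R^-1) - w s)%R)%:E))%E; first exact: eq_integral.
  rewrite integralB//; last exact: integrableZl.
  rewrite integralZl// (integral_shift_diff t0 (n0 n) cw dW) integral_cst//.
  by rewrite [X in (_ * X - _)%E](_ : _ = t%:E); [rewrite -!EFinM -EFinB|exact: muD].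
have cvgI : (n.+1%:R * Iw n) @[n --> \oo] --> w t - w 0.
  have h1 := is_derive_harmonic (dW t (lt_trans (ltrN10 R) t0)).
  have h2 := is_derive_harmonic (dW 0 (ltrN10 R)).
  apply: cvg_trans (cvgB h1 h2); apply: near_eq_cvg; apply: nearW => n.
  by rewrite /= fctE -mulrBr.
pose l s := limn_einf (fun n => (f n s)%:E).
have l0 s : D s -> (0 <= l s)%E.
  move=> Ds; rewrite /l -[0%E]/(0%:E); apply: limn_einf_ge => e e0; apply: nearW => n.
  by rewrite lee_fin sub0r (le_trans _ (f0 n s Ds))// oppr_le0 ltW.
have ml : measurable_fun D l.
  apply: measurableT_comp => //; apply: measurable_fun_limn_esup => n.
  suff : measurable_fun D (EFin \o (fun s => - f n s)) by [].
  apply/measurable_EFinP; apply: measurableT_comp => //.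
  by apply/measurable_EFinP; exact: mf.
have il : (\int[mu]_(s in D) l s <= (C * t - (w t - w 0))%:E)%E.
  have f0E n s : D s -> (0 <= (f n s)%:E)%E by move=> Ds; rewrite lee_fin; exact: f0.
  apply: le_trans (@fatou _ _ _ mu D mD (fun n s => (f n s)%:E) mf f0E) _.
  under eq_fun do rewrite fI.
  have cvgE : (C * t - n.+1%:R * Iw n)%:E @[n --> \oo] --> (C * t - (w t - w 0))%:E.
    by apply/cvg_EFin; [exact: nearW|apply: cvgB => //; exact: cvg_cst].
  by rewrite (cvg_limn_einf_sup cvgE).1.
(* The inferior limit [l] may be infinite; truncating it at [C] makes [k] finite and nonnegative. *)
pose k s := (C%:E - mine (l s) C%:E)%E.
have mm : measurable_fun D (fun s => mine (l s) C%:E) by exact: measurable_mine.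
have m0 s : D s -> (0 <= mine (l s) C%:E)%E by move=> Ds; rewrite le_min l0.
have mC s : (mine (l s) C%:E <= C%:E)%E by rewrite ge_min lexx orbT.
have mfin s : D s -> mine (l s) C%:E \is a fin_num.
  by move=> Ds; rewrite ge0_fin_numE ?m0// (le_lt_trans (mC s))// ltry.
have k0 s : D s -> (0 <= k s)%E by move=> Ds; rewrite /k sube_ge0 ?mC// mfin.
have mk : measurable_fun D k by apply: emeasurable_funB.
have kI : (\int[mu]_(s in D) k s + \int[mu]_(s in D) mine (l s) C%:E = (C * t)%:E)%E.
  rewrite -ge0_integralD//.
  transitivity (\int[mu]_(s in D) C%:E)%E.
    by apply: eq_integral => s /set_mem Ds; rewrite /k subeK// mfin.
  rewrite integral_cst// EFinM; congr (_ * _)%E; exact: muD.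
have Im : (\int[mu]_(s in D) mine (l s) C%:E <= (C * t - (w t - w 0))%:E)%E.
  apply: le_trans il; apply: ge0_le_integral => // s _.
  by rewrite ge_min lexx.
have Ik : ((w t - w 0)%:E <= \int[mu]_(s in D) k s)%E.
  have Ifin : (\int[mu]_(s in D) mine (l s) C%:E)%E \is a fin_num.
    rewrite ge0_fin_numE; first by rewrite (le_lt_trans Im)// ltry.
    by apply: integral_ge0.
  have -> : (\int[mu]_(s in D) k s = (C * t)%:E - \int[mu]_(s in D) mine (l s) C%:E)%E.
    by rewrite -kI addeK.
  rewrite -(fineK Ifin) -EFinB lee_fin.
  by move: Im; rewrite -(fineK Ifin) lee_fin; lra.
(* The Dini bound is only given inside the interval, so [k] and [a] are compared on the open
   interval, which has the same measure. *)
have Ika : (\int[mu]_(s in `]0%R, t[) k s <= \int[mu]_(s in D) (a s)%:E)%E.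
  apply: ge0_le_lower_integral.
  - exact: subset_itv_oo_cc.
  - by move=> s /subset_itv_oo_cc; exact: k0.
  - by move=> s; rewrite /D /= in_itv /= lee_fin => /aC /andP[].
  - move=> s; rewrite /= in_itv /= => /andP[s0 st].
    have Ds : D s by rewrite /D /= in_itv /= !ltW.
    have al : ((C - a s)%:E <= l s)%E.
      apply: limn_einf_ge => e e0; have [r r0 rP] := dw s s0 st e e0.
      have [N _ HN] := near_infty_natSinv_lt (PosNum r0).
      exists N => // n /= Nn; rewrite lee_fin.
      have := rP _ (n0 n) (HN n Nn); rewrite -ler_pdivrMr// invrK /f mulrC.
      by lra.
    have h : ((C - a s)%:E <= mine (l s) C%:E)%E.
      by rewrite le_min al lee_fin gerBl; have /andP[] : 0 <= a s <= C by apply: aC; rewrite !ltW.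
    rewrite /k; move: h; rewrite -(fineK (mfin s Ds)) -EFinB !lee_fin; lra.
have Ia : (\int[mu]_(s in D) (a s)%:E <= (C * t)%:E)%E.
  rewrite EFinM -muD -integral_cst//; apply: ge0_le_lower_integral => //.
  - by move=> s; rewrite /D /= in_itv /= lee_fin => /aC /andP[].
  - by move=> s; rewrite /D /= in_itv /= lee_fin => /aC /andP[].
rewrite -lee_fin /Rintegral fineK; last first.
  rewrite ge0_fin_numE; first by rewrite (le_lt_trans Ia)// ltry.
  by apply: integral_ge0 => s; rewrite /D /= in_itv /= lee_fin => /aC /andP[].
apply: le_trans Ik (le_trans _ Ika).
by rewrite integral_itv_bndoo//; apply: measurable_funS mk => //; exact: subset_itv_oo_cc.
Qed.

End integral_dini.

(** * Osgood estimate for two trajectories *)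

Section osgood_estimate.
Context (R : realType) (d : nat).
Local Notation V := 'rV[R]_d.
Context (m : R) (phi : R -> R) (u X : R -> V -> V).
Hypotheses (osg : osgood_modulus m phi) (umod : field_has_modulus m phi u).

Lemma field_seminorm_ub t x y : 0 <= t -> 0 < enorm (x - y) -> enorm (x - y) < m ->
  enorm (u t x - u t y) <= field_seminorm m phi (u t) * phi (enorm (x - y)).
Proof.
move=> t0 xy xym; have p0 := osgood_gt0 osg xy xym.
rewrite -ler_pdivrMr//; have [C uC] := umod.
apply: ub_le_sup; last by exists x, y; rewrite xy xym.
exists C => _ [x' [y' [/andP[h1 h2] ->]]].
by rewrite ler_pdivrMr ?(osgood_gt0 osg)//; exact: uC.
Qed.

Lemma field_seminorm_itv : exists2 C, 0 <= C &
  forall t, 0 <= t -> 0 <= field_seminorm m phi (u t) <= C.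
Proof.
have [C C0 uC] := field_modulus_ge0 osg umod; exists C => // t t0.
rewrite /field_seminorm; set A := (X in sup X).
have [->|/set0P A0] := eqVneq A set0; first by rewrite sup0 lexx.
have ubA : ubound A C.
  move=> _ [x [y [/andP[h1 h2] ->]]].
  by rewrite ler_pdivrMr ?(osgood_gt0 osg)//; exact: uC.
apply/andP; split; last exact: ge_sup.
have [q Aq] := A0; apply: (@le_trans _ _ q); last by apply: ub_le_sup => //; exists C.
by case: Aq => x [y [/andP[h1 h2] ->]]; rewrite divr_ge0 ?enorm_ge0// ltW// (osgood_gt0 osg).
Qed.

(** When two points approach each other, the growth of [M] is governed by [phi] just below their
    distance, and [phi] may jump there; moreover the seminorm says nothing at distance exactly [m].
    A point [z] of the segment close to [y] settles both: [x] and [z] are at a smaller distance, and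
    the contribution of [z] and [y] is negligible. *)
Lemma field_seminorm_chord t x y e : 0 <= t -> 0 < enorm (x - y) -> enorm (x - y) <= m -> 0 < e ->
  exists c, [/\ 0 < c, c < m, c < enorm (x - y) &
    enorm (u t x - u t y) <= (field_seminorm m phi (u t) + e / 2) * phi c].
Proof.
move=> t0; set r := enorm (x - y) => r0 rm e0.
set a := field_seminorm m phi (u t).
have [C C0 aC] := field_seminorm_itv.
have aC' : a <= C by have /andP[] := aC t t0.
have [_ _ _ phi0 _] := osg.
have r20 : 0 < r / 2 by lra.
have r2m : r / 2 < m by lra.
have ph := osgood_gt0 osg r20 r2m.
have C1 : 0 < C + 1 by lra.
pose e1 := e / 2 * phi (r / 2) / (C + 1).
have e10 : 0 < e1 by rewrite /e1 !mulr_gt0// ?invr_gt0.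
have e1E : e1 * (C + 1) = e / 2 * phi (r / 2) by rewrite /e1 divfK// gt_eqF.
have /cvgrPdist_lt/(_ _ e10) := phi0 => -[r1 /= r10 rP].
(* The first bound gives [eta r < r1], hence [phi (eta r) < e1]; the second gives [eta <= 1/4],
   hence [(1 - eta) r >= r / 2]. The value of [e1] makes the short piece cost at most
   [e / 2 * phi (r / 2)]. *)
pose eta := Num.min (r1 / (2 * r)) 2^-1 / 2.
have q0 : 0 < r1 / (2 * r) by rewrite divr_gt0// mulr_gt0.
have h0 : (0 : R) < 2^-1 by lra.
have eta0 : 0 < eta by rewrite /eta divr_gt0// lt_min q0 h0.
have eta1 : eta <= 2^-1 / 2 by rewrite /eta ler_pM2r// ge_min lexx orbT.
have etar : eta * r < r1.
  have : eta <= r1 / (2 * r) / 2 by rewrite /eta ler_pM2r// ge_min lexx.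
  move=> /(ler_wpM2r (ltW r0)) /le_lt_trans; apply.
  by rewrite (_ : _ / _ / 2 * r = r1 / 4); [lra|field; rewrite gt_eqF].
move: (eta) eta0 eta1 etar => {q0 h0} {}eta eta0 eta1 etar.
pose z := y + eta *: (x - y).
have xz : enorm (x - z) = (1 - eta) * r.
  rewrite (_ : x - z = (1 - eta) *: (x - y)).
    by rewrite enormZ ger0_norm//; lra.
  by apply/rowP => i; rewrite !mxE; ring.
have zy : enorm (z - y) = eta * r.
  by rewrite /z addrC addKr enormZ gtr0_norm.
have uxz : 0 < enorm (x - z) -> enorm (x - z) < m -> _ := @field_seminorm_ub t x z t0.
have uzy : 0 < enorm (z - y) -> enorm (z - y) < m -> _ := @field_seminorm_ub t z y t0.
have uxy : enorm (u t x - u t y) <= enorm (u t x - u t z) + enorm (u t z - u t y).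
  by rewrite -[X in enorm X <= _](subrKA (u t z)); exact: ler_enormD.
move: uxz uzy uxy; rewrite xz zy.
set N1 := enorm _; set N2 := enorm _; set N := enorm _; rewrite -/a.
move: (N) (N1) (N2) (a) aC' (r) r0 rm r20 r2m ph e1 e10 e1E rP etar => {N N1 N2 xz zy z aC a r}.
move=> N N1 N2 a aC r r0 rm r20 r2m ph e1 e10 e1E rP etar uxz uzy uxy.
have er0 : 0 < eta * r by rewrite mulr_gt0.
have erm : eta * r < m by nra.
have cr0 : 0 < (1 - eta) * r by rewrite mulr_gt0//; lra.
have cr : (1 - eta) * r < r by nra.
have crm : (1 - eta) * r < m by exact: lt_le_trans rm.
exists ((1 - eta) * r); split => //.
have phe := osgood_gt0 osg er0 erm.
have h1 := uxz cr0 crm.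
have h2 : N2 <= e / 2 * phi (r / 2).
  apply: (le_trans (uzy er0 erm)).
  have := rP (eta * r); rewrite /ball_ /= !sub0r !normrN !gtr0_norm//.
  move=> /(_ etar er0) h; rewrite -e1E mulrC.
  by apply: (le_trans (ler_wpM2l (ltW phe) (_ : a <= C + 1))); [lra|rewrite ler_wpM2r ?ltW].
have h3 : phi (r / 2) <= phi ((1 - eta) * r).
  by apply: (osgood_le osg) => //; nra.
have h5 : e / 2 * phi (r / 2) <= e / 2 * phi ((1 - eta) * r).
  by rewrite ler_wpM2l//; lra.
by rewrite mulrDl; lra.
Qed.

Lemma osgood_M_lip c p q : 0 < c -> c < m -> c <= p -> p <= q ->
  osgood_M m phi p - osgood_M m phi q <= (q - p) / phi c.
Proof.
move=> c0 cm cp pq; have phic := osgood_gt0 osg c0 cm.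
have [pm|mp] := ltP p m; last first.
  rewrite !osgood_M_ge// ?(le_trans mp)// subrr divr_ge0 ?subr_ge0// ltW//.
have p0 : 0 < p by exact: lt_le_trans cp.
apply: le_trans (osgood_M_diff_le osg p0 pm pq) _.
rewrite ler_wpM2l ?subr_ge0// lef_pV2 ?posrE// ?(osgood_gt0 osg)//.
exact: (osgood_le osg).
Qed.

Lemma osgood_M_continuous p : 0 < p -> {for p, continuous (osgood_M m phi)}.
Proof.
move=> p0; have m0 := osgood_m_gt0 osg.
pose c := Num.min p m / 2.
have c0 : 0 < c by rewrite divr_gt0// lt_min p0.
have cp : c < p.
  have : Num.min p m <= p by rewrite ge_min lexx.
  by rewrite /c; lra.
have cm : c < m.
  have : Num.min p m <= m by rewrite ge_min lexx orbT.
  by rewrite /c; lra.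
have phic := osgood_gt0 osg c0 cm.
have H q : c <= q -> `|osgood_M m phi p - osgood_M m phi q| <= `|p - q| / phi c.
  move=> cq; have [pq|/ltW qp] := leP p q.
    rewrite ger0_norm ?subr_ge0 ?(osgood_M_le osg)// distrC ger0_norm ?subr_ge0//.
    by apply: osgood_M_lip => //; exact: ltW.
  rewrite distrC ger0_norm ?subr_ge0 ?(osgood_M_le osg) ?(lt_le_trans c0)//.
  by rewrite ger0_norm ?subr_ge0//; exact: osgood_M_lip.
apply/cvgrPdist_le => e e0; near=> q.
apply: le_trans (H q _) _.
  by near: q; apply: (cvgr_ge p) => //; exact: cvg_id.
rewrite ler_pdivrMr//; near: q; apply: cvgr_dist_le; first exact: cvg_id.
by rewrite mulr_gt0.
Unshelve. all: by end_near. Qed.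

(** Three cases: beyond [m] the function [M] vanishes; if the distance increases, [M] does not
    increase; otherwise [M] is Lipschitz with constant [1 / phi c] above [c]. *)
Lemma osgood_M_dini (p : R -> R) s a e : {for s, continuous p} -> 0 <= a -> 0 < e ->
  (p s <= m -> exists c, [/\ 0 < c, c < m, c < p s & forall e', 0 < e' ->
     exists2 r, 0 < r & forall h, 0 < h -> h < r ->
       p s - p (s + h) <= ((a + e / 2) * phi c + e') * h]) ->
  exists2 r, 0 < r & forall h, 0 < h -> h < r ->
    osgood_M m phi (p (s + h)) - osgood_M m phi (p s) <= (a + e) * h.
Proof.
move=> cps a0 e0 dp.
have ae0 : 0 <= a + e by lra.
have [pm|mp] := leP (p s) m; last first.
  have /cvgr_gt/(_ _ mp)/nbhs_ballP[r /= r0 rP] := cps.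
  exists r => // h h0 hr.
  have mph : m <= p (s + h).
    by apply/ltW/rP; rewrite -ball_normE /= opprD addNKr normrN gtr0_norm.
  by rewrite (osgood_M_ge _ mph) (osgood_M_ge _ (ltW mp)) subrr (mulr_ge0 ae0 (ltW h0)).
have [c [c0 cm cp' {}dp]] := dp pm.
have phic := osgood_gt0 osg c0 cm.
have /cvgr_gt/(_ _ cp')/nbhs_ballP[r1 /= r10 r1P] := cps.
(* After division by [phi c] this slack becomes the second half of [e]. *)
have e20 : 0 < e / 2 * phi c by rewrite mulr_gt0// divr_gt0.
have [r2 r20 r2P] := dp _ e20.
exists (Num.min r1 r2); first by rewrite lt_min r10 r20.
move=> h h0; rewrite lt_min => /andP[hr1 hr2].
have [pp|/ltW pp] := leP (p s) (p (s + h)).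
  have : osgood_M m phi (p (s + h)) <= osgood_M m phi (p s).
    by apply: (osgood_M_le osg) => //; exact: lt_trans cp'.
  by rewrite -subr_le0 => /le_trans; apply; exact: mulr_ge0 ae0 (ltW h0).
have cph : c < p (s + h).
  by apply: r1P; rewrite -ball_normE /= opprD addNKr normrN gtr0_norm.
apply: le_trans (osgood_M_lip c0 cm (ltW cph) pp) _.
rewrite ler_pdivrMr//; apply: le_trans (r2P h h0 hr2) _.
by rewrite [leRHS]mulrAC ler_wpM2r ?(ltW h0)// -mulrDl -addrA -splitr.
Qed.

Hypothesis flowX : is_flow u X.
Hypothesis Xinj : forall t, 0 <= t -> injective (X t).

(** Injectivity keeps the distance positive, where [M] is continuous. As [M] decreases, an upper
    bound on it bounds the distance at time [t] from below, which is what controls the inverse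
    flow. *)
Lemma osgood_flow_estimate t x y : 0 <= t -> x != y ->
  osgood_M m phi (enorm (X t x - X t y)) - osgood_M m phi (enorm (x - y)) <=
  (\int[lebesgue_measure]_(s in `[0, t]) field_seminorm m phi (u s))%R.
Proof.
move=> t0 xy; have m0 := osgood_m_gt0 osg.
pose p s := enorm (X s x - X s y).
have p0 s : 0 <= s -> 0 < p s.
  by move=> s0; rewrite enorm_gt0 subr_eq0; apply: contra_neq xy; exact: Xinj.
pose w s := osgood_M m phi (p (clip 0 t s)).
have cp : continuous (fun s => p (clip 0 t s)).
  move=> s; apply: (@continuous_comp _ _ _ (fun s => X (clip 0 t s) x - X (clip 0 t s) y) (@enorm R d)).
    by apply: continuousB; exact: (flow_time_continuous flowX t0).
  exact: enorm_continuous.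
have cw : continuous w.
  move=> s; apply: (@continuous_comp _ _ _ (fun s => p (clip 0 t s)) (osgood_M m phi)); first exact: cp.
  by apply: osgood_M_continuous; apply: p0; case/andP: (clip_itv s t0).
have [C C0 aC] := field_seminorm_itv.
have -> : osgood_M m phi (enorm (X t x - X t y)) = w t by rewrite /w clip_id.
have -> : osgood_M m phi (enorm (x - y)) = w 0.
  have [Xx _ _] := flowX x; have [Xy _ _] := flowX y.
  by rewrite /w clip_id /p ?Xx ?Xy; [|exact: lexx|exact: t0].
have wt s : t <= s -> w s = w t.
  move=> ts; rewrite /w; congr (osgood_M m phi (p _)).
  by rewrite /clip !min_r.
have aC' s : 0 <= s <= t -> 0 <= field_seminorm m phi (u s) <= C by move=> /andP[s0 _]; exact: aC.
apply: (integral_dini t0 cw wt aC').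
move=> s s0 st e e0; set a := field_seminorm m phi (u s).
have a0 : 0 <= a by case/andP: (aC s (ltW s0)).
have ps := p0 s (ltW s0).
have dz : is_derive s 1 (fun s => X s x - X s y) (u s (X s x) - u s (X s y)).
  by apply: is_deriveB; exact: flow_derive.
have cps : {for s, continuous p}.
  have cz : {for s, continuous (fun s => X s x - X s y)}.
    by have [h _] := dz; apply: differentiable_continuous; apply/derivable1_diffP.
  exact: (@continuous_comp _ _ _ _ (@enorm R d) s cz (@enorm_continuous R d _)).
have [|r r0 rP] := @osgood_M_dini p s a e cps a0 e0.
  move=> pm; have [c [c0 cm cps' Nc]] := field_seminorm_chord (ltW s0) ps pm e0.
  exists c; split=> // e' e'0; have [r r0 rP] := is_derive_enorm_le dz e'0.
  exists r => // h h0 hr; have := rP h; rewrite gtr0_norm// => /(_ hr) h1.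
  have := le_trans (ler_norm _) (ler_enorm_dist (X s x - X s y) (X (s + h) x - X (s + h) y)).
  rewrite [X in _ <= X]enormB => /le_trans; apply; apply: le_trans h1 _.
  by rewrite ler_wpM2r ?(ltW h0)// lerD2r.
have ts0 : 0 < t - s by rewrite subr_gt0.
exists (Num.min r (t - s)); first by rewrite lt_min r0 ts0.
move=> h h0; rewrite lt_min => /andP[hr ht].
have sht : s + h <= t by rewrite addrC -lerBrDr ltW.
have s0h : 0 <= s + h := addr_ge0 (ltW s0) (ltW h0).
by have := rP h h0 hr; rewrite /w (clip_id s0h sht) (clip_id (ltW s0) (ltW st)).
Qed.

End osgood_estimate.

(** * Integrals of increments *)

Section polar.
Context (R : realType).
Let mu := @lebesgue_measure R.

Lemma pushforward_lebesgue_scale (c : R) (A : set (measurableTypeR R)) : 0 < c -> measurable A ->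
  pushforward mu (fun x => (c * x)%R : measurableTypeR R) A = (c^-1%:E * mu A)%E.
Proof.
move=> c0 mA; have c0' := ltW c0.
have mc : measurable_fun setT (fun x : measurableTypeR R => (c * x)%R : measurableTypeR R).
  exact: measurable_funM.
have itvE (a b : R) : mu `]a, b]%classic = (if a < b then (b - a)%R%:E else 0%E).
  by apply: etrans (lebesgue_measure_itv `]a, b]) _ => /=; rewrite lte_fin EFinB.
have h X : ocitv X -> mu X = (c%:E * pushforward mu (fun x => (c * x)%R : measurableTypeR R) X)%E.
  move=> [[a b]] _ <-; rewrite /pushforward.
  have -> : (fun x => (c * x)%R : measurableTypeR R) @^-1` `]a, b]%classic = `]a / c, b / c]%classic.
    apply/seteqP; split => x /=; rewrite !in_itv /= => /andP[h1 h2].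
      by rewrite ltr_pdivrMr// ler_pdivlMr// (mulrC x) h1.
    by move: h1 h2; rewrite ltr_pdivrMr// ler_pdivlMr// (mulrC x) => -> ->.
  rewrite !itvE ltr_pM2r ?invr_gt0//.
  case: ifPn => // _; last by rewrite mule0.
  by rewrite -EFinM -mulrBl mulrC divfK// gt_eqF.
have -> : mu A = (c%:E * pushforward mu (fun x => (c * x)%R : measurableTypeR R) A)%E.
  rewrite -[RHS]/(pushforward (mscale (NngNum c0') mu) (fun x => (c * x)%R : measurableTypeR R) A).
  by apply: lebesgue_measure_unique.
by rewrite muleA -EFinM mulVf ?gt_eqF// mul1e.
Qed.

Lemma ge0_integral_lebesgue_scale (c : R) (f : R -> \bar R) : 0 < c ->
  measurable_fun setT f -> (forall x, 0 <= f x)%E ->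
  (\int[mu]_x f (c * x)%R = c^-1%:E * \int[mu]_x f x)%E.
Proof.
move=> c0 mf f0.
have cn0 : 0 <= c^-1 by rewrite invr_ge0 ltW.
rewrite -(ge0_integral_mscale _ measurableT (NngNum cn0))//.
have mc : measurable_fun setT (fun x : measurableTypeR R => (c * x)%R : measurableTypeR R).
  exact: measurable_funM.
transitivity (\int[pushforward mu (fun x => (c * x)%R : measurableTypeR R)]_x f x)%E.
  by rewrite ge0_integral_pushforward.
by apply: eq_measure_integral => A mA _; exact: pushforward_lebesgue_scale.
Qed.

Lemma measurable_nonneg_inv d (T : measurableType d) (f : T -> R) : (forall x, 0 <= f x) ->
  measurable_fun setT (f : T -> measurableTypeR R) ->
  measurable_fun setT (fun x => (f x)^-1 : measurableTypeR R).
Proof.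
move=> f0 mf; have -> : (fun x => (f x)^-1) = (@powR R ^~ (-1)) \o f.
  by apply/funext => x /=; rewrite powR_inv1.
by apply: measurableT_comp => //; exact: measurable_powR.
Qed.

Context (n : nat).
Local Notation d := n.+1.
Let lam := lebesgue_rV R d.
Local Notation V := 'rV[R]_d.

Definition unit_ball_volume : R := fine (lam [set x : V | enorm x <= 1]).

Lemma lebesgue_ball (r : R) : 0 < r ->
  lam [set x : V | enorm x <= r] = (r ^+ d * unit_ball_volume)%:E.
Proof.
move=> r0.
have mB : measurable [set x : V | enorm x <= 1].
  by apply: compact_measurable_rV; exact: enorm_ball_compact.
have r0' : 0 < r^-1 by rewrite invr_gt0.
have := @pushforward_affine_rV R d r^-1 0 r0' _ mB.
rewrite invrK /pushforward.
have -> : affine_rV r^-1 0 @^-1` [set x : V | enorm x <= 1] = [set x : V | enorm x <= r].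
  apply/seteqP; split => x /=; rewrite /affine_rV addr0 enormZ gtr0_norm// mulrC;
    by rewrite ler_pdivrMr// mul1r.
move=> ->; rewrite EFinM /unit_ball_volume fineK// ge0_fin_numE//.
by apply: lebesgue_rV_compact_lty; exact: enorm_ball_compact.
Qed.

Lemma unit_ball_volume_ge0 : 0 <= unit_ball_volume.
Proof. by rewrite fine_ge0. Qed.

Context (F : R -> R).
Hypotheses (F0 : forall r, 0 <= F r) (mF : measurable_fun setT (F : measurableTypeR R -> measurableTypeR R)).
Hypothesis Fneg : forall r, r <= 0 -> F r = 0.

Let g (x : V) : R := (enorm x ^+ d)^-1.
Let g0 x : 0 <= g x. Proof. by rewrite invr_ge0 exprn_ge0 ?enorm_ge0. Qed.
Let mg : measurable_fun setT (g : V -> measurableTypeR R).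
Proof.
apply: measurable_nonneg_inv; first by move=> x; rewrite exprn_ge0 ?enorm_ge0.
by apply: measurable_funX; exact: measurable_enorm.
Qed.

Let J : \bar R := (\int[lam]_x (F (enorm x) * g x)%:E)%E.

(** The density [|x|^(-d)] is invariant under dilations: its homogeneity cancels the Jacobian. *)
Let J_scale c : 0 < c -> (\int[lam]_x (F (c * enorm x) * g x)%:E = J)%E.
Proof.
move=> c0; have cd0 : 0 < c ^+ d by rewrite exprn_gt0.
have mf : measurable_fun setT (fun x : V => (F (enorm x) * g x)%:E).
  apply/measurable_EFinP; apply: measurable_funM => //.
  by apply: measurableT_comp => //; exact: measurable_enorm.
have f0 x : (0 <= (F (enorm x) * g x)%:E)%E by rewrite lee_fin mulr_ge0.
have := @ge0_integral_affine_rV R d c 0 _ c0 mf f0; rewrite -/J.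
have -> : (fun x : V => (F (enorm (c *: x + 0)) * g (c *: x + 0))%:E) =
    (fun x : V => ((c^-1 ^+ d)%:E * (F (c * enorm x) * g x)%:E)%E).
  apply/funext => x; rewrite addr0 /g enormZ gtr0_norm// exprMn invfM -EFinM exprVn.
  by congr EFin; ring.
rewrite ge0_integralZl//; last 3 first.
- apply/measurable_EFinP; apply: measurable_funM => //.
  apply: measurableT_comp => //; apply: measurable_funM => //; exact: measurable_enorm.
- by move=> x _; rewrite lee_fin mulr_ge0.
- by rewrite lee_fin exprn_ge0// invr_ge0 ltW.
move=> /(congr1 (fun z => ((c ^+ d)%:E * z)%E)).
by rewrite !muleA -EFinM -exprMn divff ?gt_eqF// expr1n !mul1e.
Qed.

(** With [r = c |x|], this is the condition that [c] lies in [1, 2]. *)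
Let S : set (measurableTypeR R * V) := [set p | p.1 / 2 <= enorm p.2 <= p.1].
Let mS : measurable S.
Proof.
have h : measurable_fun setT (fun p : measurableTypeR R * V => (p.1 / 2 <= enorm p.2) && (enorm p.2 <= p.1)).
  apply: measurable_and; apply: measurable_fun_ler => //.
  - by apply: measurable_funM.
  - by apply: measurableT_comp => //; exact: measurable_enorm.
  - by apply: measurableT_comp => //; exact: measurable_enorm.
have mt : measurable [set true] by [].
have := h measurableT [set true] mt.
rewrite setTI; congr (measurable _); apply/seteqP; split => p //=.
Qed.

Let q (r : R) : R := F r / r.
Let q0 r : 0 <= q r.
Proof.
have [r0|r0] := leP r 0; first by rewrite /q Fneg// mul0r.
by rewrite /q divr_ge0// ltW.
Qed.
Let mq : measurable_fun setT (q : measurableTypeR R -> measurableTypeR R).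
Proof.
have -> : q = (fun r => F r * (Num.max 0 r)^-1).
  apply/funext => r; rewrite /q; have [r0|//] := leP r 0.
  by rewrite Fneg// !mul0r.
apply: measurable_funM => //; apply: measurable_nonneg_inv.
  by move=> r; rewrite le_max lexx.
exact: measurable_maxr.
Qed.

(* The integral to bound is invariant under dilations: averaging it over the
   dilation factors [c] in [1, 2] and exchanging the integrals gives a radial
   integral, without polar coordinates. *)
Let K1 (p : measurableTypeR R * V) : \bar R :=
  ((\1_`[1, 2]%classic p.1 : R) * (F (p.1 * enorm p.2) * g p.2))%:E.
Let K1_ge0 p : (0 <= K1 p)%E.
Proof. by rewrite lee_fin !mulr_ge0. Qed.
Let mK1 : measurable_fun setT K1.
Proof.
have m12 : measurable (`[1, 2]%classic : set (measurableTypeR R)) by exact: measurable_itv.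
apply/measurable_EFinP; apply: measurable_funM.
  apply: (@measurableT_comp _ _ _ _ _ _ (\1_`[1, 2]%classic : measurableTypeR R -> measurableTypeR R)) => //.
apply: measurable_funM; last by apply: measurableT_comp.
apply: measurableT_comp => //; apply: measurable_funM => //.
by apply: measurableT_comp => //; exact: measurable_enorm.
Qed.

(** [K1] after the substitution [r = c |x|], with the Jacobian [1 / |x|] replaced by its upper bound
    [2 / r] on [S]. *)
Let K2 (p : measurableTypeR R * V) : \bar R := ((\1_S p : R) * (g p.2 * (2 * q p.1)))%:E.
Let gq0 x r : 0 <= g x * (2 * q r).
Proof. by apply: mulr_ge0 => //; apply: mulr_ge0. Qed.
Let K2_ge0 p : (0 <= K2 p)%E.
Proof. by rewrite lee_fin; apply: mulr_ge0. Qed.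
Let mK2 : measurable_fun setT K2.
Proof.
apply/measurable_EFinP; apply: measurable_funM; first exact: measurable_indic.
apply: measurable_funM; first by apply: measurableT_comp.
by apply: measurable_funM => //; apply: measurableT_comp.
Qed.

Let J_K1 : (J = \int[mu]_c \int[lam]_x K1 (c, x))%E.
Proof.
transitivity (\int[mu]_(c in `[1%R, 2%R]) J)%E.
  have mu12 : mu `[1, 2]%classic = 1%E.
    by apply: etrans (lebesgue_measure_itv `[1, 2]) _; rewrite /= lte_fin ltr1n -EFinB; congr EFin; ring.
  by apply/esym; apply: etrans (integral_cst mu (measurable_itv _) J) _; rewrite [X in (_ * X)%E]mu12 mule1.
rewrite integral_mkcond; apply: eq_integral => c _; rewrite patchE /K1 /=.
case: ifPn => [c12|/negP c12].
  have c0 : 0 < c by move: c12; rewrite inE /= in_itv /= => /andP[+ _]; exact: lt_le_trans.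
  rewrite -(J_scale c0); apply: eq_integral => x _.
  by rewrite indicE c12 mul1r.
rewrite -[LHS](@integral0 _ _ _ lam setT); apply: eq_integral => x _.
by rewrite indicE (negbTE (introN idP c12)) mul0r.
Qed.

Let K1_K2 x : (\int[mu]_c K1 (c, x) <= \int[mu]_r K2 (r, x))%E.
Proof.
have [x0|] := eqVneq x 0.
  rewrite (eq_integral (cst 0%E)); last first.
    by move=> c _; rewrite /K1 /= x0 enorm0 mulr0 Fneg// mul0r mulr0.
  by rewrite integral0; apply: integral_ge0.
rewrite -enorm_gt0 => x0.
have m12 : measurable (`[1, 2]%classic : set (measurableTypeR R)) by exact: measurable_itv.
pose G (r : R) : \bar R := ((\1_`[1, 2]%classic (r * (enorm x)^-1) : R) * (F r * g x))%:E.
have G0 r : (0 <= G r)%E by rewrite lee_fin !mulr_ge0.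
have mG : measurable_fun setT (G : measurableTypeR R -> _).
  apply/measurable_EFinP; apply: measurable_funM; last by apply: measurable_funM.
  apply: (@measurableT_comp _ _ _ _ _ _ (\1_`[1, 2]%classic : measurableTypeR R -> measurableTypeR R)).
    exact: measurable_indic.
  exact: measurable_funM.
have -> : (\int[mu]_c K1 (c, x) = \int[mu]_c G (enorm x * c)%R)%E.
  apply: eq_integral => c _; rewrite /K1 /G /= mulrAC divff ?gt_eqF// mul1r.
  by rewrite (mulrC c).
rewrite ge0_integral_lebesgue_scale// -ge0_integralZl//; last by rewrite lee_fin invr_ge0 ltW.
apply: ge0_le_integral => //.
- by move=> r _; rewrite mule_ge0// lee_fin invr_ge0 ltW.
- exact: measurable_funeM.
- by apply: (@measurableT_comp _ _ _ _ _ _ K2 _ (fun r => (r, x))).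
move=> r _; rewrite /G /K2 -EFinM lee_fin /= !indicE.
case: (boolP (r * (enorm x)^-1 \in _)) => [|_]; last first.
  by rewrite mul0r mulr0; apply: mulr_ge0; [|exact: gq0].
rewrite inE /= in_itv /= ler_pdivlMr// ler_pdivrMr// mul1r => /andP[h1 h2].
have r0 : 0 < r by exact: lt_le_trans h1.
have h3 : r / 2 <= enorm x by rewrite ler_pdivrMr// (mulrC (enorm x)).
rewrite mem_set; last by rewrite /S /= h1 h3.
rewrite !mul1r (_ : g x * (2 * q r) = 2 / r * (F r * g x)); last by rewrite /q; ring.
rewrite ler_wpM2r ?mulr_ge0// -[2 / r]invf_div lef_pV2 ?posrE ?divr_gt0//.
Qed.

(** On [S] one has [|x|^(-d) <= (2 / r)^d], and the slice lies in a ball of volume [r^d] times that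
    of the unit ball. With the factor 2 of [K2] this makes [2^(d+1)]. *)
Let K2_le r : (\int[lam]_x K2 (r, x) <= (2 ^+ d.+1 * unit_ball_volume)%:E * (q r)%:E)%E.
Proof.
have [r0|r0] := leP r 0.
  have qr : q r = 0 by rewrite /q Fneg// mul0r.
  rewrite (eq_integral (cst 0%E)); last by move=> c _; rewrite /K2 /= qr !mulr0.
  by rewrite integral0 qr mule0.
have q2 : 0 <= 2 * q r by apply: mulr_ge0.
have P0 : 0 <= (2 / r) ^+ d * (2 * q r).
  by apply: mulr_ge0 => //; rewrite exprn_ge0// divr_ge0// ltW.
have mB : measurable [set x : V | (enorm x <= r)%R].
  by apply: compact_measurable_rV; exact: enorm_ball_compact.
apply: (@le_trans _ _ (\int[lam]_x (((2 / r) ^+ d * (2 * q r))%:E * (\1_[set x : V | (enorm x <= r)%R] x)%:E))%E).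
  apply: ge0_le_integral => //.
  - by apply: (@measurableT_comp _ _ _ _ _ _ K2 _ (fun x => (r, x))) => //; exact: measurable_fun_pair.
  - apply: measurable_funeM; apply/measurable_EFinP; exact: measurable_indic.
  - move=> x _; rewrite -EFinM lee_fin /= !indicE.
    case: (boolP ((r, x) \in S)) => [|_]; last by rewrite mul0r; apply: mulr_ge0.
    rewrite inE /S /= => /andP[h1 h2]; rewrite mem_set// mul1r mulr1.
    have r2 : 0 < r / 2 by rewrite divr_gt0.
    rewrite ler_wpM2r// /g -exprVn lerXn2r ?nnegrE ?invr_ge0 ?enorm_ge0 ?divr_ge0 ?(ltW r0)//.
    by rewrite -[2 / r]invf_div lef_pV2 ?posrE// (lt_le_trans r2).
rewrite ge0_integralZl//; last by apply/measurable_EFinP; exact: measurable_indic.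
rewrite integral_indic// setIT [X in (_ * X)%E](_ : _ = (r ^+ d * unit_ball_volume)%:E);
  last exact: lebesgue_ball.
rewrite -!EFinM lee_fin le_eqVlt; apply/orP; left; apply/eqP.
have rd : r ^+ d != 0 by rewrite expf_neq0// gt_eqF.
rewrite expr_div_n [2 ^+ d.+1]exprS; move: rd.
by move: (2 ^+ d) (r ^+ d) (q r) (unit_ball_volume) => a b c o b0; field.
Qed.

Lemma polar_le : (\int[lam]_x (F (enorm x) * (enorm x ^+ d)^-1)%:E <=
   (2 ^+ d.+1 * unit_ball_volume)%:E * \int[mu]_(r in `]0%R, +oo[) (F r / r)%:E)%E.
Proof.
rewrite -/J J_K1 fubini_tonelli//.
apply: (@le_trans _ _ (\int[lam]_x \int[mu]_r K2 (r, x))%E).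
  apply: ge0_le_integral => //.
  - by move=> x _; apply: integral_ge0.
  - exact: measurable_fun_fubini_tonelli_G.
  - exact: measurable_fun_fubini_tonelli_G.
rewrite -fubini_tonelli// -ge0_integralZl//; last 3 first.
- by apply/measurable_EFinP; exact: measurable_funTS.
- by move=> r _; rewrite lee_fin; exact: q0.
- by rewrite lee_fin mulr_ge0 ?exprn_ge0 ?unit_ball_volume_ge0.
rewrite [leRHS]integral_mkcond; apply: ge0_le_integral => //.
- by move=> r _; apply: integral_ge0.
- exact: measurable_fun_fubini_tonelli_F.
- apply/(measurable_restrictT _ _).1 => //; apply: measurable_funeM.
  by apply/measurable_EFinP; exact: measurable_funTS.
move=> r _; rewrite patchE; case: ifPn => [_|]; first exact: K2_le.
move=> /negP; rewrite inE /= in_itv /= andbT => /negP; rewrite -leNgt => r0.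
by apply: le_trans (K2_le r) _; rewrite /q Fneg// mul0r mule0.
Qed.

End polar.

(** * The flow modulus and the inverse flow *)

Section flow_modulus_theory.
Context (R : realType) (d : nat).
Local Notation V := 'rV[R]_d.
Context (m : R) (phi : R -> R) (u : R -> V -> V).
Hypotheses (osg : osgood_modulus m phi) (umod : field_has_modulus m phi u).

Let a (s : R) : R := field_seminorm m phi (u s).

(** Finiteness matters: [Rintegral] would turn an infinite integral into 0. As the seminorm need not
    be measurable in time, the comparison is made between lower integrals. *)
Lemma flow_exponent_mono t T : 0 <= t -> t <= T ->
  0 <= (\int[lebesgue_measure]_(s in `[0%R, t]) a s)%R <=
       (\int[lebesgue_measure]_(s in `[0%R, T]) a s)%R.
Proof.
move=> t0 tT; have [C C0 aC] := field_seminorm_itv osg umod.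
have a0 r s : `[0%R, r]%classic s -> (0 <= (a s)%:E)%E.
  by rewrite /= in_itv /= => /andP[s0 _]; rewrite lee_fin; case/andP: (aC s s0).
have int0 r : (0 <= \int[lebesgue_measure]_(s in `[0%R, r]) (a s)%:E)%E.
  by apply: integral_ge0 => s; exact: a0.
have intoo : (\int[lebesgue_measure]_(s in `[0%R, T]) (a s)%:E < +oo)%E.
  apply: (@le_lt_trans _ _ (\int[lebesgue_measure]_(s in `[0%R, T]) C%:E)%E).
    apply: ge0_le_lower_integral => //.
    - by move=> s; exact: a0.
    - by move=> s; rewrite /= in_itv /= => /andP[s0 _]; rewrite lee_fin; case/andP: (aC s s0).
  rewrite integral_cst//= lebesgue_measure_itv /= lte_fin.
  by case: ifPn => _; rewrite ?mule0 ?ltry// -EFinB -EFinM ltry.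
have le : (\int[lebesgue_measure]_(s in `[0%R, t]) (a s)%:E <=
    \int[lebesgue_measure]_(s in `[0%R, T]) (a s)%:E)%E.
  apply: ge0_le_lower_integral => //.
  - by apply: subset_itvl; rewrite bnd_simp.
  - by move=> s; exact: a0.
  - by move=> s; exact: a0.
rewrite /Rintegral fine_ge0//=; apply: fine_le => //.
- by rewrite ge0_fin_numE// (le_lt_trans le).
- by rewrite ge0_fin_numE.
Qed.

Lemma osgood_R_lt x y : 0 < x -> x < y -> y < m -> osgood_R m phi x < osgood_R m phi y.
Proof. by move=> x0 xy ym; rewrite ltr_expR ltrN2 (osgood_M_lt osg). Qed.

Lemma osgood_R_le_inv x y : 0 < y -> x < m -> osgood_R m phi x <= osgood_R m phi y -> x <= y.
Proof.
by move=> y0 xm; rewrite leNgt => /negP Rxy; rewrite leNgt; apply/negP => yx; apply/Rxy/osgood_R_lt.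
Qed.

Lemma osgood_RK z : 0 < z -> z < m -> osgood_Rinv m phi (osgood_R m phi z) = z.
Proof.
move=> z0 zm; rewrite /osgood_Rinv.
have [/andP[x0 xm] Rx] : [set z' | 0 < z' < m /\ osgood_R m phi z' = osgood_R m phi z]
    (xget 0 [set z' | 0 < z' < m /\ osgood_R m phi z' = osgood_R m phi z]).
  by apply: (xgetI _ (x := z)); rewrite /= z0 zm.
apply/eqP; rewrite eq_le; apply/andP.
by split; apply: osgood_R_le_inv; [exact: z0|exact: xm|rewrite Rx|exact: x0|exact: zm|rewrite Rx].
Qed.

Lemma flow_modulusP t r : flow_modulus_dom m phi u t r ->
  [/\ 0 < r, r < m, 0 < flow_modulus m phi u t r, flow_modulus m phi u t r < m &
  osgood_R m phi (flow_modulus m phi u t r) = flow_factor m phi u t * osgood_R m phi r].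
Proof.
by move=> [/andP[r0 rm] [z /andP[z0 zm] zE]]; rewrite /flow_modulus -zE osgood_RK.
Qed.

Lemma flow_modulus_mono T r1 r2 : flow_modulus_dom m phi u T r1 -> flow_modulus_dom m phi u T r2 ->
  r1 <= r2 -> flow_modulus m phi u T r1 <= flow_modulus m phi u T r2.
Proof.
move=> /flow_modulusP[r10 r1m z10 z1m E1] /flow_modulusP[r20 r2m z20 z2m E2].
rewrite le_eqVlt => /predU1P[->|r12]; first exact: lexx.
have Fr : flow_factor m phi u T * osgood_R m phi r1 <= flow_factor m phi u T * osgood_R m phi r2.
  apply: ler_wpM2l; first exact: expR_ge0.
  exact: (ltW (osgood_R_lt r10 r12 r2m)).
move: E1 E2 z20 z1m Fr.
move: (flow_modulus _ _ _ _ _) (flow_modulus _ _ _ _ _).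
move=> z1 z2 E1 E2 z20 z1m Fr.
by apply: (osgood_R_le_inv z20 z1m); rewrite E1 E2.
Qed.

(** The factor at time [t] lies between 1 and the factor at [T]. The value to be attained thus lies
    between those of [osgood_R] at [r] and at the modulus for [T], and the intermediate value
    theorem applies. *)
Lemma flow_modulus_dom_le t T r : 0 <= t -> t <= T -> flow_modulus_dom m phi u T r ->
  flow_modulus_dom m phi u t r /\ flow_modulus m phi u t r <= flow_modulus m phi u T r.
Proof.
move=> t0 tT /flow_modulusP[r0 rm z0 zm zE].
set z := flow_modulus m phi u T r in z0 zm zE *.
have /andP[I0 It] := flow_exponent_mono t0 tT.
have Rr : 0 < osgood_R m phi r by exact: expR_gt0.
have F1 : 1 <= flow_factor m phi u t by rewrite -expR0 ler_expR.
have FT : flow_factor m phi u t <= flow_factor m phi u T by rewrite ler_expR.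
have h1 : osgood_R m phi r <= flow_factor m phi u t * osgood_R m phi r by rewrite ler_peMl ?(ltW Rr).
have h2 : flow_factor m phi u t * osgood_R m phi r <= osgood_R m phi z by rewrite zE ler_pM2r.
have rz : r <= z := osgood_R_le_inv z0 rm (le_trans h1 h2).
have cR : {within `[r, z], continuous (osgood_R m phi)}.
  apply: continuous_in_subspaceT => x; rewrite inE /= in_itv /= => /andP[rx _].
  apply: (@continuous_comp _ _ _ (fun x => - osgood_M m phi x) (@expR R)); last exact: continuous_expR.
  by apply: (@continuousN _ _ _ _ x); apply: (osgood_M_continuous osg); exact: lt_le_trans rx.
have [] := @IVT R _ r z (flow_factor m phi u t * osgood_R m phi r) rz cR.
  apply/andP; split; first by rewrite ge_min; apply/orP; left; exact: h1.
  by rewrite le_max; apply/orP; right; exact: h2.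
move=> y; rewrite in_itv /= => /andP[ry yz] yE.
have y0 : 0 < y by exact: lt_le_trans ry.
have ym : y < m by exact: le_lt_trans yz zm.
split; first by split; [rewrite r0 rm|exists y; rewrite // y0].
by rewrite /flow_modulus -yE osgood_RK.
Qed.

Context (X Xinv : R -> V -> V).
Hypothesis flowX : is_flow u X.
Hypothesis XK : forall t, 0 <= t -> cancel (X t) (Xinv t).
Hypothesis XinvK : forall t, 0 <= t -> cancel (Xinv t) (X t).

(** Write [r = |x - y|], [z] for the modulus at [r], [p] for the distance of the preimages and [I]
    for the integral of the seminorm. In logarithmic form the definition of [z] reads
    [M z = M r - I]; the estimate along the trajectories of the preimages gives [M p >= M r - I]. As
    [M] decreases, [p <= z]. *)
Lemma flow_inv_modulus t x y : 0 <= t -> flow_modulus_dom m phi u t (enorm (x - y)) ->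
  enorm (Xinv t x - Xinv t y) <= flow_modulus m phi u t (enorm (x - y)).
Proof.
move=> t0 /flow_modulusP[r0 rm z0 zm zE].
set z := flow_modulus m phi u t _ in z0 zm zE *.
have xy : Xinv t x != Xinv t y.
  apply: contraTneq r0 => /(can_inj (XinvK t0)) ->.
  by rewrite subrr enorm0 ltxx.
have Xinj s : 0 <= s -> injective (X s) by move=> s0; exact: can_inj (XK s0).
have := osgood_flow_estimate osg umod flowX Xinj t0 xy.
rewrite (XinvK t0 x) (XinvK t0 y).
move: zE; rewrite /osgood_R /flow_factor -expRD => /expR_inj zE.
have p0 : 0 < enorm (Xinv t x - Xinv t y) by rewrite enorm_gt0 subr_eq0.
move: (enorm (x - y)) (enorm (Xinv t x - Xinv t y)) (z) p0 r0 rm z0 zm zE => {xy} r p {}z.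
move=> p0 r0 rm z0 zm; move: (Rintegral _ _ _) => I zE pE.
rewrite leNgt; apply/negP => zp.
have : osgood_M m phi p < osgood_M m phi z.
  have [pm|mp] := ltP p m; first exact: (osgood_M_lt osg z0 zp pm).
  by rewrite (osgood_M_ge _ mp); exact: (osgood_M_gt0 osg z0 zm).
move: zE pE; move: (osgood_M m phi p) (osgood_M m phi z) (osgood_M m phi r) => Mp Mz Mr.
by lra.
Qed.

End flow_modulus_theory.

(** * The double integral of increments *)

Section fractional_bound.
Context (R : realType) (n : nat).
Local Notation d := n.+1.
Local Notation V := 'rV[R]_d.
Let lam := lebesgue_rV R d.
Let mu := @lebesgue_measure R.

(** Here [f] stands for the modulus at time [t] and [F] for the one at time [T]. The weight removes
    one of the two factors [f] of the square and the other is raised to [F]. *)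
Lemma sqr_increment_le (a b q f F : R) : 0 < f -> f <= F -> 0 <= q -> q <= (a + b) * f ->
  q ^+ 2 * f^-1 <= 2 * F * (a ^+ 2 + b ^+ 2).
Proof.
move=> f0 fF q0 qf; have ab0 : 0 <= a + b by rewrite -(pmulr_lge0 _ f0) (le_trans q0).
have h1 : q ^+ 2 <= ((a + b) * f) ^+ 2.
  by rewrite ler_pXn2r// nnegrE ?mulr_ge0// ltW.
have h2 : ((a + b) * f) ^+ 2 * f^-1 = (a + b) ^+ 2 * f by field; rewrite gt_eqF.
have h3 : (a + b) ^+ 2 <= 2 * (a ^+ 2 + b ^+ 2) by rewrite -subr_ge0 (_ : _ - _ = (a - b) ^+ 2) ?sqr_ge0//; ring.
have h4 : (a + b) ^+ 2 * f <= 2 * (a ^+ 2 + b ^+ 2) * F.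
  by apply: ler_pM => //; [exact: sqr_ge0|exact: ltW].
rewrite [leRHS]mulrAC; apply: le_trans h4; rewrite -h2 ler_wpM2r// invr_ge0 ltW//.
Qed.

Lemma integral_translation (h : V) (f : V -> \bar R) : measurable_fun setT f ->
  (forall x, 0 <= f x)%E -> (\int[lam]_x f ((x : V) + h)%R = \int[lam]_x f x)%E.
Proof.
move=> mf f0; have := @ge0_integral_affine_rV R d 1 h f ltr01 mf f0.
rewrite invr1 expr1n mul1e => <-.
by apply: eq_integral => x _; rewrite scale1r.
Qed.

Context (Th G : V -> R) (f F : R -> R).
Hypothesis mG : measurable_fun setT (G : V -> measurableTypeR R).
Hypothesis f_gt0 : forall r, 0 < r -> r < 1 -> 0 < f r.
Hypothesis fF : forall r, 0 < r -> r < 1 -> f r <= F r.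
Hypothesis mF : measurable_fun (`]0, 1[%classic : set (measurableTypeR R)) (F : _ -> measurableTypeR R).
Hypothesis ThG : forall x y, 0 < enorm (x - y) -> enorm (x - y) < 1 ->
  `|Th x - Th y| <= (G x + G y) * f (enorm (x - y)).

(** Extension by zero: the radial bound asks for a function on the whole line that vanishes for
    [r <= 0]. *)
Let F1 : R -> R := F \_ `]0, 1[%classic.

Let F1_ge0 r : 0 <= F1 r.
Proof.
rewrite /F1 patchE; case: ifPn => [|//].
by rewrite inE /= in_itv/= => /andP[r0 r1]; exact: ltW (lt_le_trans (f_gt0 r0 r1) (fF r0 r1)).
Qed.

Let F1_le0 r : r <= 0 -> F1 r = 0.
Proof.
move=> r0; rewrite /F1 patchE; case: ifPn => //.
by rewrite inE /= in_itv/= => /andP[/lt_le_trans/(_ r0)]; rewrite ltxx.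
Qed.

Let F1E r : 0 < r -> r < 1 -> F1 r = F r.
Proof. by move=> r0 r1; rewrite /F1 patchE mem_set//= in_itv/= r0 r1. Qed.

Let mF1 : measurable_fun setT (F1 : measurableTypeR R -> measurableTypeR R).
Proof. by apply: (measurable_restrictT _ _).1 => //; exact: measurable_itv. Qed.

Let G2 (x : V) : \bar R := (G x ^+ 2)%:E.
Let mG2 : measurable_fun setT G2.
Proof. by apply/measurable_EFinP; exact: measurable_funX. Qed.
Let G2_ge0 x : (0 <= G2 x)%E. Proof. by rewrite lee_fin sqr_ge0. Qed.
Let N : \bar R := (\int[lam]_x G2 x)%E.

(** One 2 comes from the square of the sum; the other from the two terms, at [x] and at [x + h],
    whose integrals agree by translation invariance. Nothing is assumed on the measurability of
    [Th], so lower integrals are compared. *)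
Let inner h : enorm h < 1 ->
  (\int[lam]_x (`|Th x - Th (x + h)| ^+ 2 / enorm h ^+ d * (f (enorm h))^-1)%:E <=
   (4 * (F1 (enorm h) * (enorm h ^+ d)^-1))%:E * N)%E.
Proof.
move=> h1; set r := enorm h; set c := F1 r * (r ^+ d)^-1.
have c0 : 0 <= c by rewrite mulr_ge0// invr_ge0 exprn_ge0// enorm_ge0.
have cN : (\int[lam]_x ((2 * c)%:E * (G2 x + G2 ((x : V) + h)%R)) = (4 * c)%:E * N)%E.
  have mGh : measurable_fun setT (fun x : V => G2 (x + h)).
    have -> : (fun x : V => G2 (x + h)) = G2 \o affine_rV 1 h.
      by apply/funext => x /=; rewrite /affine_rV scale1r.
    by apply: measurableT_comp => //; exact: measurable_affine_rV.
  have NN : (N + N = 2%:E * N)%E.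
    by rewrite -[in LHS](mul1e N) -ge0_muleDl ?lee_fin// -EFinD.
  rewrite ge0_integralZl; last 2 first.
  - by move=> x _; rewrite adde_ge0.
  - by rewrite lee_fin mulr_ge0.
  - rewrite ge0_integralD//.
    rewrite (@integral_translation h G2)// -/N NN muleA -EFinM.
    by congr (_%:E * _)%E; ring.
  - exact: measurableT.
  - exact: emeasurable_funD.
rewrite -cN; apply: ge0_le_lower_integral => //.
(* For [h = 0] the quotient is 0 by the convention that the inverse of 0 is 0. *)
- have [r0|r0] := leP r 0.
    move=> x _; have -> : r = 0 by apply/eqP; rewrite eq_le r0 enorm_ge0.
    by rewrite expr0n /= invr0 mulr0 mul0r lexx.
  move=> x _; rewrite lee_fin mulr_ge0//; last by rewrite invr_ge0 ltW// f_gt0.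
  by rewrite mulr_ge0 ?sqr_ge0// invr_ge0 exprn_ge0// enorm_ge0.
- by move=> x _; rewrite mule_ge0 ?adde_ge0// lee_fin mulr_ge0.
move=> x _; rewrite /G2 -EFinD -EFinM lee_fin.
have [r0|r0] := leP r 0.
  have -> : r = 0 by apply/eqP; rewrite eq_le r0 enorm_ge0.
  rewrite expr0n /= invr0 mulr0 mul0r mulr_ge0//; first by rewrite mulr_ge0.
  by rewrite addr_ge0 ?sqr_ge0.
have rE : enorm (x - (x + h)) = r by rewrite opprD addNKr enormN.
have := @ThG x (x + h); rewrite rE => /(_ r0 h1) ThGh.
have := sqr_increment_le (f_gt0 r0 h1) (fF r0 h1) (normr_ge0 _) ThGh.
rewrite -(F1E r0 h1) => le.
by rewrite mulrAC /c mulrA [leRHS]mulrAC ler_wpM2r// ?invr_ge0 ?exprn_ge0// ?enorm_ge0//.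
Qed.

(** The bound on the inner integral depends on [h] through its length only, so [polar_le] turns the
    outer integral into a radial one. *)
Lemma fractional_bound :
  (\int[lam]_(h in [set h | (enorm h < 1)%R])
     \int[lam]_x (`|Th x - Th (x + h)| ^+ 2 / enorm h ^+ d * (f (enorm h))^-1)%:E <=
   (4 * (2 ^+ d.+1 * unit_ball_volume R n))%:E * N *
   \int[mu]_(r in `]0%R, 1%R[) (F r / r)%:E)%E.
Proof.
have N0 : (0 <= N)%E by apply: integral_ge0.
have K0 h : 0 <= F1 (enorm h) * (enorm h ^+ d)^-1.
  by rewrite mulr_ge0// invr_ge0 exprn_ge0// enorm_ge0.
apply: (@le_trans _ _ (\int[lam]_h ((F1 (enorm h) * (enorm h ^+ d)^-1)%:E * (4%:E * N)))%E).
  apply: ge0_le_lower_integral => //.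
  - move=> h /= h1; apply: integral_ge0 => x _; rewrite lee_fin.
    have [->|h0] := eqVneq h 0; first by rewrite enorm0 expr0n /= invr0 mulr0 mul0r.
    rewrite mulr_ge0//; last by rewrite invr_ge0 ltW// f_gt0// enorm_gt0.
    by rewrite mulr_ge0 ?sqr_ge0// invr_ge0 exprn_ge0// enorm_ge0.
  - by move=> h _; rewrite mule_ge0 ?mule_ge0// lee_fin.
  - by move=> h /= h1; rewrite muleA -EFinM [X in X%:E]mulrC; exact: inner.
have m1 : measurable_fun setT (fun h : V => (F1 (enorm h) * (enorm h ^+ d)^-1)%:E).
  apply/measurable_EFinP; apply: measurable_funM.
    by apply: measurableT_comp => //; exact: measurable_enorm.
  apply: measurable_nonneg_inv; first by move=> x; rewrite exprn_ge0 ?enorm_ge0.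
  by apply: measurable_funX; exact: measurable_enorm.
rewrite ge0_integralZr//; [|by move=> h _; rewrite lee_fin|by rewrite mule_ge0].
have := @polar_le R n F1 F1_ge0 mF1 F1_le0.
have -> : (\int[mu]_(r in `]0%R, +oo[) (F1 r / r)%:E = \int[mu]_(r in `]0%R, 1%R[) (F r / r)%:E)%E.
  rewrite integral_mkcond [RHS]integral_mkcond; apply: eq_integral => r _.
  rewrite !patchE; have [r0|r0] := ltP 0 r.
    rewrite mem_set/=; last by rewrite in_itv/= r0.
    by rewrite /F1 patchE; case: ifPn => // _; rewrite mul0r.
  by rewrite !memNset//= in_itv/= ltNge r0.
set P := (\int[_]_x _)%E; set A := (\int[_]_(x in _) _)%E => PA.
apply: (@le_trans _ _ ((2 ^+ d.+1 * unit_ball_volume R n)%:E * A * (4%:E * N))%E).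
  by apply: lee_wpmul2r => //; rewrite mule_ge0.
rewrite (EFinM 4) -!muleA le_eqVlt; apply/predU1P; left.
by rewrite (muleC A) -(muleA 4%:E) [LHS]muleCA.
Qed.

End fractional_bound.

(** * The norm of [g] and its transport by the flow *)

Section L2.
Context (R : realType) (d : nat).
Local Notation V := 'rV[R]_d.
Let lam := lebesgue_rV R d.

Lemma Lfun2_sqr_norm (g : V -> R) :
  (('N[lam]_2%:E[EFin \o g]) ^+ 2 = \int[lam]_x (g x ^+ 2)%:E)%E.
Proof.
have h : (2 : R) != 0 by [].
have := @poweR_Lnorm _ _ _ lam (EFin \o g) 2 h.
set N := ('N[_]_ _ [_])%E => NE.
have -> : (\int[lam]_x (g x ^+ 2)%:E = N `^ 2)%E.
  rewrite NE; apply: eq_integral => x _ /=.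
  by rewrite powR_mulrn ?normr_ge0// real_normK ?num_real.
have N0 : (0 <= N)%E by exact: Lnorm_ge0.
case: N N0 {NE} => [r|_|//]; last by rewrite poweRyr.
by rewrite lee_fin => r0; rewrite poweR_EFin powR_mulrn.
Qed.

End L2.

Lemma integral_flow_inv (R : realType) (d : nat) (m : R) (phi : R -> R)
    (u X Xinv : R -> 'rV[R]_d -> 'rV[R]_d) (t : R) (f : 'rV[R]_d -> \bar R) :
  osgood_modulus m phi -> field_has_modulus m phi u -> divergence_free u -> is_flow u X ->
  (forall s, 0 <= s -> cancel (X s) (Xinv s)) -> (forall s, 0 <= s -> cancel (Xinv s) (X s)) ->
  0 <= t -> measurable_fun setT f -> (forall x, 0 <= f x)%E ->
  (\int[lebesgue_rV R d]_x f (Xinv t x) = \int[lebesgue_rV R d]_x f x)%E.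
Proof.
move=> osg umod udiv flowX XK XinvK t0 mf f0.
have mX : measurable_fun setT (Xinv t).
  exact: continuous_measurable_rV_rV (flow_inv_continuous osg umod flowX XinvK t0).
have := @ge0_integral_pushforward _ _ _ _ _ _ mX (lebesgue_rV R d) setT f measurableT mf.
rewrite preimage_setT => <-; last by move=> x _; exact: f0.
apply: eq_measure_integral => A mA _.
exact: (flow_inv_measure_preserving osg umod udiv flowX XK XinvK t0 mA).
Qed.

Theorem theorem2 (R : realType) (d : nat) (hd : (0 < d)%N) :
  exists C : R, 0 < C /\
  forall (m : R) (phi mu0 : R -> R) (u : R -> 'rV[R]_d -> 'rV[R]_d)
    (theta0 : 'rV[R]_d -> R) (theta : R -> 'rV[R]_d -> R),
    osgood_modulus m phi ->
    field_has_modulus m phi u ->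
    divergence_free u ->
    modulus_of_continuity mu0 ->
    transport_solution u theta0 theta ->
    (has_modulus `[0, +oo[ mu0 theta0 ->
     forall t : R, 0 <= t ->
       has_modulus (flow_modulus_dom m phi u t)
         (mu0 \o flow_modulus m phi u t) (theta t))
    /\
    (forall (T : R) (g : 'rV[R]_d -> R),
       let A := (\int[lebesgue_measure]_(r in `]0%R, 1%R[)
                   (mu0 (flow_modulus m phi u T r) / r)%:E)%E in
       0 < T ->
       (forall r : R, 0 < r < 1 -> flow_modulus_dom m phi u T r) ->
       (A < +oo)%E ->
       g \in Lfun (lebesgue_rV R d) 2%:E ->
       (forall x y, `|theta0 x - theta0 y| <= (g x + g y) * mu0 (enorm (x - y))) ->
       forall t : R, 0 <= t <= T ->
       (\int[lebesgue_rV R d]_(h in [set h | (enorm h < 1)%R])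
          \int[lebesgue_rV R d]_x
            (`|theta t x - theta t (x + h)| ^+ 2 / enorm h ^+ d
               * (mu0 (flow_modulus m phi u t (enorm h)))^-1)%:E
        <= C%:E * ('N[lebesgue_rV R d]_2%:E[EFin \o g]) ^+ 2 * A)%E).
Proof.
case: d hd => // n _; set d := n.+1.
pose K := 4 * (2 ^+ d.+1 * unit_ball_volume R n).
have K0 : 0 <= K.
  by rewrite /K mulr_ge0// mulr_ge0 ?unit_ball_volume_ge0 ?exprn_ge0.
(* [K] is only known to be nonnegative here; adding 1 makes the constant positive. *)
exists (K + 1); split; first by rewrite ltr_wpDl.
move=> m phi mu0 u theta0 theta osg umod udiv [mu_le mu_gt0 _] [X [Xinv [flowX sol]]].
have XK s : 0 <= s -> cancel (X s) (Xinv s) by move=> s0; have [] := sol s s0.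
have XinvK s : 0 <= s -> cancel (Xinv s) (X s) by move=> s0; have [] := sol s s0.
have thetaE s x : 0 <= s -> theta s x = theta0 (Xinv s x) by move=> s0; have [] := sol s s0.
have inv_modulus := flow_inv_modulus osg umod flowX XK XinvK.
split=> [[C [C0 theta0C]] t t0|T g A T0 domT Aoo gL2 theta0g t /andP[t0 tT]].
  exists C; split=> // x y xy; rewrite !thetaE//=.
  have := theta0C (Xinv t x) (Xinv t y); rewrite /= in_itv/= andbT enorm_ge0 => /(_ isT) h.
  apply: (le_trans h); rewrite (ler_pM2l C0); apply: mu_le; first exact: enorm_ge0.
  exact: inv_modulus t x y t0 xy.
have domt r : 0 < r -> r < 1 -> flow_modulus_dom m phi u t r /\
    flow_modulus m phi u t r <= flow_modulus m phi u T r.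
  move=> r0 r1; apply: (flow_modulus_dom_le osg umod t0 tT); apply: domT.
  by apply/andP; split; [exact: r0|exact: r1].
have mg : measurable_fun setT (g : _ -> measurableTypeR R).
  by have /andP[/[!inE]] := gL2.
have mX : measurable_fun setT (Xinv t).
  exact: continuous_measurable_rV_rV (flow_inv_continuous osg umod flowX XinvK t0).
have f_gt0 r : 0 < r -> r < 1 -> 0 < mu0 (flow_modulus m phi u t r).
  by move=> r0 r1; have [/(flow_modulusP osg)[_ _ h _ _] _] := domt r r0 r1; exact: mu_gt0.
have fF r : 0 < r -> r < 1 -> mu0 (flow_modulus m phi u t r) <= mu0 (flow_modulus m phi u T r).
  move=> r0 r1; have [/(flow_modulusP osg)[_ _ h _ _] h'] := domt r r0 r1.
  exact: mu_le (ltW h) h'.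
(* The modulus at time [T] is measurable on (0, 1) as a composite of monotone functions. *)
have mF : measurable_fun (`]0, 1[%classic : set (measurableTypeR R))
    (fun r => mu0 (flow_modulus m phi u T r) : measurableTypeR R).
  apply: monotone_itv_measurable; first exact: interval_is_interval.
  move=> r s /=; rewrite !in_itv/= => r01 s01 rs.
  have dr := domT r r01; have ds := domT s s01.
  have [_ _ h _ _] := flow_modulusP osg dr.
  by apply: mu_le; [exact: ltW h|exact: (flow_modulus_mono osg dr ds rs)].
have thG x y : 0 < enorm (x - y) -> enorm (x - y) < 1 ->
    `|theta t x - theta t y| <= (g (Xinv t x) + g (Xinv t y)) * mu0 (flow_modulus m phi u t (enorm (x - y))).
  move=> xy0 xy1; have [dxy _] := domt _ xy0 xy1.
  have xy : 0 < enorm (Xinv t x - Xinv t y).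
    rewrite enorm_gt0 subr_eq0; apply: contraTneq xy0 => /(can_inj (XinvK t t0)) ->.
    by rewrite subrr enorm0 ltxx.
  have h := theta0g (Xinv t x) (Xinv t y).
  (* The sign of [g] is not prescribed. The sum is nonnegative because its product with a positive
     value of [mu0] bounds an absolute value; the preimages are distinct, so this value is
     positive. *)
  have g0 : 0 <= g (Xinv t x) + g (Xinv t y).
    by rewrite -(pmulr_lge0 _ (mu_gt0 _ xy)); apply: le_trans h; exact: normr_ge0.
  rewrite !thetaE//; apply: (le_trans h); apply: (ler_wpM2l g0).
  by apply: mu_le; [exact: enorm_ge0|exact: inv_modulus t x y t0 dxy].
have mG : measurable_fun setT (fun x => g (Xinv t x) : measurableTypeR R).
  exact: measurableT_comp mg mX.
have := fractional_bound mG f_gt0 fF mF thG.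
rewrite (@integral_flow_inv _ _ _ _ _ _ _ t (fun x => (g x ^+ 2)%:E) osg umod udiv flowX
  XK XinvK t0); last 2 first.
- exact/measurable_EFinP/measurable_funX.
- by move=> x; rewrite lee_fin sqr_ge0.
rewrite -Lfun2_sqr_norm -/A -/K => /le_trans; apply.
have A0 : (0 <= A)%E.
  apply: integral_ge0 => r /=; rewrite in_itv/= => /andP[r0 r1].
  rewrite lee_fin; apply: (divr_ge0 _ (ltW r0)).
  exact: (le_trans (ltW (f_gt0 r r0 r1)) (fF r r0 r1)).
apply: (lee_wpmul2r A0); apply: lee_wpmul2r; first by rewrite expe_ge0 ?Lnorm_ge0.
by rewrite lee_fin lerDl.
Qed.
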